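(* Let $X$ be a symmetric space on $[0,1]$ which satisfies a lower $2$-estimate and such that $X\supset L_2[0,1]$, and let the associated (Köthe dual) space $X'$ have the Kruglov property. Then $X$ has the property (IR): there exists $\gamma>0$ such that for any $N\in\mathbb N$ and arbitrary independent functions $f_1,\ldots,f_N\in X$ with $\int_0^1 f_k(x)\,dx=0$ and $\|f_k\|_X\ge 1$, $k=1,\ldots,N$, we have $$d_{\gamma N}(\{f_1,\ldots,f_N\},X)\ge\gamma .$$
   Context: All functions are real-valued Lebesgue measurable functions on $[0,1]$ with Lebesgue measure $m$ (modulo a.e. equality); independence is with respect to $m$. Symmetric space (s.s.) on $[0,1]$: a Banach space $X$ of measurable functions on $[0,1]$ such that (1) if $x\in X$ and $y$ is measurable with $|y|\le|x|$ a.e., then $y\in X$ and $\|y\|_X\le\|x\|_X$; (2) if $x\in X$ and $|x|,|y|$ are identically distributed, then $y\in X$ and $\|y\|_X=\|x\|_X$. It is assumed throughout that $\|\chi_{[0,1]}\|_X=1$. Associated space: $X'$ is the set of measurable $y$ with $\|y\|_{X'}:=\sup\{\int_0^1 x(t)y(t)\,dt:\ \|x\|_X\le1\}<\infty$; it is again a symmetric space. Lower $2$-estimate: there is $C_X>0$ such that for all $N$ and all pairwise disjoint (i.e. disjointly supported) $x_1,\ldots,x_N\in X$, $\|\sum_{k=1}^N x_k\|_X\ge C_X^{-1}(\sum_{k=1}^N\|x_k\|_X^2)^{1/2}$. Kruglov property: for a measurable $f$ on $[0,1]$ let $\pi(f)$ be the random variable $\sum_{k=1}^{\mathcal N}f_k$,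 where $f_1,f_2,\dots$ are independent copies of $f$ and $\mathcal N$ is a Poisson random variable with parameter $1$ independent of $\{f_k\}$. A symmetric space $Y$ has the Kruglov property if $f\in Y$ implies $\pi(f)\in Y$ (i.e. a function on $[0,1]$ with the same distribution as $\pi(f)$ belongs to $Y$). Kolmogorov width: for $K\subset X$, $d_n(K,X):=\inf_{\dim V\le n}\sup_{x\in K}\inf_{v\in V}\|x-v\|_X$, the infimum over linear subspaces $V\subset X$ of dimension at most $n$; for non-integer $r$, $d_r:=d_{\lfloor r\rfloor}$. *)

(* Defs.v *)
From HB Require Import structures.
From mathcomp Require Import all_boot all_order all_algebra.
From mathcomp Require Import finmap.
From mathcomp Require Import all_classical all_reals all_analysis.

Set Implicit Arguments.
Unset Strict Implicit.
Unset Printing Implicit Defensive.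

Import Order.TTheory GRing.Theory Num.Theory.
Import numFieldNormedType.Exports.

Local Open Scope classical_set_scope.
Local Open Scope ring_scope.

(* A function on [0,1] is represented by a map [R -> R] whose values outside
   [0,1] are never used. Measurability is with respect to the Borel sets: every
   Lebesgue measurable function is a.e. equal to a Borel one, so the classes
   modulo a.e. equality are the same. *)

Definition unit_itv (R : realType) : set R := `[0, 1].
Arguments unit_itv : clear implicits.

Definition ae01 (R : realType) (P : R -> Prop) : Prop :=
  {ae (@lebesgue_measure R), forall t, unit_itv R t -> P t}.

Definition mfun01 (R : realType) (x : R -> R) : Prop :=
  measurable_fun (unit_itv R) x.

Definition prob01 (R : realType) (A : set R) : \bar R :=
  lebesgue_measure (unit_itv R `&` A).

Definition int01 (R : realType) (x : R -> R) : \bar R :=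
  (\int[lebesgue_measure]_(t in unit_itv R) (x t)%:E)%E.

Definition same_distribution (R : realType) (x y : R -> R) : Prop :=
  forall B : set R, measurable B -> prob01 (x @^-1` B) = prob01 (y @^-1` B).

Definition independent (R : realType) (I : choiceType) (f : I -> R -> R) :
    Prop :=
  forall (J : {fset I}) (B : I -> set R), (forall i, measurable (B i)) ->
    prob01 (\bigcap_(i in [set` J]) (f i @^-1` B i)) =
    (\prod_(i <- J) prob01 (f i @^-1` B i))%E.

Record symmetric_space (R : realType) := SymmetricSpace {
  ss_mem : set (R -> R);
  ss_norm : (R -> R) -> R;
  ss_measurable : forall x, ss_mem x -> mfun01 x;
  ss_add : forall x y, ss_mem x -> ss_mem y -> ss_mem (x \+ y);
  ss_scale : forall (a : R) x, ss_mem x -> ss_mem (fun t => a * x t);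
  ss_norm_eq0 : forall x, ss_mem x -> ss_norm x = 0 -> ae01 (fun t => x t = 0);
  ss_norm_triangle : forall x y, ss_mem x -> ss_mem y ->
    ss_norm (x \+ y) <= ss_norm x + ss_norm y;
  ss_norm_scale : forall (a : R) x, ss_mem x ->
    ss_norm (fun t => a * x t) = `|a| * ss_norm x;
  ss_complete : forall u : nat -> R -> R, (forall n, ss_mem (u n)) ->
    (forall e : R, 0 < e -> exists M : nat, forall m n : nat,
       (M <= m)%N -> (M <= n)%N -> ss_norm (u m \- u n) < e) ->
    exists2 x, ss_mem x & (fun n => ss_norm (u n \- x)) @ \oo --> (0 : R);
  ss_ideal : forall x y, ss_mem x -> mfun01 y ->
    ae01 (fun t => `|y t| <= `|x t|) -> ss_mem y /\ ss_norm y <= ss_norm x;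
  ss_symmetric : forall x y, ss_mem x -> mfun01 y ->
    same_distribution (fun t => `|x t|) (fun t => `|y t|) ->
    ss_mem y /\ ss_norm y = ss_norm x;
  ss_one : ss_mem (\1_(unit_itv R) : R -> R);
  ss_norm_one : ss_norm (\1_(unit_itv R) : R -> R) = 1
}.

Definition unit_ball (R : realType) (X : symmetric_space R) : set (R -> R) :=
  [set x | ss_mem X x /\ ss_norm X x <= 1].

(* The integral of a function [z] is [\int z^+ - \int z^-], with the value -oo
   when both terms are infinite. Such [x] do not affect the supremum, because
   the unit ball of [X] also contains [|x| * sgn y]. *)
Definition associated (R : realType) (X : symmetric_space R) : set (R -> R) :=
  [set y | mfun01 y /\
    (ereal_sup [set int01 (fun t => x t * y t)%R | x in unit_ball X] < +oo)%E].

Definition L2 (R : realType) : set (R -> R) :=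
  [set x | mfun01 x /\ (int01 (fun t => (x t ^+ 2)%R) < +oo)%E].
Arguments L2 : clear implicits.

Definition lower_2_estimate (R : realType) (X : symmetric_space R) : Prop :=
  exists2 C : R, 0 < C &
    forall (N : nat) (x : 'I_N -> R -> R), (forall k, ss_mem X (x k)) ->
      (forall j k, j != k -> ae01 (fun t => x j t * x k t = 0)) ->
      C^-1 * Num.sqrt (\sum_(k < N) ss_norm X (x k) ^+ 2) <=
      ss_norm X (fun t => \sum_(k < N) x k t).

(* [g] is a realization on [0,1] of [\sum_(k = 1)^P f_k], with [P] a Poisson
   variable of parameter 1 and [f_1, f_2, ...] copies of [f]. The index [None]
   stands for [P], so that the sequence and [P] are jointly independent. *)
Definition is_pi (R : realType) (f g : R -> R) : Prop :=
  exists (F : nat -> R -> R) (P : R -> nat),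
    [/\ forall k, mfun01 (F k) /\ same_distribution (F k) f,
        measurable_fun (unit_itv R) P,
        forall k : nat, prob01 (P @^-1` [set k]) = (poisson_pmf 1 k)%:E,
        independent (fun i : option nat =>
          if i is Some k then F k else fun t => (P t)%:R) &
        forall t, unit_itv R t -> g t = \sum_(k < P t) F k t].

(* A realization of [pi f] on [0,1] always exists, and all of them have the
   same distribution, so the choice of [g] is immaterial when [Y] is a
   symmetric space. *)
Definition kruglov_property (R : realType) (Y : set (R -> R)) : Prop :=
  forall f, Y f -> exists2 g, is_pi f g & Y g.

Definition linear_subspace (R : realType) (X : symmetric_space R)
    (V : set (R -> R)) : Prop :=
  [/\ V `<=` ss_mem X, V (cst 0), (forall x y, V x -> V y -> V (x \+ y)) &
      (forall (a : R) x, V x -> V (fun t => a * x t))].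

Definition dim_le (R : realType) (V : set (R -> R)) (n : nat) : Prop :=
  exists2 v : 'I_n -> R -> R, (forall i, V (v i)) &
    forall x, V x -> exists c : 'I_n -> R,
      ae01 (fun t => x t = \sum_(i < n) c i * v i t).

Definition kolmogorov_width (R : realType) (n : nat) (K : set (R -> R))
    (X : symmetric_space R) : \bar R :=
  ereal_inf [set ereal_sup [set ereal_inf [set (ss_norm X (x \- v))%:E
                                          | v in V] | x in K]
            | V in [set V | linear_subspace X V /\ dim_le V n]].

Definition kolmogorov_width_real (R : realType) (r : R) (K : set (R -> R))
    (X : symmetric_space R) : \bar R :=
  kolmogorov_width (Num.truncn r) K X.

(* [N] is positive: for [N = 0] the width of the empty set is not >= gamma. *)
Definition property_IR (R : realType) (X : symmetric_space R) : Prop :=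
  exists2 gamma : R, 0 < gamma &
    forall (N : nat) (f : 'I_N -> R -> R), (0 < N)%N ->
      (forall k, ss_mem X (f k)) -> independent f ->
      (forall k, int01 (f k) = 0%E) -> (forall k, 1 <= ss_norm X (f k)) ->
      (gamma%:E <= kolmogorov_width_real (gamma * N%:R) (range f) X)%E.

(* Main.v *)
(* Write [y] for an element of [X'] and [<x, y>] for the integral of [x y].
   Conditional expectations contract the norm of [X] and, by the lower
   2-estimate, this norm is order continuous; hence each [f_k] has a mean zero
   simple function [g_k = h_k(f_k)] in a fixed ball of [X'] with
   [<f_k, g_k> >= c |f_k|].
   The [g_k] satisfy [|\sum a_k g_k|_{X'} <= K (\sum a_k^2)^{1/2}]. To see this,
   split each [a_k g_k] at the height 1. By duality [X'] has an upper 2-estimate,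
   so disjoint copies of the large parts have a sum [b] in [X'], and the
   distribution tail of [pi(b)] dominates that of the sum of the independent
   large parts up to the factor [e]. The small parts have a total variance which
   is bounded because [L_2] is contained in [X], so the exponential moments of
   their sum give it a tail dominated by that of the Poisson variable [pi(1)].
   Uniformity of the constants comes from a gliding hump argument.
   If now the width were small, some [v_k] near [f_k] would span a space of
   dimension [r <= gamma N], so the matrix of the [<v_k, g_j> / |f_k|] would have
   rank at most [r], a trace of order [N] and columns of norm at most [2 K]. This
   contradicts [(tr A)^2 <= rank(A) |A|_{HS}^2]. *)
Require Import Defs.
From mathcomp Require Import all_boot all_order all_algebra.
From mathcomp Require Import finmap.
From mathcomp Require Import all_classical all_reals all_analysis.
From mathcomp Require Import measurable_realfun ring lra.

Set Implicit Arguments.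
Unset Strict Implicit.
Unset Printing Implicit Defensive.

Import Order.TTheory GRing.Theory Num.Theory.
Import numFieldNormedType.Exports.

Local Open Scope classical_set_scope.
Local Open Scope ring_scope.

(** * Tails and uniform rearrangements *)

Section Tails.
Context {R : realType}.
Local Notation mu := (@lebesgue_measure R).
Local Notation U01 := (unit_itv R).
Implicit Types (x y W h : R -> R) (A B : set R).

(** The Kruglov property and the inclusion of [L_2] in [X] only assert membership, whereas bounds
    uniform in [N] are needed; hence sequences of counterexamples are merged into one function,
    twice. What is known about [pi] concerns its tails, so norm bounds in the dual are transferred
    by comparing tails ([dual_tail_le]). The functions [g_k] are simple so that laws become finite
    lists of weighted atoms: independence then amounts to finite sums, and no product space is
    needed. All couplings live on [[0,1]] itself and come from an explicit ordering of its points.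
    The factor [e] normalises the Poisson weights [1 / (e j!)]. A product of operators [1 + w_k] is
    at most the exponential series of the sum of the [w_k], and the [j]-th term of that series is
    [e] times the contribution of [j] summands to [pi]. Conditional expectations reduce the norming
    problem to functions constant on a finite partition, where Hahn-Banach is finite-dimensional. *)

Lemma measurable_U01 : measurable U01.
Proof. exact: measurable_itv. Qed.

Lemma measure_U01 : mu U01 = 1%E.
Proof. by rewrite /unit_itv lebesgue_measure_itv/= lte_fin ltr01 oppr0 adde0. Qed.

Definition pr A : R := fine (prob01 A).

Lemma measurable_subgraph k : measurable_fun setT k ->
  measurable [set p : measurableTypeR R * measurableTypeR R | 0 <= p.2 < k p.1].
Proof.
move=> mk.
pose f1 (p : measurableTypeR R * measurableTypeR R) := 0 <= p.2.
pose f2 (p : measurableTypeR R * measurableTypeR R) := p.2 < k p.1.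
rewrite [X in measurable X](_ : _ =
    f1 @^-1` [set true] `&` f2 @^-1` [set true]); last first.
  by apply/seteqP; split => p /= => [/andP//|[? ?]]; exact/andP.
apply: measurableI.
  have : measurable_fun setT f1 by exact: measurable_fun_ler.
  by move=> /(_ measurableT [set true]); rewrite setTI; exact.
have : measurable_fun setT f2.
  by apply: measurable_fun_ltr => //; exact: measurableT_comp.
by move=> /(_ measurableT [set true]); rewrite setTI; exact.
Qed.

(* The integral of [W] over the superlevel set of [h] in [A], set to 0 at the
   negative levels so that it can be integrated over the whole line. *)
Definition upper_integral A W h (s : R) : \bar R :=
  if 0 <= s then (\int[mu]_(t in A `&` [set t | (s < h t)%R]) (W t)%:E)%E
  else 0%E.

(** Tonelli for [W] times the indicator of the region below the graph of [h]. The weight [W] allows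
    a second application, which produces joint tails. *)
Lemma layer_cake A W h : measurable A -> measurable_fun A W ->
  measurable_fun A h -> (forall t, A t -> 0 <= W t) ->
  (forall t, A t -> 0 <= h t) ->
  measurable_fun setT (upper_integral A W h) /\
  (\int[mu]_(t in A) (W t * h t)%:E =
   \int[mu]_s upper_integral A W h s)%E.
Proof.
move=> mA mW mh W0 h0.
pose w := W \_ A; pose k := h \_ A.
have mw : measurable_fun setT w by apply/(measurable_restrictT _ mA).
have mk : measurable_fun setT k by apply/(measurable_restrictT _ mA).
have w0 t : 0 <= w t by rewrite /w patchE; case: ifPn => // /set_mem /W0.
have k0 t : 0 <= k t by rewrite /k patchE; case: ifPn => // /set_mem /h0.
pose f (p : measurableTypeR R * measurableTypeR R) : \bar R :=
  (w p.1 * \1_[set q : measurableTypeR R * measurableTypeR R |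
                0 <= q.2 < k q.1] p)%:E.
have f0 p : (0 <= f p)%E by rewrite /f lee_fin mulr_ge0.
have mf : measurable_fun setT f.
  apply/measurable_EFinP; apply: measurable_funM.
    exact: measurableT_comp.
  by apply/measurable_indicP; exact: measurable_subgraph.
have GE s : (\int[mu]_t f (t, s) = upper_integral A W h s)%E.
  rewrite /upper_integral; case: ifPn => s0; last first.
    apply: integral0_eq => t _; rewrite /f indicE memNset ?mulr0//=.
    by rewrite (negbTE s0).
  rewrite [RHS]integral_mkcond; apply: eq_integral => t _.
  rewrite /f indicE /w /k !patchE /=.
  have [tA|tA] := boolP (t \in A).
    have [sh|sh] := ltP s (h t).
      rewrite !mem_set ?mulr1//=; first by split => //; exact: set_mem.
      by rewrite s0 patchE tA.
    rewrite !memNset ?mulr0//=; last by rewrite s0 patchE tA ltNge sh.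
    by move=> [_]; rewrite ltNge sh.
  rewrite mul0r ifF//; apply/negP => /set_mem [/mem_set]; by rewrite (negbTE tA).
have FE t : (\int[mu]_s f (t, s) = (w t * k t)%:E)%E.
  transitivity (\int[mu]_s ((w t)%:E * (\1_`[0%R, k t[%classic s : R)%:E))%E.
    apply: eq_integral => s _; rewrite /f EFinM; congr (_ * _)%E.
  rewrite ge0_integralZl//.
  - rewrite integral_indic//= setIT lebesgue_measure_itv/= lte_fin.
    have [kt|kt] := ltP 0 (k t); first by rewrite oppr0 adde0 EFinM.
    have -> : k t = 0 by apply/eqP; rewrite eq_le kt k0.
    by rewrite mulr0 mule0.
  - by apply/measurable_EFinP; exact: measurable_indic.
  - by rewrite lee_fin.
split.
  rewrite (_ : upper_integral A W h = fun s => (\int[mu]_t f (t, s))%E).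
    exact: (@measurable_fun_fubini_tonelli_G _ _ _ _ R mu f mf f0).
  by apply/funext => s; rewrite GE.
transitivity (\int[mu]_t (w t * k t)%:E)%E.
  rewrite integral_mkcond; apply: eq_integral => t _.
  by rewrite /w /k !patchE; case: ifPn => //; rewrite mul0r.
have := @fubini_tonelli _ _ _ _ R mu mu f mf f0.
by under eq_integral do rewrite FE; under [RHS]eq_integral do rewrite GE.
Qed.

End Tails.

Section Probability.
Context {R : realType}.
Local Notation mu := (@lebesgue_measure R).
Local Notation U01 := (unit_itv R).
Implicit Types (x y W h : R -> R) (A B : set R).

(** Only the trace on [[0,1]] counts, because functions are arbitrary outside it; this makes
    superlevel sets of an [mfun01] function admissible as they are. *)
Definition m01 A := measurable (U01 `&` A).

Lemma m01T : m01 [set: R].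
Proof. by rewrite /m01 setIT; exact: measurable_U01. Qed.

Lemma m01_0 : m01 (@set0 R).
Proof. by rewrite /m01 setI0; exact: measurable0. Qed.

Lemma m01I A B : m01 A -> m01 B -> m01 (A `&` B).
Proof.
move=> mA mB; rewrite /m01 (_ : _ `&` _ = (U01 `&` A) `&` (U01 `&` B)).
  exact: measurableI.
by apply/seteqP; split => t /=; tauto.
Qed.

Lemma m01U A B : m01 A -> m01 B -> m01 (A `|` B).
Proof. by move=> mA mB; rewrite /m01 setIUr; exact: measurableU. Qed.

Lemma m01C A : m01 A -> m01 (~` A).
Proof.
move=> mA; rewrite /m01 (_ : _ `&` _ = U01 `\` (U01 `&` A)).
  by apply: measurableD => //; exact: measurable_U01.
by apply/seteqP; split => t /=; tauto.
Qed.

Lemma m01_bigcup (F : nat -> set R) : (forall n, m01 (F n)) ->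
  m01 (\bigcup_n F n).
Proof. by move=> mF; rewrite /m01 setI_bigcupr; exact: bigcupT_measurable. Qed.

Lemma m01_bigcap (F : nat -> set R) : (forall n, m01 (F n)) ->
  m01 (\bigcap_n F n).
Proof.
move=> mF; rewrite -[X in m01 X]setCK setC_bigcap; apply: m01C.
by apply: m01_bigcup => n; exact: m01C.
Qed.

Lemma measurable_m01 A : measurable A -> m01 A.
Proof. by move=> mA; apply: measurableI => //; exact: measurable_U01. Qed.

Lemma m01_preimage x B : mfun01 x -> measurable B -> m01 (x @^-1` B).
Proof. by move=> mx mB; apply: mx => //; exact: measurable_U01. Qed.

Lemma m01_gt x (s : R) : mfun01 x -> m01 [set t | s < x t].
Proof.
move=> mx; rewrite (_ : [set t | _] = x @^-1` `]s, +oo[%classic).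
  by apply: m01_preimage.
by apply/seteqP; split => t /=; rewrite in_itv/= andbT.
Qed.

Lemma m01_ge x (s : R) : mfun01 x -> m01 [set t | s <= x t].
Proof.
move=> mx; rewrite (_ : [set t | _] = x @^-1` `[s, +oo[%classic).
  by apply: m01_preimage.
by apply/seteqP; split => t /=; rewrite in_itv/= andbT.
Qed.

Lemma m01_eq x (s : R) : mfun01 x -> m01 [set t | x t = s].
Proof. by move=> mx; apply: (m01_preimage mx (measurable_set1 s)). Qed.

Lemma m01_lt x (s : R) : mfun01 x -> m01 [set t | x t < s].
Proof.
move=> mx; rewrite (_ : [set t | _] = x @^-1` `]-oo, s[%classic).
  by apply: m01_preimage.
by apply/seteqP; split => t /=; rewrite in_itv/=.
Qed.

Lemma measure_U01_fin A : m01 A -> mu (U01 `&` A) \is a fin_num.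
Proof.
move=> mA; rewrite ge0_fin_numE; last exact: measure_ge0.
apply: (@le_lt_trans _ _ (mu U01)).
  apply: le_measure; rewrite ?inE//; exact: measurable_U01.
by rewrite measure_U01 ltry.
Qed.

Lemma prE A : m01 A -> prob01 A = (pr A)%:E.
Proof. by move=> mA; rewrite /pr fineK//; exact: measure_U01_fin. Qed.

Lemma pr_ge0 A : m01 A -> 0 <= pr A.
Proof. by move=> mA; rewrite -lee_fin -prE//; exact: measure_ge0. Qed.

Lemma le_pr A B : m01 A -> m01 B -> (forall t, U01 t -> A t -> B t) ->
  pr A <= pr B.
Proof.
move=> mA mB AB; rewrite -lee_fin -!prE//; apply: le_measure; rewrite ?inE//.
by move=> t [tU tA]; split => //; exact: AB.
Qed.

Lemma eq_pr A B : (forall t, U01 t -> A t <-> B t) -> pr A = pr B.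
Proof.
move=> AB; rewrite /pr /prob01; congr (fine (mu _)).
by apply/seteqP; split => t [tU tA]; split => //; exact/AB.
Qed.

Lemma pr0 : pr (@set0 R) = 0.
Proof. by rewrite /pr /prob01 setI0 measure0. Qed.

Lemma prT : pr [set: R] = 1.
Proof. by rewrite /pr /prob01 setIT measure_U01. Qed.

Lemma pr_le1 A : m01 A -> pr A <= 1.
Proof. by move=> mA; rewrite -prT; apply: le_pr => //; exact: m01T. Qed.

Lemma prU A B : m01 A -> m01 B -> (forall t, U01 t -> A t -> B t -> False) ->
  pr (A `|` B) = pr A + pr B.
Proof.
move=> mA mB AB; apply: EFin_inj; rewrite EFinD -!prE//; last exact: m01U.
rewrite /prob01 setIUr measureU//.
by apply/seteqP; split => // t [[tU tA] [_ tB]]; apply: AB tA tB.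
Qed.

Lemma pr_split A B : m01 A -> m01 B -> pr A = pr (A `&` B) + pr (A `&` ~` B).
Proof.
move=> mA mB; rewrite -prU.
- by rewrite -setIUr setUv setIT.
- exact: m01I.
- by apply: m01I => //; exact: m01C.
- by move=> t _ [_ tB] [_].
Qed.

Lemma prU_le A B : m01 A -> m01 B -> pr (A `|` B) <= pr A + pr B.
Proof.
move=> mA mB; rewrite (pr_split (m01U mA mB) mA) lerD//; apply: le_pr => //.
- by apply: m01I => //; exact: m01U.
- by move=> t _ [].
- by apply: m01I (m01C mA); exact: m01U.
- by move=> t _ [[]].
Qed.

Lemma pr_bigcup_gt (F : nat -> set R) w : (forall n, m01 (F n)) ->
  (forall n t, F n t -> F n.+1 t) -> w < pr (\bigcup_n F n) ->
  exists n, w < pr (F n).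
Proof.
move=> mF ndF wF.
have mUF := m01_bigcup mF.
have nd : nondecreasing_seq (fun n => U01 `&` F n).
  apply/nondecreasing_seqP => n; apply/subsetPset => t [? ?].
  by split => //; exact: ndF.
have := @nondecreasing_cvg_mu _ _ _ mu _ mF _ nd.
rewrite -setI_bigcupr => /(_ mUF) cv.
have /(cvgr_gt _) /(_ _ wF) [N _ /(_ N (leqnn N)) /= H] :
  (fun n => pr (F n)) @ \oo --> pr (\bigcup_n F n).
  by apply: (proj2 (proj1 (fine_cvgP _ _) (_ : _ --> (pr _)%:E))); rewrite -prE.
by exists N.
Qed.

Lemma pr_bigcap_lt (F : nat -> set R) w : (forall n, m01 (F n)) ->
  (forall n t, F n.+1 t -> F n t) -> pr (\bigcap_n F n) < w ->
  exists n, pr (F n) < w.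
Proof.
move=> mF niF wF; have mIF := m01_bigcap mF.
have [||| n] := @pr_bigcup_gt (fun n => ~` F n) (1 - w).
- by move=> n; exact: m01C.
- by move=> n t nF /niF.
- rewrite -setC_bigcap; have := pr_split m01T mIF; rewrite prT !setTI => ->.
  lra.
- have := pr_split m01T (mF n); rewrite prT !setTI => -> H; exists n; lra.
Qed.

Lemma pr_ae_le A B : m01 A -> m01 B -> ae01 (fun t => A t -> B t) ->
  pr A <= pr B.
Proof.
move=> mA mB [N [mN N0 AB]].
have mN1 : m01 N by exact: measurable_m01.
have -> : pr B = pr B + pr N.
  have : prob01 N = 0%E.
    apply/eqP; rewrite eq_le measure_ge0// andbT -N0.
    by apply: le_measure; rewrite ?inE.
  by rewrite prE// => -[->]; rewrite addr0.
apply: le_trans (prU_le mB mN1); apply: le_pr => //; first exact: m01U.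
move=> t tU tA; have [tB|tB] := pselect (B t); [by left|right].
by apply: AB => /(_ tU tA).
Qed.


Section Quantile.
Variable T : R -> R.
Hypothesis T_nincr : {homo T : s r / s <= r >-> r <= s}.
Hypothesis T_rcont : forall s w, w < T s -> exists2 e, 0 < e & w < T (s + e).
Hypothesis T_vanish : forall w, 0 < w -> exists s, T s < w.

(** The generalised inverse of a tail function. For [u <= 0] the set may be unbounded and its [sup]
    meaningless, so the value is fixed to 0 there. *)
Definition quantile (u : R) : R :=
  if 0 < u then sup [set s | 0 <= s /\ u < T s] else 0.

Lemma quantile_has_ubound u : 0 < u -> has_ubound [set s | 0 <= s /\ u < T s].
Proof.
move=> /T_vanish[s Ts]; exists s => r [r0 ur].
by rewrite leNgt; apply/negP => /ltW /T_nincr /(lt_le_trans ur) /lt_trans;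
  move=> /(_ _ Ts); rewrite ltxx.
Qed.

Lemma quantile_ge0 u : 0 <= quantile u.
Proof.
rewrite /quantile; case: ifPn => // u0.
have [->|/set0P[s /[dup] [[s0 _]] Es]] :=
  eqVneq [set s | 0 <= s /\ u < T s] set0; first by rewrite sup0.
by apply: le_trans s0 _; apply: ub_le_sup => //; exact: quantile_has_ubound.
Qed.

(** The Galois relation between [T] and its inverse. Right continuity of [T] gives some [s + e] in
    the set, which makes the inequality with the supremum strict. *)
Lemma quantile_gt u s : 0 < u -> 0 <= s -> (s < quantile u) = (u < T s).
Proof.
move=> u0 s0; rewrite /quantile u0; apply/idP/idP => [su|/T_rcont[e e0 ue]].
  have [E0|E0] := eqVneq [set s | 0 <= s /\ u < T s] set0.
    by move: su; rewrite E0 sup0 ltNge s0.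
  have [r [_ ur] sr] := sup_gt (proj1 (set0P _) E0) su.
  by apply: lt_le_trans ur _; apply: T_nincr; exact: ltW.
apply: (@lt_le_trans _ _ (s + e)); first by rewrite ltrDl.
apply: ub_le_sup; first exact: quantile_has_ubound.
by split => //; rewrite addr_ge0// ltW.
Qed.

Lemma le_quantile u v : 0 < u -> u <= v -> quantile v <= quantile u.
Proof.
move=> u0 uv; rewrite leNgt; apply/negP.
rewrite quantile_gt//; last exact: quantile_ge0.
  move=> /(le_lt_trans uv); rewrite -quantile_gt ?ltxx//; exact: quantile_ge0.
exact: lt_le_trans uv.
Qed.

End Quantile.

Section Tail.
Variables (A : set R) (x : R -> R).
Hypotheses (mA : m01 A) (mx : mfun01 x).
Let T (s : R) := pr (A `&` [set t | s < x t]).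

Let mT s : m01 (A `&` [set t | s < x t]).
Proof. by apply: m01I => //; exact: m01_gt. Qed.

Lemma tail_nincr : {homo T : s r / s <= r >-> r <= s}.
Proof.
by move=> s r sr; apply: le_pr => // t _ [? /= rx]; split => //=; exact: le_lt_trans rx.
Qed.

Lemma tail_rcont s w : w < T s -> exists2 e, 0 < e & w < T (s + e).
Proof.
pose F (n : nat) := A `&` [set t | s + n.+1%:R^-1 < x t].
have -> : T s = pr (\bigcup_n F n).
  apply: eq_pr => t _; split => [[tA /= sx]|[n _ [tA /= sx]]].
    by have [k sk] := ltr_add_invr sx; exists k.
  by split => //=; apply: lt_trans sx; rewrite ltrDl.
move=> /pr_bigcup_gt[n|n t [tA /= sx]|n wF].
- exact: mT.
- split => //=; apply: le_lt_trans sx; rewrite lerD2l lef_pV2 ?posrE// ler_nat.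
  exact: leqnSn.
- by exists n.+1%:R^-1.
Qed.

Lemma tail_vanish w : 0 < w -> exists s, T s < w.
Proof.
move=> w0; pose F (n : nat) := A `&` [set t | n%:R < x t].
have [n|n t [tA /= sx]||n nw] := @pr_bigcap_lt F w.
- exact: mT.
- by split => //=; apply: lt_trans sx; rewrite ltr_nat.
- rewrite (_ : pr _ = 0)// -[RHS]pr0; apply: eq_pr => t _; split => // H.
  have [_ /=] := H (Num.bound `|x t|) I.
  by rewrite ltNge (le_trans (ler_norm _))// ltW// archi_boundP.
- by exists n%:R.
Qed.

End Tail.

End Probability.

Section Rearrangement.
Context {R : realType}.
Local Notation mu := (@lebesgue_measure R).
Local Notation U01 := (unit_itv R).
Implicit Types (x y W h : R -> R) (A B : set R).

Lemma measurable_fun_gt (D : set R) x : measurable D ->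
  (forall s, measurable (D `&` [set t | s < x t])) -> measurable_fun D x.
Proof.
move=> mD mx.
apply: (measurability (@RGenOInfty.G R)) => [|/= _ [_] [r] -> <-].
  exact: RGenOInfty.measurableE.
rewrite (_ : _ @^-1` _ = [set t | r < x t])//.
by apply/seteqP; split => t /=; rewrite in_itv/= andbT.
Qed.

Lemma mfun01_gt x : (forall s, m01 [set t | s < x t]) -> mfun01 x.
Proof. by move=> mx; apply: measurable_fun_gt => //; exact: measurable_U01. Qed.

(** Open half-lines form a generating pi-system, so tails determine the image measure. Restricting
    to [U01] turns [x] and [y] into globally measurable maps, as the image measures require. *)
Lemma tail_same_distribution x y : mfun01 x -> mfun01 y ->
  (forall s, pr [set t | s < x t] = pr [set t | s < y t]) ->
  same_distribution x y.
Proof.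
move=> mx my xy B mB.
have mU := @measurable_U01 R.
pose x1 := x \_ U01; pose y1 := y \_ U01.
have mx1 : measurable_fun setT x1 by apply/(measurable_restrictT _ mU).
have my1 : measurable_fun setT y1 by apply/(measurable_restrictT _ mU).
have pE z C : pushforward (mrestr mu mU) (z \_ U01) C = prob01 (z @^-1` C).
  rewrite /pushforward /mrestr /prob01; congr (mu _).
  apply/seteqP; split => t /= [].
    by rewrite patchE => + tU; rewrite mem_set.
  by move=> tU zC; split => //; rewrite patchE mem_set.
rewrite -!pE -/x1 -/y1.
pose m1 : {measure set R -> \bar R} := pushforward (mrestr mu mU) x1.
pose m2 : {measure set R -> \bar R} := pushforward (mrestr mu mU) y1.
apply: (@measure_unique _ _ _ (@RGenOInfty.G R) (fun k => `]-k%:R, +oo[%classic)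
  _ _ _ _ (m1 mx1) (m2 my1)) => //.
- exact: RGenOInfty.measurableE.
- move=> _ _ [a ->] [b ->]; exists (Num.max a b); apply/seteqP; split => t /=;
    by rewrite !in_itv/= !andbT gt_max => /andP.
- by move=> k; eexists.
- apply/seteqP; split => // t _; exists (Num.bound `|t|) => //=.
  rewrite in_itv/= andbT ltrNl (le_lt_trans (ler_norm _))// normrN.
  exact: archi_boundP.
- move=> _ [s ->]; rewrite /m1 /m2 /= !pE.
  have e (z : R -> R) : z @^-1` `]s, +oo[%classic = [set t | s < z t].
    by apply/seteqP; split => t /=; rewrite in_itv/= andbT.
  by rewrite !e !prE ?xy//; exact: m01_gt.
- move=> k; rewrite /m1 /= pE prE ?ltry//; exact: m01_preimage.
Qed.

Section Cdf.
Variable A : set R.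
Hypothesis mA : m01 A.

(** Lebesgue measure has no atoms, so this function is 1-Lipschitz, reaches every level by the
    intermediate value theorem, and is uniformly distributed on [A]. *)
Definition cdf01 (t : R) := pr (A `&` [set s | s <= t]).

Lemma m01_cdf01 t : m01 (A `&` [set s | s <= t]).
Proof.
apply: m01I => //; apply: measurable_m01.
rewrite (_ : [set s | _] = `]-oo, t]%classic); first exact: measurable_itv.
by apply/seteqP; split => s /=; rewrite in_itv.
Qed.

Lemma cdf01_ge0 t : 0 <= cdf01 t.
Proof. by apply: pr_ge0; exact: m01_cdf01. Qed.

Lemma le_cdf01 s t : s <= t -> cdf01 s <= cdf01 t.
Proof.
move=> st; apply: le_pr; [exact: m01_cdf01..|].
by move=> r _ [? /= rs]; split => //=; exact: le_trans st.
Qed.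

Lemma cdf01_lipschitz s t : s <= t -> cdf01 t <= cdf01 s + (t - s).
Proof.
move=> st; have mi : m01 `]s, t]%classic by exact: measurable_m01.
apply: (@le_trans _ _ (pr ((A `&` [set r | r <= s]) `|` `]s, t]%classic))).
  apply: le_pr; [exact: m01_cdf01|by apply: m01U => //; exact: m01_cdf01|].
  move=> r _ [rA /= rt]; have [rs|sr] := leP r s; [left|right] => //=.
  by rewrite in_itv/= sr rt.
apply: le_trans (prU_le (m01_cdf01 _) mi) _; rewrite lerD2l.
rewrite -lee_fin -prE//; apply: (@le_trans _ _ (mu `]s, t]%classic)).
  by apply: le_measure; rewrite ?inE.
rewrite lebesgue_measure_itv/= lte_fin; case: ifPn => // _.
by rewrite lee_fin subr_ge0.
Qed.

Lemma cdf01_continuous : continuous cdf01.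
Proof.
move=> t; apply/cvgrPdist_lt => e e0; near=> s.
apply: (@le_lt_trans _ _ `|t - s|); last first.
  by near: s; apply: cvgr_dist_lt => //; exact: cvg_id.
have [ts|st] := leP t s.
  rewrite distrC ger0_norm ?subr_ge0 ?le_cdf01// distrC ger0_norm ?subr_ge0//.
  by rewrite lerBlDl; exact: cdf01_lipschitz.
have st' := ltW st.
rewrite ger0_norm ?subr_ge0 ?le_cdf01// ger0_norm ?subr_ge0//.
by rewrite lerBlDl cdf01_lipschitz.
Unshelve. all: by end_near. Qed.

Lemma cdf01_surj w : 0 <= w <= pr A -> exists c, cdf01 c = w.
Proof.
move=> /andP[w0 wA].
have c1 : cdf01 1 = pr A.
  apply: eq_pr => t; rewrite /unit_itv /= in_itv/= => /andP[_ t1].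
  by split => [[]|].
have c0 : cdf01 (-1) = 0.
  rewrite -(@pr0 R); apply: eq_pr => t; rewrite /unit_itv /= in_itv/=.
  by move=> /andP[t0 _]; split => // -[_ /=] /(le_trans t0); lra.
have [|||c _ cw] := @IVT R cdf01 (-1) 1 w; last by exists c.
- lra.
- apply: continuous_subspaceT; exact: cdf01_continuous.
- rewrite c1 c0 (min_idPl _) ?(max_idPr _) ?w0//; exact: (le_trans w0).
Qed.

Lemma mfun01_cdf01 : mfun01 cdf01.
Proof.
apply: nondecreasing_measurable; first exact: measurable_U01.
by move=> s t; exact: le_cdf01.
Qed.

(** If [cdf01 c = w], the set lies in [{s <= c}], whence one inequality. If its measure [p] were
    less than [w], a point [d] at the level [(p + w) / 2 < w] would give a subset of measure larger
    than [p]. *)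
Lemma cdf01_uniform w : 0 <= w <= pr A ->
  pr (A `&` [set t | cdf01 t < w]) = w.
Proof.
move=> w01; have [c cw] := cdf01_surj w01.
have mw v : m01 (A `&` [set t | cdf01 t < v]).
  by apply: m01I => //; apply: m01_lt; exact: mfun01_cdf01.
apply/eqP; rewrite eq_le; apply/andP; split.
  rewrite -{2}cw; apply: le_pr => //; first exact: m01_cdf01.
  move=> t _ [tA /= tw]; split => //=; rewrite leNgt; apply/negP => ct.
  by move: tw; rewrite -cw ltNge le_cdf01// ltW.
rewrite leNgt; apply/negP => H; set p := pr _ in H.
have p0 : 0 <= p by apply: pr_ge0; exact: mw.
have [|d dv] := @cdf01_surj ((p + w) / 2).
  by move: w01 => /andP[? ?]; apply/andP; split; lra.
have : (p + w) / 2 <= p.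
  rewrite -{1}dv; apply: le_pr => //; first exact: m01_cdf01.
  move=> t _ [tA /= td]; split => //=; apply: le_lt_trans (le_cdf01 td) _.
  by rewrite dv; lra.
lra.
Qed.

End Cdf.

(* Orders [0,1] by decreasing values of [y], ties being broken by the order of
   [0,1] itself: this makes [rank y] uniformly distributed even if [y] has
   atoms. *)
Definition rank y (t : R) : R :=
  pr [set s | y t < y s] + cdf01 [set s | y s = y t] t.

Section Rank.
Variable y : R -> R.
Hypotheses (my : mfun01 y) (y0 : forall t, U01 t -> 0 <= y t).
Let G (c : R) := pr [set t | c < y t].

Let mG c : m01 [set t | c < y t]. Proof. exact: m01_gt. Qed.
Let mE c : m01 [set t | y t = c]. Proof. exact: m01_eq. Qed.

Let G_nincr c d : c <= d -> G d <= G c.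
Proof. by move=> cd; apply: le_pr => // t _ /=; exact: le_lt_trans. Qed.

Lemma rank_ge t : G (y t) <= rank y t.
Proof. by rewrite lerDl; apply: cdf01_ge0. Qed.

Lemma rank_ge0 t : 0 <= rank y t.
Proof. by apply: le_trans (rank_ge t); exact: pr_ge0. Qed.

Lemma rank_lt c t : c < y t -> rank y t <= G c.
Proof.
move=> cy; rewrite /rank /cdf01 -prU//; last 2 first.
  exact: m01_cdf01.
  by move=> s _ /= ys [ey _]; move: ys; rewrite ey ltxx.
apply: le_pr => //; first by apply: m01U => //; exact: m01_cdf01.
by move=> s _ [/= /(lt_trans cy)//|[/= -> _]].
Qed.

(** [c] is the level where the tail [G] of [y] crosses [v]. Continuity of the measure from either
    side places [v] between [G c] and [G c + pr {y = c}], so an initial piece of the level set of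
    [c] fills the gap. *)
Lemma rank_lt_set v : 0 < v <= 1 -> exists2 c,
  0 <= v - G c <= pr [set t | y t = c] &
  forall t, U01 t -> (rank y t < v <->
    c < y t \/ (y t = c /\ cdf01 [set s | y s = c] t < v - G c)).
Proof.
move=> /andP[v0 v1]; pose S := [set c | G c < v]; pose c := inf S.
have S0 : S !=set0.
  have [s sv] := tail_vanish m01T my v0; exists s; apply: le_lt_trans sv.
  by apply: le_pr => //; exact: m01I m01T _.
have S0' r : S r -> 0 <= r.
  move=> Sr; rewrite leNgt; apply/negP => r0.
  have : G r < 1 by exact: lt_le_trans v1.
  rewrite -(@prT R) ltNge; case/negP; apply: le_pr => //; first exact: m01T.
  by move=> t /y0 + _; exact: lt_le_trans.
have hS : has_lbound S by exists 0 => r /S0'.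
have cS d : c < d -> G d < v.
  move=> cd; have [e Se ed] := inf_lt S0 cd.
  by apply: le_lt_trans Se; apply: G_nincr; exact: ltW.
have Sc d : d < c -> v <= G d.
  move=> dc; rewrite leNgt; apply/negP => /(ge_inf hS).
  by rewrite leNgt dc.
have Gcv : G c <= v.
  rewrite leNgt; apply/negP => vG.
  have [|e e0] := @tail_rcont R setT y m01T my c v.
    by rewrite setTI.
  rewrite setTI => /lt_trans /(_ (cS (c + e) _)).
  by rewrite ltxx ltrDl => /(_ e0).
have vGE : v <= G c + pr [set t | y t = c].
  rewrite -prU//; last by move=> t _ /= + e; rewrite e ltxx.
  rewrite leNgt; apply/negP => H.
  have [n|n t /=||n nv] := @pr_bigcap_lt R (fun n => [set t | c - n.+1%:R^-1 < y t]) v.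
  - exact: mG.
  - by apply: le_lt_trans; rewrite lerD2l lerN2 lef_pV2 ?posrE// ler_nat leqnSn.
  - apply: le_lt_trans H; apply: le_pr => //.
    + by apply: m01_bigcap => n; exact: mG.
    + exact: m01U.
    + move=> t _ H; have [ct|tc|->] := ltgtP c (y t); [by left| |by right].
      have [k ck] := ltr_add_invr tc.
      by have /= := H k I; rewrite ltrBlDr => /(lt_trans ck); rewrite ltxx.
  - by move: nv; rewrite ltNge Sc// gtrBl.
exists c; first by apply/andP; split; lra.
move=> t tU; have [ct|tc|e] := ltgtP c (y t).
- split => // _; first by left.
  have cm : c < (c + y t) / 2 by lra.
  by apply: le_lt_trans (cS _ cm); apply: rank_lt; lra.
- split => [|[//|[e _]]]; last by move: tc; rewrite e ltxx.
  by rewrite ltNge (le_trans (Sc _ tc))//; exact: rank_ge.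
- rewrite /rank -e -/(G c); split => [H|[//|[_]]]; last by rewrite ltrBrDl.
  by right; rewrite ltrBrDl.
Qed.

Lemma mfun01_rank : mfun01 (rank y).
Proof.
(* Measurability is tested on strict superlevel sets, while [rank_lt_set] describes strict sublevel
   sets of [rank y]; hence the double sign. *)
rewrite -(_ : (fun t => - - rank y t) = rank y); last first.
  by apply/funext => t; rewrite opprK.
apply: measurable_funN; apply: mfun01_gt => s.
have [v0|v0] := leP (- s) 0.
  rewrite (_ : [set t | _] = set0); first exact: m01_0.
  apply/seteqP; split => // t /=; rewrite ltrNr => /lt_le_trans/(_ v0).
  by rewrite ltNge rank_ge0.
have [v1|v1] := leP (- s) 1.
  have [|c cw H] := @rank_lt_set (- s); first by rewrite v0 v1.
  rewrite /m01 (_ : _ `&` _ = U01 `&` ([set t | c < y t] `|`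
     ([set t | y t = c] `&` [set t | cdf01 [set s | y s = c] t < - s - G c]))).
    apply: m01U => //; apply: m01I => //; apply: m01_lt.
    exact: mfun01_cdf01.
  apply/seteqP; split => t [tU] /=; rewrite ltrNr => /(H _ tU) ?; split => //.
rewrite (_ : [set t | _] = setT); first exact: m01T.
apply/seteqP; split => // t _ /=; rewrite ltrNr (le_lt_trans _ v1)//.
rewrite /rank -prU//; first by apply: pr_le1; apply: m01U => //; exact: m01_cdf01.
- exact: m01_cdf01.
- by move=> r _ /= ys [ey _]; move: ys; rewrite ey ltxx.
Qed.

Lemma rank_uniform v : 0 <= v <= 1 -> pr [set t | rank y t < v] = v.
Proof.
move=> /andP[]; rewrite le_eqVlt => /predU1P[<- _|v0 v1].
  rewrite -[RHS](@pr0 R); apply: eq_pr => t _; split => //=.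
  by rewrite ltNge rank_ge0.
have [|c cw H] := @rank_lt_set v; first by rewrite v0 v1.
pose C := [set t | y t = c] `&` [set t | cdf01 [set s | y s = c] t < v - G c].
have mC : m01 C by apply: m01I => //; apply: m01_lt; exact: mfun01_cdf01.
rewrite (_ : pr _ = pr ([set t | c < y t] `|` C)); last first.
  by apply: eq_pr => t tU; rewrite /= (H t tU).
rewrite prU//; last by move=> t _ /= + [e _]; rewrite e ltxx.
by rewrite cdf01_uniform// -/(G c); lra.
Qed.

End Rank.

End Rearrangement.

Section Comonotone.
Context {R : realType}.
Local Notation mu := (@lebesgue_measure R).
Local Notation U01 := (unit_itv R).
Implicit Types (x y z W h : R -> R) (A B : set R).

Section QuantileTransform.
Variable T : R -> R.
Hypothesis T_nincr : {homo T : s r / s <= r >-> r <= s}.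
Hypothesis T_rcont : forall s w, w < T s -> exists2 e, 0 < e & w < T (s + e).
Hypothesis T_vanish : forall w, 0 < w -> exists s, T s < w.

Lemma quantile_gtE s u : 0 <= s -> (s < quantile T u) = (0 < u < T s).
Proof.
move=> s0; have [u0|u0] := ltP 0 u; first by rewrite quantile_gt.
by rewrite /= /quantile (ltNge 0 u) u0 /= ltNge s0.
Qed.

Lemma measurable_quantile : measurable_fun setT (quantile T).
Proof.
apply: measurable_fun_gt => // s; rewrite setTI.
have [s0|s0] := leP 0 s.
  rewrite (_ : [set t | _] = `]0, T s[%classic) //.
  by apply/seteqP; split => u /=; rewrite in_itv/= quantile_gtE.
rewrite (_ : [set t | _] = setT)//; apply/seteqP; split => // u _ /=.
by apply: lt_le_trans s0 _; exact: quantile_ge0.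
Qed.

(** The superlevel set is [{0 < o < T s}], so it remains to see that [o = 0] is negligible: a set of
    measure [w] where [o] vanishes lies in [{o < w / 2}], which forces [w <= w / 2]. *)
Lemma pr_quantile A (o : R -> R) s : m01 A -> mfun01 o -> (forall t, 0 <= o t) ->
  (forall v, 0 <= v <= pr A -> pr (A `&` [set t | o t < v]) = v) ->
  0 <= s -> 0 <= T s <= pr A ->
  pr (A `&` [set t | s < quantile T (o t)]) = T s.
Proof.
move=> mA mo o0 ou s0 /andP[T0 TA].
have mlt v : m01 [set t | o t < v] by exact: m01_lt.
have mgt v : m01 [set t | v < o t] by exact: m01_gt.
rewrite (_ : pr _ = pr (A `&` [set t | o t < T s] `&` [set t | 0 < o t])); last first.
  apply: eq_pr => t _; rewrite /= quantile_gtE//; split.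
    by move=> [? /andP[]].
  by move=> [[? ->] ->].
have := pr_split (m01I mA (mlt (T s))) (mgt 0); rewrite ou ?T0// => {2}->.
rewrite [X in _ = _ + X](_ : _ = 0) ?addr0//.
apply/eqP; rewrite eq_le pr_ge0 ?andbT; last first.
  by apply: m01I; [exact: m01I|exact: m01C].
rewrite leNgt; apply/negP; set w := pr _ => w0.
have wT : w / 2 <= T s.
  have : w <= T s.
    rewrite -[leRHS]ou ?T0//; apply: le_pr.
    - by apply: m01I; [exact: m01I|exact: m01C].
    - exact: m01I.
    - by move=> t _ [].
  lra.
have : w <= w / 2.
  rewrite -[leRHS]ou; last by apply/andP; split; lra.
  apply: le_pr.
  - by apply: m01I; [exact: m01I|exact: m01C].
  - exact: m01I.
  - by move=> t _ [[tA _] /= /negP]; rewrite -leNgt => o1; split => //=; lra.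
lra.
Qed.

End QuantileTransform.

(** [x'] is the decreasing rearrangement of [x] laid along the order of decreasing [y]. The
    superlevel sets of [x'] and [y] are then nested up to null sets, so their intersections are as
    large as the marginals permit: this is the extremal case of the Hardy-Littlewood inequality. *)
Lemma comonotone x y : mfun01 x -> mfun01 y ->
  (forall t, U01 t -> 0 <= y t) ->
  exists x', [/\ mfun01 x', forall t, 0 <= x' t,
    (forall s, 0 <= s -> pr [set t | s < x' t] = pr [set t | s < x t]) &
    (forall s r, 0 <= s ->
      Num.min (pr [set t | s < x t]) (pr [set t | r < y t]) <=
      pr ([set t | s < x' t] `&` [set t | r < y t]))].
Proof.
move=> mx my y0; pose T s := pr [set t | s < x t].
have TE s : T s = pr ([set: R] `&` [set t | s < x t]) by rewrite setTI.
have T1 : {homo T : s r / s <= r >-> r <= s}.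
  by move=> s r; rewrite !TE; exact: tail_nincr m01T mx _ _.
have T2 s w : w < T s -> exists2 e, 0 < e & w < T (s + e).
  by rewrite TE => /(tail_rcont m01T mx)[e e0]; rewrite -TE; exists e.
have T3 w : 0 < w -> exists s, T s < w.
  by move=> /(tail_vanish m01T mx)[s]; rewrite -TE; exists s.
have T01 s : 0 <= T s <= 1.
  by rewrite pr_ge0 ?pr_le1//; exact: m01_gt.
have mr : mfun01 (rank y) by exact: mfun01_rank.
have r0 t : 0 <= rank y t by exact: rank_ge0.
have ru v : 0 <= v <= 1 -> pr [set t | rank y t < v] = v by exact: rank_uniform.
have mx' : mfun01 (quantile T \o rank y).
  apply: (measurable_comp _ _ (measurable_quantile T1 T2 T3) mr) => //.
exists (quantile T \o rank y); split => //.
- by move=> t; exact: quantile_ge0.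
- move=> s s0 /=; have := @pr_quantile T T1 T2 T3 setT (rank y) s.
  rewrite setTI prT => -> //; first exact: m01T.
  by move=> v; rewrite setTI; exact: ru.
move=> s r s0; set m := Num.min _ _.
have m0 : 0 <= m by rewrite /m le_min !pr_ge0//; exact: m01_gt.
have m1 : m <= 1 by rewrite /m ge_min pr_le1//; exact: m01_gt.
have mU : m01 ([set t | s < (quantile T \o rank y) t] `&` [set t | r < y t]).
  by apply: m01I; exact: m01_gt.
(* [m] is the measure of [{rank y < m}]. Without its null part [{rank y = 0}] this set is contained
   in both superlevel sets. *)
rewrite -[leLHS]ru ?m0//.
have ml v : m01 [set t | rank y t < v] by exact: m01_lt.
have -> : pr [set t | rank y t < m] =
  pr ([set t | rank y t < m] `&` [set t | 0 < rank y t]).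
  rewrite (pr_split (ml _) (m01_gt 0 mr)) [X in _ + X](_ : _ = 0) ?addr0//.
  apply/eqP; rewrite eq_le pr_ge0 ?andbT; last first.
    by apply: m01I => //; apply: m01C; exact: m01_gt.
  rewrite leNgt; apply/negP; set w := pr _ => w0.
  have mw : m01 ([set t | rank y t < m] `&` ~` [set t | 0 < rank y t]).
    by apply: m01I => //; apply: m01C; exact: m01_gt.
  have w1 : w <= 1 by exact: pr_le1.
  have : w <= w / 2.
    rewrite -[leRHS]ru; last by apply/andP; split; lra.
    apply: le_pr => // t _ [_ /= /negP]; rewrite -leNgt; lra.
  lra.
apply: le_pr => //; first by apply: m01I => //; exact: m01_gt.
move=> t tU [/= rm rp]; split => /=.
  by rewrite quantile_gtE// rp (lt_le_trans rm)// /m ge_min lexx.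
rewrite ltNge; apply/negP => yr; move: rm; rewrite ltNge; case/negP.
apply: le_trans (rank_ge my t); rewrite /m ge_min; apply/orP; right.
apply: le_pr; [exact: m01_gt|exact: m01_gt|].
by move=> u _ /=; exact: le_lt_trans.
Qed.

(** The second layer cake, in [x] and with weight 1: integrals of products become double integrals
    of joint tails, which [comonotone] bounds. *)
Lemma upper_integral_tails x z s : mfun01 x -> mfun01 z ->
  (forall t, U01 t -> 0 <= x t) -> 0 <= s ->
  let J r := if 0 <= r then (pr ([set t | s < z t] `&` [set t | r < x t]))%:E
             else 0%E in
  measurable_fun setT J /\ upper_integral U01 x z s = (\int[mu]_r J r)%E.
Proof.
move=> mx mz x0 s0 J.
have mz' : measurable (U01 `&` [set t | s < z t]) by exact: m01_gt.
have JE : upper_integral (U01 `&` [set t | s < z t]) (cst 1) x = J.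
  apply/funext => r; rewrite /upper_integral /J; case: ifPn => // r0.
  have mI : m01 ([set t | s < z t] `&` [set t | r < x t]).
    by apply: m01I; exact: m01_gt.
  by rewrite -setIA (@integral_cst _ _ _ mu _ mI 1) mul1e -prE.
have [||||m e] := @layer_cake R (U01 `&` [set t | s < z t]) (cst 1) x mz'.
- by [].
- by apply: measurable_funS mx => //; exact: measurable_U01.
- by move=> t _ /=.
- by move=> t [/x0].
rewrite -JE; split => //; rewrite -e /upper_integral s0.
by apply: eq_integral => t _; rewrite mul1r.
Qed.

End Comonotone.

(** * Functions in the dual ball *)

Section Dual.
Context {R : realType}.
Local Notation mu := (@lebesgue_measure R).
Local Notation U01 := (unit_itv R).
Variable X : symmetric_space R.
Local Notation norm := (ss_norm X).
Implicit Types (x y z : R -> R) (A B : set R).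

(* [y] lies in the ball of radius [C] of the associated space. *)
Definition dual_le (C : R) y := mfun01 y /\
  forall x, ss_mem X x ->
    (\int[mu]_(t in U01) (`|x t| * `|y t|)%:E <= (C * norm x)%:E)%E.

Lemma mfun01_abs x : mfun01 x -> mfun01 (fun t => `|x t|).
Proof. by move=> mx; exact: measurableT_comp. Qed.

Lemma ae01_all (P : R -> Prop) : (forall t, U01 t -> P t) -> ae01 P.
Proof. by move=> H; apply: aeW => t; exact: H. Qed.

Lemma ae01S (P Q : R -> Prop) :
  (forall t, U01 t -> P t -> Q t) -> ae01 P -> ae01 Q.
Proof.
by move=> PQ [N [mN N0 NP]]; exists N; split => // t /= nQ; apply: NP => /= nP;
  apply: nQ => tU; exact/PQ/nP.
Qed.

Lemma ae01_forall (P : nat -> R -> Prop) : (forall n, ae01 (P n)) ->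
  ae01 (fun t => forall n, P n t).
Proof.
move=> H.
have [N [mN N0 NP]] := @ae_foralln _ _ _ mu (fun n t => U01 t -> P n t) H.
exists N; split => // t /= nt; apply: NP => /= h; apply: nt => tU n.
exact: h.
Qed.

Lemma null_ae01 A : m01 A -> pr A = 0 -> ae01 (fun t => ~ A t).
Proof.
move=> mA A0; exists (U01 `&` A); split => //.
  by rewrite -/(prob01 A) prE// A0.
move=> t /= nt; split; first by apply: contrapT => tU; apply: nt => /tU.
by apply: contrapT => h; apply: nt.
Qed.

Lemma ss_abs x : ss_mem X x ->
  ss_mem X (fun t => `|x t|) /\ norm (fun t => `|x t|) = norm x.
Proof.
move=> Xx; have mx := mfun01_abs (ss_measurable Xx).
have [Xa na] : ss_mem X (fun t => `|x t|) /\ norm (fun t => `|x t|) <= norm x.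
  by apply: ss_ideal => //; apply: ae01_all => t _; rewrite normr_id.
split => //; apply/eqP; rewrite eq_le na/=.
apply: (proj2 (ss_ideal Xa (ss_measurable Xx) _)).
by apply: ae01_all => t _; rewrite normr_id.
Qed.

(** A copy [x'] of [|x|] comonotone with [|y|] dominates [|y|] almost everywhere, so the ideal
    property and symmetry apply. *)
Lemma tail_ss_mem x y : ss_mem X x -> mfun01 y ->
  (forall s, 0 <= s -> pr [set t | s < `|y t|] <= pr [set t | s < `|x t|]) ->
  ss_mem X y /\ norm y <= norm x.
Proof.
move=> Xx my yx; have mx := ss_measurable Xx.
have ma := mfun01_abs mx; have mb := mfun01_abs my.
have [|x' [mx' x'0 x'T H]] := comonotone ma mb.
  by move=> t _.
have [Xx' nx'] : ss_mem X x' /\ norm x' = norm x.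
  apply: ss_symmetric => //; apply: tail_same_distribution => //.
    exact: mfun01_abs.
  move=> s; have [s0|s0] := leP 0 s.
    rewrite -x'T//; congr pr; apply/seteqP; split => t /=; by rewrite ger0_norm.
  by apply: eq_pr => t _ /=; split => _; apply: lt_le_trans s0 _.
rewrite -nx'; apply: ss_ideal => //.
(* Rational levels suffice, and there are countably many. At each level the minimum in [H] is the
   tail of [|y|], so [{s < |y|}] is almost contained in [{s < x'}]. *)
have Hq (p q : nat) : ae01 (fun t =>
    (p%:R / q.+1%:R < `|y t| -> p%:R / q.+1%:R < x' t) : Prop).
  set s := _ / _; have s0 : 0 <= s by rewrite divr_ge0.
  pose N := [set t | s < `|y t|] `&` ~` [set t | s < x' t].
  have mg z : mfun01 z -> m01 [set t | s < z t] by exact: m01_gt.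
  have mN : m01 N by apply: m01I; [exact: mg|apply: m01C; exact: mg].
  suff : pr N = 0.
    move=> /(null_ae01 mN); apply: ae01S => t tU Nt sy.
    by apply: contrapT => h; exact: Nt.
  have := pr_split (mg _ mb) (mg _ mx'); have := H s s s0.
  rewrite (min_idPr (yx _ s0)) [X in _ <= pr X]setIC -/N.
  by have := pr_ge0 mN; lra.
have := ae01_forall (fun p => ae01_forall (Hq p)).
apply: ae01S => t tU Ht; rewrite (ger0_norm (x'0 t)) leNgt; apply/negP => xy.
(* The mesh [1 / q.+1] is finer than the gap, so some [p / q.+1] is at least [x' t] and less than
   [|y t|], against [Ht]. *)
pose q := Num.bound (`|y t| - x' t)^-1.
have q0 : (`|y t| - x' t)^-1 < q.+1%:R.
  apply: (@lt_le_trans _ _ q%:R); last by rewrite ler_nat.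
  by apply: archi_boundP; rewrite invr_ge0; lra.
have q2 : 1 < q.+1%:R * (`|y t| - x' t).
  by move: q0; rewrite -[X in X < _]div1r ltr_pdivrMr// subr_gt0.
have xq : 0 <= x' t * q.+1%:R by rewrite mulr_ge0.
have [p [p1 p2]] : exists p : nat, p%:R <= x' t * q.+1%:R + 1 /\ x' t * q.+1%:R <= p%:R.
  exists (Num.truncn (x' t * q.+1%:R)).+1.
  have := truncn_itv xq => /andP[h1 h2].
  by split; [rewrite -natr1; lra|exact: ltW].
have : x' t * q.+1%:R < x' t * q.+1%:R; last by rewrite ltxx.
have : p%:R / q.+1%:R < x' t by apply: (Ht p q); rewrite ltr_pdivrMr//; nra.
by rewrite ltr_pdivrMr//; exact: le_lt_trans.
Qed.

(** With [x'] comonotone to [|y|], the joint tail of [|x|] and [|z|] is at most the minimum of the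
    marginals, hence at most [L] times the joint tail of [x'] and [|y|]; [1 <= L] takes the factor
    out of the minimum. Two layer cakes turn this into an inequality of integrals. *)
Lemma dual_tail_le C L y z : dual_le C y -> mfun01 z -> 1 <= L ->
  (forall s, 0 <= s -> pr [set t | s < `|z t|] <= L * pr [set t | s < `|y t|]) ->
  dual_le (L * C) z.
Proof.
move=> [my yC] mz L1 zy; split => // x Xx; have mx := ss_measurable Xx.
have ma := mfun01_abs mx; have mb := mfun01_abs my; have mc := mfun01_abs mz.
have [|x' [mx' x'0 x'T H]] := comonotone ma mb.
  by move=> t _.
have [Xx' nx'] : ss_mem X x' /\ norm x' <= norm x.
  apply: tail_ss_mem => // s s0; rewrite -x'T//; apply: le_pr.
  - by apply: m01_gt; exact: mfun01_abs.
  - exact: m01_gt.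
  - by move=> t _ /=; rewrite ger0_norm.
have L0 : 0 <= L by lra.
have U0 : measurable U01 := @measurable_U01 R.
have [||||m1 ->] := @layer_cake R U01 (fun t => `|x t|) (fun t => `|z t|) U0 => //.
have [||||m2 e2] := @layer_cake R U01 x' (fun t => `|y t|) U0 => //.
have upper_ge0 v w s : (forall t, U01 t -> 0 <= v t) ->
    (0 <= upper_integral U01 v w s)%E.
  move=> v0; rewrite /upper_integral; case: ifPn => // _; apply: integral_ge0.
  by move=> t [/v0 ?] _; rewrite lee_fin.
apply: (@le_trans _ _ (\int[mu]_s (L%:E * upper_integral U01 x' (fun t => (`|y t|)%R) s))%E).
  apply: ge0_le_integral => //.
  - by move=> s _; exact: upper_ge0.
  - by apply: measurable_funeM.
  move=> s _; rewrite /upper_integral; have [s0|s0] := leP 0 s; last by rewrite mule0.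
  have [||m3 e3] := @upper_integral_tails R _ _ s ma mc => //.
  have [||m4 e4] := @upper_integral_tails R _ _ s mx' mb => //.
  move: e3 e4; rewrite /upper_integral s0 => -> ->.
  rewrite -ge0_integralZl//; last first.
    by move=> r _; case: ifPn => // _; rewrite lee_fin pr_ge0//; apply: m01I; exact: m01_gt.
  apply: ge0_le_integral => //.
  - by move=> r _; case: ifPn => // _; rewrite lee_fin pr_ge0//; apply: m01I; exact: m01_gt.
  - by apply: measurable_funeM.
  move=> r _; case: ifPn => r0; last by rewrite mule0.
  rewrite -EFinM lee_fin; apply: (@le_trans _ _ (L * Num.min (pr [set t | r < `|x t|]) (pr [set t | s < `|y t|]))); last first.
    by rewrite ler_wpM2l// setIC; exact: H.
  rewrite minr_pMr// le_min; apply/andP; split.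
    apply: (@le_trans _ _ (pr [set t | r < `|x t|])).
      by apply: le_pr => [||t _ []//]; [apply: m01I|]; exact: m01_gt.
    by rewrite ler_peMl// pr_ge0//; exact: m01_gt.
  apply: le_trans (zy _ s0).
  by apply: le_pr => [||t _ []//]; [apply: m01I|]; exact: m01_gt.
rewrite ge0_integralZl//; last by move=> s _; exact: upper_ge0.
rewrite -e2 -mulrA EFinM; apply: lee_wpmul2l; first by rewrite lee_fin.
have C0 : 0 <= C.
  have := yC _ (ss_one X); rewrite ss_norm_one mulr1 -lee_fin; apply: le_trans.
  by apply: integral_ge0 => t _; rewrite lee_fin mulr_ge0.
have := yC _ Xx'; under eq_integral do rewrite (ger0_norm (x'0 _)).
by move=> /le_trans; apply; rewrite lee_fin ler_wpM2l.
Qed.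

End Dual.

Section Integrals.
Context {R : realType}.
Local Notation U01 := (unit_itv R).
Implicit Types (f g : R -> R).

Lemma int01_ge0 f : (forall t, U01 t -> 0 <= f t) -> (0 <= int01 f)%E.
Proof. by move=> f0; apply: integral_ge0 => t tU; rewrite lee_fin f0. Qed.

Lemma le_int01 f g : mfun01 f -> mfun01 g -> (forall t, U01 t -> 0 <= f t) ->
  (forall t, U01 t -> 0 <= g t) -> ae01 (fun t => f t <= g t) ->
  (int01 f <= int01 g)%E.
Proof.
by move=> mf mg f0 g0 fg; apply: ae_ge0_le_integral => //;
  [exact: measurable_U01|exact/measurable_EFinP|exact/measurable_EFinP].
Qed.

Lemma int01Z k f : 0 <= k -> mfun01 f -> (forall t, U01 t -> 0 <= f t) ->
  int01 (fun t => k * f t) = (k%:E * int01 f)%E.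
Proof.
move=> k0 mf f0; rewrite /int01; under eq_integral do rewrite EFinM.
by rewrite ge0_integralZl//; [exact: measurable_U01|exact/measurable_EFinP].
Qed.

Lemma int01D f g : mfun01 f -> mfun01 g -> (forall t, U01 t -> 0 <= f t) ->
  (forall t, U01 t -> 0 <= g t) ->
  int01 (fun t => f t + g t) = (int01 f + int01 g)%E.
Proof.
move=> mf mg f0 g0; rewrite /int01; under eq_integral do rewrite EFinD.
by rewrite ge0_integralD//;
  [exact: measurable_U01|exact/measurable_EFinP|exact/measurable_EFinP].
Qed.

Lemma mfun01_cst (c : R) : mfun01 (cst c).
Proof. exact: measurable_cst. Qed.

Lemma mfun01_sum (I : Type) (s : seq I) (P : pred I) (F : I -> R -> R) :
  (forall i, P i -> mfun01 (F i)) ->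
  mfun01 (fun t => \sum_(i <- s | P i) F i t).
Proof.
move=> mF; elim: s => [|i s IH].
  by under eq_fun do rewrite big_nil; exact: mfun01_cst.
have [Pi|/negbTE Pi] := boolP (P i); under eq_fun do rewrite big_cons Pi; last by [].
by apply: measurable_funD => //; exact: mF.
Qed.

Lemma int01_sum (I : Type) (s : seq I) (F : I -> R -> R) :
  (forall i, mfun01 (F i)) -> (forall i t, U01 t -> 0 <= F i t) ->
  int01 (fun t => \sum_(i <- s) F i t) = (\sum_(i <- s) int01 (F i))%E.
Proof.
move=> mF F0; elim: s => [|i s IH].
  rewrite big_nil /int01; under eq_integral do rewrite big_nil.
  by rewrite integral0.
rewrite big_cons -IH -int01D//; [|exact: mfun01_sum|exact: F0|]; last first.
  by move=> t tU; apply: sumr_ge0 => j _; exact: F0.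
by congr int01; apply/funext => t; rewrite big_cons.
Qed.

Lemma eq_int01 f g : (forall t, U01 t -> f t = g t) -> int01 f = int01 g.
Proof. by move=> fg; apply: eq_integral => t /set_mem /fg ->. Qed.

Lemma int01_indic (A : set R) : m01 A -> int01 (\1_A) = (pr A)%:E.
Proof.
move=> mA; rewrite -prE// /prob01 -(setIid U01) -setIA setIC.
rewrite -integral_indic//; last exact: measurable_U01.
apply: eq_integral => t tU; rewrite /= !indicE; congr ((nat_of_bool _)%:R%:E).
by apply/idP/idP => /set_mem; [move=> tA; apply/mem_set; split => //; exact: set_mem|
  case=> _ /mem_set].
Qed.

Lemma mfun01_if (A : set R) f g : m01 A -> mfun01 f -> mfun01 g ->
  mfun01 (fun t => if t \in A then f t else g t).
Proof.
move=> mA mf mg _ B mB.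
rewrite (_ : _ `&` _ = (U01 `&` (A `&` f @^-1` B)) `|`
                       (U01 `&` (~` A `&` g @^-1` B))).
  apply: measurableU; apply: m01I => //; try exact: m01C.
  - exact: m01_preimage.
  - exact: m01_preimage.
apply/seteqP; split => t /= [].
  move=> tU; case: ifPn => [/set_mem ?|/negP tA]; [by left|right].
  by split => //; split => // /mem_set.
  by move=> [tU [/mem_set -> ?]].
by move=> [tU [tA gB]]; split => //; rewrite memNset.
Qed.

Lemma mfun01_ifb (P : R -> bool) f g : m01 [set t | P t] -> mfun01 f ->
  mfun01 g -> mfun01 (fun t => if P t then f t else g t).
Proof.
move=> mP mf mg; rewrite (_ : (fun t => _) =
  (fun t => if t \in [set t | P t] then f t else g t)); first exact: mfun01_if.
apply/funext => t; congr (if _ then _ else _).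
by apply/idP/idP => [?|/set_mem//]; exact/mem_set.
Qed.

Lemma mfun01_indic (A : set R) : m01 A -> mfun01 (\1_A : R -> R).
Proof.
move=> mA; rewrite (_ : \1_A = fun t => if t \in A then cst 1 t else cst 0 t).
  by apply: mfun01_if => //; exact: mfun01_cst.
by apply/funext => t; rewrite indicE; case: (_ \in _).
Qed.

End Integrals.

Section SymmetricSpace.
Context {R : realType}.
Local Notation U01 := (unit_itv R).
Variable X : symmetric_space R.
Local Notation norm := (ss_norm X).
Implicit Types (x y z : R -> R) (A B : set R).

Lemma ss_bounded x (B : R) : mfun01 x -> (forall t, U01 t -> `|x t| <= B) ->
  ss_mem X x /\ norm x <= `|B|.
Proof.
move=> mx xB; have X1 := ss_scale B (ss_one X).
have := ss_norm_scale B (ss_one X); rewrite ss_norm_one mulr1 => <-.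
apply: ss_ideal => //; apply: ae01_all => t tU.
rewrite indicE mem_set// mulr1; apply: le_trans (xB _ tU) _; exact: ler_norm.
Qed.

Lemma ss_cst (a : R) : ss_mem X (cst a) /\ norm (cst a) <= `|a|.
Proof.
by have := @ss_bounded (cst a) `|a| (mfun01_cst a) (fun _ _ => lexx _);
  rewrite normr_id.
Qed.

Lemma ss_mem0 : ss_mem X (cst 0). Proof. by have [] := ss_cst 0. Qed.

Lemma ss_norm0 : norm (cst 0) = 0.
Proof.
have := ss_norm_scale 0 ss_mem0; rewrite normr0 mul0r => e; rewrite -[RHS]e.
by congr norm; apply/funext => t; rewrite mul0r.
Qed.

Lemma ss_memN x : ss_mem X x ->
  ss_mem X (fun t => - x t) /\ norm (fun t => - x t) = norm x.
Proof.
move=> Xx; have := ss_scale (-1) Xx; have := ss_norm_scale (-1) Xx.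
rewrite normrN normr1 mul1r (_ : (fun t => -1 * x t) = (fun t => - x t))//.
by apply/funext => t; rewrite mulN1r.
Qed.

Lemma ss_norm_ge0 x : ss_mem X x -> 0 <= norm x.
Proof.
move=> Xx; have [XN nN] := ss_memN Xx.
have := ss_norm_triangle Xx XN; rewrite nN.
rewrite (_ : x \+ _ = cst 0) ?ss_norm0; first by lra.
by apply/funext => t /=; rewrite subrr.
Qed.

Lemma ss_sub x y : ss_mem X x -> ss_mem X y -> ss_mem X (x \- y).
Proof. by move=> Xx /ss_memN[/(ss_add Xx)]. Qed.

Lemma ss_norm_sub x y : ss_mem X x -> ss_mem X y ->
  norm (x \- y) = norm (y \- x).
Proof.
move=> Xx Xy; rewrite -(proj2 (ss_memN (ss_sub Xx Xy))); congr norm.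
by apply/funext => t /=; rewrite opprB.
Qed.

Lemma ss_sum (I : Type) (s : seq I) (F : I -> R -> R) :
  (forall i, ss_mem X (F i)) ->
  ss_mem X (fun t => \sum_(i <- s) F i t) /\
  norm (fun t => \sum_(i <- s) F i t) <= \sum_(i <- s) norm (F i).
Proof.
move=> XF; elim: s => [|i s [Xs ns]].
  rewrite big_nil (_ : (fun _ => _) = cst 0); last first.
    by apply/funext => t; rewrite big_nil.
  by rewrite ss_norm0; split => //; exact: ss_mem0.
rewrite big_cons (_ : (fun _ => _) = F i \+ (fun t => \sum_(i <- s) F i t)).
  split; first exact: ss_add.
  by apply: le_trans (ss_norm_triangle _ _) _ => //; rewrite lerD2l.
by apply/funext => t; rewrite big_cons.
Qed.

(** * Order continuity of the norm *)

Section OrderContinuity.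
Hypothesis lower2 : lower_2_estimate X.
Variable u : R -> R.
Hypothesis Xu : ss_mem X u.

Let slice (a b : nat) t := if (a%:R < `|u t| <= b%:R) then u t else 0.

Let mu_ : mfun01 u. Proof. exact: ss_measurable Xu. Qed.
Let mau : mfun01 (fun t => `|u t|). Proof. exact: mfun01_abs. Qed.

Let m_le (b : R) : m01 [set t | `|u t| <= b].
Proof.
rewrite (_ : [set t | _] = ~` [set t | b < `|u t|]).
  by apply: m01C; exact: m01_gt.
by apply/seteqP; split => t /=; rewrite leNgt => /negP.
Qed.

Let mslice a b : mfun01 (slice a b).
Proof.
apply: mfun01_ifb => //; last exact: mfun01_cst.
rewrite (_ : [set t | _] = [set t | a%:R < `|u t|] `&` [set t | `|u t| <= b%:R]).
  by apply: m01I => //; exact: m01_gt.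
by apply/seteqP; split => t /= => [/andP|] [? ?] //; apply/andP.
Qed.

Let Xslice a b : ss_mem X (slice a b).
Proof.
apply: (proj1 (ss_ideal Xu (mslice a b) _)).
by apply: ae01_all => t _; rewrite /slice; case: ifPn => // _; rewrite normr0.
Qed.

(** Otherwise there are levels such that every slice between consecutive ones has norm above [e]. By
    the lower 2-estimate, [N] of these disjoint slices give [e * sqrt N <= C * norm u], which fails
    for the chosen [N]. *)
Let slice_small e : 0 < e -> exists M, forall b, norm (slice M b) <= e.
Proof.
move=> e0; apply: contrapT => H.
have {}H M : exists b, (M <= b)%N /\ e < norm (slice M b).
  apply: contrapT => H'; apply: H; exists M => b; rewrite leNgt; apply/negP => eb.
  apply: H'; exists b; split => //; rewrite leqNgt; apply/negP => bM.
  move: eb; rewrite (_ : slice M b = cst 0) ?ss_norm0 ?ltNge ?(ltW e0)//.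
  apply/funext => t; rewrite /slice; case: ifPn => // /andP[h1 /(lt_le_trans h1)].
  by rewrite ltr_nat ltnNge ltnW.
have /choice[next Hn] := H.
pose M k := iter k next 0%N.
have Mle k l : (k <= l)%N -> (M k <= M l)%N.
  move=> /subnK <-; elim: (l - k)%N => // n IH; apply: leq_trans IH _.
  by rewrite addSn; have [] := Hn (M (n + k)%N).
have [C C0 HC] := lower2.
have nu : 0 <= norm u by exact: ss_norm_ge0.
pose N := Num.bound ((C * norm u / e) ^+ 2).
have HN : (C * norm u / e) ^+ 2 < N%:R by apply: archi_boundP; exact: sqr_ge0.
pose F (k : 'I_N) := slice (M k) (M k.+1).
have disj (j k : 'I_N) t : j != k -> F j t * F k t = 0.
  move=> jk; rewrite /F /slice.
  case: ifPn => [/andP[h1 h2]|]; last by rewrite mul0r.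
  case: ifPn => [/andP[h3 h4]|]; last by rewrite mulr0.
  have a1 : (M j < M k.+1)%N by rewrite -(ltr_nat R) (lt_le_trans h1).
  have a2 : (M k < M j.+1)%N by rewrite -(ltr_nat R) (lt_le_trans h3).
  move: jk; rewrite -val_eqE neq_ltn => /orP[] /Mle h.
    by have := leq_trans a2 h; rewrite ltnn.
  by have := leq_trans a1 h; rewrite ltnn.
have le1 : norm (fun t => \sum_(k < N) F k t) <= norm u.
  apply: (proj2 (ss_ideal Xu _ _)); first by apply: mfun01_sum => k _; exact: mslice.
  apply: ae01_all => t _.
  have [[k Fk]|F0] := pselect (exists k : 'I_N, F k t != 0); last first.
    rewrite big1 ?normr0// => k _; apply/eqP; apply: contrapT => /negP Fk.
    by apply: F0; exists k.
  rewrite (bigD1 k)//= big1 ?addr0.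
    by rewrite /F /slice; case: ifPn => // _; rewrite normr0.
  move=> j /(disj _ _ t) /eqP; rewrite mulf_eq0 (negbTE Fk) orbF.
  by move=> /eqP.
have le2 : N%:R * e ^+ 2 <= \sum_(k < N) norm (F k) ^+ 2.
  rewrite -[N in N%:R]card_ord -sumr_const mulr_suml; apply: ler_sum => k _.
  rewrite mul1r lerXn2r ?nnegrE ?(ltW e0)//; first by apply: ss_norm_ge0; exact: Xslice.
  by apply: ltW; have [] := Hn (M k).
have le3 := HC N F (fun k => Xslice _ _) (fun j k jk => ae01_all (fun t _ => disj j k t jk)).
have le4 : Num.sqrt (\sum_(k < N) norm (F k) ^+ 2) <= C * norm u.
  by rewrite mulrC -ler_pdivrMr// mulrC; exact: le_trans le1.
have le5 : N%:R * e ^+ 2 <= (C * norm u) ^+ 2.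
  apply: le_trans le2 _; rewrite -[leLHS]sqr_sqrtr; last first.
    by apply: sumr_ge0 => k _; exact: sqr_ge0.
  by rewrite lerXn2r ?nnegrE ?sqrtr_ge0 ?mulr_ge0// ltW.
move: HN; rewrite expr_div_n ltr_pdivrMr ?exprn_gt0//.
by move=> /(le_lt_trans le5); rewrite ltxx.
Qed.

(** [slice_small] controls slices bounded from above only. It makes the truncations [w n] a Cauchy
    sequence, and completeness then takes care of the whole unbounded part. *)
Lemma ss_truncation e : 0 < e ->
  exists n : nat, let v t := if n%:R < `|u t| then u t else 0 in
    ss_mem X v /\ norm v <= e.
Proof.
move=> e0; pose w (n : nat) t := if `|u t| <= n%:R then u t else 0.
have mw n : mfun01 (w n) by apply: mfun01_ifb => //; exact: mfun01_cst.
have Xw n : ss_mem X (w n).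
  apply: (proj1 (ss_ideal Xu (mw n) _)).
  by apply: ae01_all => t _; rewrite /w; case: ifPn => // _; rewrite normr0.
have cauchy d : 0 < d -> exists M : nat, forall m n : nat,
    (M <= m)%N -> (M <= n)%N -> norm (w m \- w n) < d.
  move=> d0; have [|M HM] := @slice_small (d / 2); first by lra.
  suff H m n : (M <= m)%N -> (m <= n)%N -> norm (w m \- w n) < d.
    exists M => m n Mm Mn; have [mn|nm] := leqP m n; first exact: H.
    by rewrite ss_norm_sub//; apply: H => //; exact: ltnW.
  move=> Mm mn; apply: (@le_lt_trans _ _ (norm (slice M n))); last first.
    by apply: le_lt_trans (HM n) _; lra.
  apply: (proj2 (ss_ideal (Xslice _ _) (ss_measurable (ss_sub (Xw _) (Xw _))) _)).
  apply: ae01_all => t _; rewrite /= /w /slice.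
  have mnR : m%:R <= n%:R :> R by rewrite ler_nat.
  have [h1|h1] := leP `|u t| m%:R.
    by rewrite (le_trans h1 mnR) subrr normr0.
  have [h2|h2] := leP `|u t| n%:R; last by rewrite subrr normr0.
  by rewrite sub0r normrN ifT// andbT (le_lt_trans _ h1)// ler_nat.
have [z Xz wz] := ss_complete Xw cauchy.
(* The limit is [u]: on [{|u| <= k}] the difference [u - z] is dominated by [w n - z] for every
   [n >= k], so its norm is 0. *)
have uz : ae01 (fun t => forall k : nat, `|u t| <= k%:R -> u t = z t).
  apply: ae01_forall => k.
  pose v t := if `|u t| <= k%:R then u t - z t else 0.
  have mv : mfun01 v.
    apply: mfun01_ifb => //; last exact: mfun01_cst.
    by apply: measurable_funB => //; exact: ss_measurable Xz.
  have vle n : (k <= n)%N -> ss_mem X v /\ norm v <= norm (w n \- z).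
    move=> kn; apply: ss_ideal => //; first exact: ss_sub.
    apply: ae01_all => t _; rewrite /v /w /=; case: ifPn => h; last by rewrite normr0.
    by rewrite (le_trans h)// ler_nat.
  have [Xv _] := vle k (leqnn k).
  have : norm v = 0.
    apply/eqP; rewrite eq_le ss_norm_ge0// andbT leNgt; apply/negP => v0.
    have [N _ HN] := cvgr_lt _ wz _ v0.
    have := HN (maxn k N) (leq_maxr _ _).
    by rewrite /= ltNge; case/negP; apply: (proj2 (vle _ _)); exact: leq_maxl.
  move=> /(ss_norm_eq0 Xv); apply: ae01S => t _; rewrite /v => + h.
  by rewrite h => /eqP; rewrite subr_eq0 => /eqP.
have [N _ HN] := cvgr_lt _ wz _ e0.
exists N => v.
have mv : mfun01 v by apply: mfun01_ifb => //; [exact: m01_gt|exact: mfun01_cst].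
have [Xv nv] : ss_mem X v /\ norm v <= norm (w N \- z).
  apply: ss_ideal => //; first exact: ss_sub.
  apply: ae01S uz => t _ H; rewrite /v /w /=.
  case: ltP => [_|_]; last by rewrite normr0.
  rewrite sub0r normrN -(H (Num.bound `|u t|))//.
  by apply: ltW; exact: archi_boundP.
by split => //; apply: le_trans nv _; apply: ltW; exact: HN (leqnn N).
Qed.

End OrderContinuity.
End SymmetricSpace.

Section DisjointUnion.
Context {R : realType}.

Lemma bigU_cons (I : eqType) (i : I) (s : seq I) (F : I -> set R) :
  [set t | exists2 j, j \in i :: s & F j t] =
  F i `|` [set t | exists2 j, j \in s & F j t].
Proof.
apply/seteqP; split => t /=.
  move=> [j]; rewrite inE => /predU1P[-> ?|js ?]; [by left|by right; exists j].
move=> [Fi|[j js Fj]]; first by exists i; rewrite ?mem_head.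
by exists j => //; rewrite inE js orbT.
Qed.

Lemma m01_bigU (I : eqType) (s : seq I) (F : I -> set R) :
  (forall i, m01 (F i)) -> m01 [set t | exists2 i, i \in s & F i t].
Proof.
move=> mF; elim: s => [|i s IH].
  by rewrite (_ : [set t | _] = set0); [exact: m01_0|apply/seteqP; split => t // []].
by rewrite bigU_cons; exact: m01U.
Qed.

Lemma pr_bigU (I : eqType) (s : seq I) (F : I -> set R) : uniq s ->
  (forall i, m01 (F i)) -> (forall i j t, i != j -> F i t -> F j t -> False) ->
  pr [set t | exists2 i, i \in s & F i t] = \sum_(i <- s) pr (F i).
Proof.
move=> us mF dF; elim: s us => [_|i s IH /= /andP[is_ us]].
  by rewrite big_nil -[RHS](@pr0 R); apply: eq_pr => t _; split => // -[].
rewrite bigU_cons big_cons -IH// prU//; first exact: m01_bigU.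
by move=> t _ Fi [j js Fj]; apply: (dF i j t) => //; apply: contraNneq is_ => ->.
Qed.

End DisjointUnion.

(** * Conditional expectations *)

Section Averaging.
Context {R : realType}.
Local Notation mu := (@lebesgue_measure R).
Local Notation U01 := (unit_itv R).
Variable X : symmetric_space R.
Local Notation norm := (ss_norm X).
Implicit Types (x y z : R -> R) (A B : set R).

Definition intA A x : \bar R := int01 (fun t => if t \in A then x t else 0).

Lemma mfun01_restr A x : m01 A -> mfun01 x ->
  mfun01 (fun t => if t \in A then x t else 0).
Proof. by move=> mA mx; apply: mfun01_if => //; exact: mfun01_cst. Qed.

Lemma intA_tail_le A x y : m01 A -> mfun01 x -> mfun01 y ->
  (forall t, U01 t -> 0 <= x t) -> (forall t, U01 t -> 0 <= y t) ->
  (forall s, 0 <= s ->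
    pr (A `&` [set t | s < x t]) <= pr (A `&` [set t | s < y t])) ->
  (intA A x <= intA A y)%E.
Proof.
move=> mA mx my x0 y0 xy.
have U0 := @measurable_U01 R.
have E z : mfun01 z -> (forall t, U01 t -> 0 <= z t) ->
    let w := fun t => if t \in A then z t else 0 in
    measurable_fun setT (upper_integral U01 (cst 1) w) /\
    intA A z = (\int[mu]_s upper_integral U01 (cst 1%R) w s)%E.
  move=> mz z0 w.
  have [||||m e] := @layer_cake R U01 (cst 1) w U0.
  - exact: mfun01_cst.
  - exact: mfun01_restr.
  - by move=> t _ /=.
  - by move=> t tU; rewrite /w; case: ifPn => // _; exact: z0.
  by split => //; rewrite -e; apply: eq_integral => t _; rewrite mul1r.
have EE z s : mfun01 z -> 0 <= s ->
    upper_integral U01 (cst 1) (fun t => if t \in A then z t else 0) s =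
    (pr (A `&` [set t | s < z t]))%:E.
  move=> mz s0; rewrite /upper_integral s0.
  have mI : m01 (A `&` [set t | s < z t]) by apply: m01I => //; exact: m01_gt.
  rewrite (_ : _ `&` _ = U01 `&` (A `&` [set t | s < z t])).
    by rewrite (@integral_cst _ _ _ mu _ mI 1) mul1e -prE.
  apply/seteqP; split => t /= [tU].
    by case: ifPn => [/set_mem//|_]; rewrite ltNge s0.
  by move=> [/mem_set -> ?].
have [mx1 ->] := E x mx x0; have [my1 ->] := E y my y0.
apply: ge0_le_integral => //.
- move=> s _; rewrite /upper_integral; case: ifPn => // _.
  by apply: integral_ge0 => t _; rewrite lee_fin.
- move=> s _; have [s0|s0] := leP 0 s.
    by rewrite !EE// lee_fin xy.
  by rewrite /upper_integral (leNgt 0%R s) s0.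
Qed.

Lemma tail_intA_eq A x y : m01 A -> mfun01 x -> mfun01 y ->
  (forall t, U01 t -> 0 <= x t) -> (forall t, U01 t -> 0 <= y t) ->
  (forall s, 0 <= s ->
    pr (A `&` [set t | s < x t]) = pr (A `&` [set t | s < y t])) ->
  intA A x = intA A y.
Proof.
by move=> mA mx my x0 y0 xy; apply/eqP; rewrite eq_le; apply/andP; split;
  apply: intA_tail_le => // s s0; rewrite xy.
Qed.

Section Cells.
Variables (A : set R) (x : R -> R) (B a : R) (K : nat).
Hypotheses (mA : m01 A) (A_gt0 : 0 < pr A) (Xx : ss_mem X x).
Hypothesis xB : forall t, U01 t -> 0 <= x t <= B.
Hypothesis a0 : 0 <= a.
Hypothesis aA : (a * pr A)%:E = intA A x.

Let n := K.+1.
Let p := pr A.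
Let Phi := cdf01 A.
Let T s := pr (A `&` [set t | s < x t]).
Let u (l : nat) : R := l%:R * p / n%:R.
Let cell (l : 'I_n) := A `&` [set t | u l <= Phi t] `&` [set t | Phi t < u l.+1].
(** The quantile function decreases, so its value at the right end of a cell is the lower one. *)
Let q (l : 'I_n) := quantile T (u l.+1).
(** The addition [l + j] in ['I_n] is modulo [n], so averaging over [j] gives every cell the same
    value. *)
Let xs (j : 'I_n) t := if t \in A then \sum_(l < n) q (l + j) * \1_(cell l) t
                       else x t.

Let mx : mfun01 x. Proof. exact: ss_measurable Xx. Qed.
Let mPhi : mfun01 Phi. Proof. exact: mfun01_cdf01. Qed.
Let mcell l : m01 (cell l).
Proof. by apply: m01I; [apply: m01I => //; exact: m01_ge|exact: m01_lt]. Qed.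

Let n0 : 0 < n%:R :> R. Proof. by rewrite ltr0n. Qed.

Let u0 l : 0 <= u l.
Proof. by rewrite /u divr_ge0// mulr_ge0// ltW. Qed.

Let uS l : u l.+1 = u l + p / n%:R.
Proof. by rewrite /u -natr1 mulrDl mul1r mulrDl. Qed.

Let u_gt0 l : 0 < u l.+1.
Proof. by rewrite uS ltr_wpDl// divr_gt0. Qed.

Let le_u k l : (k <= l)%N -> u k <= u l.
Proof. by move=> kl; rewrite /u ler_wpM2r ?invr_ge0 ?(ltW n0)// ler_wpM2r ?(ltW A_gt0)// ler_nat. Qed.

Let un : u n = p.
Proof. by rewrite /u mulrAC divff ?mul1r// gt_eqF. Qed.

Let pr_cell l : pr (cell l) = p / n%:R.
Proof.
have h1 : 0 <= u l <= p by rewrite u0 -un le_u// ltnW.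
have h2 : 0 <= u l.+1 <= p by rewrite u0 -un le_u.
have := cdf01_uniform mA h2; have := cdf01_uniform mA h1.
have mI v : m01 (A `&` [set t | Phi t < v]) by apply: m01I => //; exact: m01_lt.
have := pr_split (mI (u l.+1)) (m01_lt (u l) mPhi).
rewrite -/Phi; set b := pr _; set c := pr _; set d := pr _.
have -> : c = pr (A `&` [set t | Phi t < u l]).
  apply: eq_pr => t _ /=; split => [[[]]//|[tA h]]; split => //; split => //.
  by apply: lt_le_trans h _; exact: le_u.
have -> : d = pr (cell l).
  apply: eq_pr => t _ /=; split => [[[tA h1'] /negP]|[[tA h1'] h2']].
    by rewrite -leNgt.
  by split => //; apply/negP; rewrite -leNgt.
by move=> -> ->; rewrite uS => h; lra.
Qed.

Let cell_disj (k l : 'I_n) t : cell k t -> cell l t -> k = l.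
Proof.
move=> [[_ h1] h2] [[_ h3] h4]; apply/val_inj/eqP; rewrite /= in h1 h2 h3 h4.
case: (ltngtP k l) => // /le_u h; exfalso.
  by have := lt_le_trans h2 h; rewrite ltNge h3.
by have := lt_le_trans h4 h; rewrite ltNge h1.
Qed.

Let T_nincr : {homo T : s r / s <= r >-> r <= s}. Proof. exact: tail_nincr. Qed.
Let T_rcont s w : w < T s -> exists2 e, 0 < e & w < T (s + e).
Proof. exact: tail_rcont. Qed.
Let T_vanish w : 0 < w -> exists s, T s < w. Proof. exact: tail_vanish. Qed.

Let q0 l : 0 <= q l. Proof. exact: quantile_ge0. Qed.

Let xs_cell j l t : cell l t -> xs j t = q (l + j).
Proof.
move=> cl; rewrite /xs mem_set; last by case: cl => [[]].
rewrite (bigD1 l)//= big1 ?addr0 ?indicE ?mem_set ?mulr1// => k kl.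
by rewrite indicE memNset ?mulr0// => /(cell_disj cl) e; rewrite e eqxx in kl.
Qed.

Let mxs j : mfun01 (xs j).
Proof.
apply: mfun01_if => //; apply: mfun01_sum => l _.
by apply: measurable_funM; [exact: mfun01_cst|exact: mfun01_indic].
Qed.

Let pr_cells (P : pred 'I_n) :
  pr [set t | exists2 l, P l & cell l t] = \sum_(l < n | P l) p / n%:R.
Proof.
rewrite -big_filter -(eq_bigr _ (fun l _ => pr_cell l)) -pr_bigU//.
- apply: eq_pr => t _ /=; split => [[l Pl cl]|[l]]; first exists l => //.
    by rewrite mem_filter Pl mem_index_enum.
  by rewrite mem_filter => /andP[Pl _] cl; exists l.
- by rewrite filter_uniq// index_enum_uniq.
- by move=> k l t kl ck cl; move: kl; rewrite (cell_disj ck cl) eqxx.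
Qed.

Let m_cells (P : pred 'I_n) : m01 [set t | exists2 l, P l & cell l t].
Proof.
rewrite (_ : [set t | _] = [set t | exists2 l, l \in [seq l <- index_enum _ | P l] & cell l t]).
  by apply: m01_bigU.
apply/seteqP; split => t /= [l]; first by exists l => //; rewrite mem_filter mem_index_enum andbT.
by rewrite mem_filter => /andP[Pl _] cl; exists l.
Qed.

(** The cyclic shift only permutes cells of equal measure, so inside [A] one may take [j = 0]; the
    cells with [s < q l] then lie in [{Phi < T s}], a set of measure [T s]. *)
Let xs_tail j s : 0 <= s -> pr [set t | s < `|xs j t|] <= pr [set t | s < `|x t|].
Proof.
move=> s0.
have max : mfun01 (fun t => `|x t|) by exact: mfun01_abs.
have maxs : mfun01 (fun t => `|xs j t|) by exact: mfun01_abs.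
rewrite (pr_split (m01_gt s maxs) mA) (pr_split (m01_gt s max) mA).
apply: lerD; last first.
  apply: le_pr; try by apply: m01I; [exact: m01_gt|exact: m01C].
  by move=> t _ /= [+ tA]; rewrite /xs memNset.
have -> : pr ([set t | s < `|x t|] `&` A) = T s.
  apply: eq_pr => t tU /=; have /andP[x0 _] := xB tU.
  by rewrite ger0_norm//; split => [[]|[]].
have Ts : 0 <= T s <= p.
  rewrite pr_ge0 ?le_pr//; try by apply: m01I => //; exact: m01_gt.
  by move=> t _ [].
rewrite -(cdf01_uniform mA Ts).
have -> : pr ([set t | s < `|xs j t|] `&` A) =
          pr [set t | exists2 l, s < q (l + j) & cell l t].
  apply: eq_pr => t _ /=; split => [[sx tA]|[l sl cl]]; last first.
    by rewrite (xs_cell _ cl) ger0_norm//; split => //; case: cl => [[]].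
  have [[l cl]|nc] := pselect (exists l, cell l t).
    by exists l => //; move: sx; rewrite (xs_cell _ cl) ger0_norm.
  move: sx; rewrite /xs mem_set// big1 ?normr0 ?ltNge ?s0// => l _.
  by rewrite indicE memNset ?mulr0// => cl; apply: nc; exists l.
rewrite (pr_cells (fun l => s < q (l + j))).
have <- : \sum_(l < n | s < q l) p / n%:R = \sum_(l < n | s < q (l + j)) p / n%:R.
  by rewrite (reindex_inj (addIr j)).
rewrite -pr_cells.
apply: le_pr => //; first by apply: m01I => //; exact: m01_lt.
move=> t _ [l sl [[tA h1] h2]]; split => //=; apply: lt_trans h2 _.
by move: sl; rewrite /q quantile_gt.
Qed.

Let xs_ss j : ss_mem X (xs j) /\ norm (xs j) <= norm x.
Proof. by apply: tail_ss_mem => //; exact: xs_tail. Qed.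

Let Q := \sum_(l < n) q l.
Let N := A `&` [set t | p <= Phi t].

Let mN : m01 N. Proof. by apply: m01I => //; exact: m01_ge. Qed.

Let pr_N : pr N = 0.
Proof.
have mI : m01 [set t | Phi t < p] by exact: m01_lt.
have := pr_split mA mI.
have pp : 0 <= p <= p by rewrite lexx ltW.
rewrite (cdf01_uniform mA pp) -/p.
suff -> : pr (A `&` ~` [set t | Phi t < p]) = pr N by lra.
by apply: eq_pr => t _ /=; split => [[? /negP]|[? h]]; rewrite -?leNgt//;
  split => //; apply/negP; rewrite -leNgt.
Qed.

Let cell_exists t : A t -> Phi t < p -> exists l, cell l t.
Proof.
move=> tA; rewrite -un => h.
have [m [mn h1 h2]] : exists m, [/\ (m < n)%N, u m <= Phi t & Phi t < u m.+1].
  elim: {-2}n (leqnn n) h => [|m IH] mn h.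
    by move: h; rewrite /u !mul0r ltNge cdf01_ge0.
  have [h1|h1] := leP (u m) (Phi t); first by exists m.
  have [k [km k1 k2]] := IH (ltnW mn) h1.
  by exists k; split => //; exact: ltnW.
by exists (Ordinal mn).
Qed.

Let x_B t : U01 t -> 0 <= B.
Proof. by move=> /xB/andP[]; exact: le_trans. Qed.

Let B0 : 0 <= B.
Proof. by apply: (@x_B 0); rewrite /unit_itv /= in_itv/= lexx ler01. Qed.

(** Upper and lower Riemann sums of a monotone function: the upper value of a cell is the lower
    value of the preceding one, so the two sums differ by at most the first term [B]. *)
Let avg_le : a <= (B + Q) / n%:R.
Proof.
(* The quantile at 0 is 0 by convention, so the first cell needs the bound [B] of [x] instead. *)
pose r (l : 'I_n) := if l == ord0 then B else quantile T (u l).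
pose w t := \sum_(l < n) r l * \1_(cell l) t + B * \1_N t.
have r0 l : 0 <= r l by rewrite /r; case: ifPn => // _; exact: quantile_ge0.
have mi C : m01 C -> mfun01 (\1_C : R -> R) by exact: mfun01_indic.
have mi' (c : R) C : m01 C -> mfun01 (fun t => c * \1_C t).
  by move=> mC; apply: measurable_funM; [exact: mfun01_cst|exact: mi].
have mw : mfun01 w.
  apply: measurable_funD; last exact: mi'.
  by apply: mfun01_sum => l _; exact: mi'.
have w0 t : 0 <= w t.
  by rewrite addr_ge0 ?mulr_ge0// sumr_ge0// => l _; rewrite mulr_ge0.
have qB v : quantile T v <= B.
  rewrite leNgt quantile_gtE//; apply/negP => /andP[v0].
  rewrite (_ : T B = 0); first by rewrite ltNge ltW.
  rewrite -[RHS](@pr0 R); apply: eq_pr => t tU; split => // -[_ /=].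
  by have /andP[_] := xB tU; rewrite leNgt => /negP.
have mqP : mfun01 (quantile T \o Phi).
  exact: (measurable_comp _ _ (measurable_quantile T_nincr T_rcont T_vanish) mPhi).
have e1 : intA A x = intA A (quantile T \o Phi).
  apply: tail_intA_eq => //.
  - by move=> t /xB/andP[].
  - by move=> t _; exact: quantile_ge0.
  - move=> s s0; rewrite (pr_quantile T_nincr T_rcont T_vanish mA mPhi)//.
    + by move=> t; exact: cdf01_ge0.
    + by move=> v; exact: cdf01_uniform.
    + rewrite pr_ge0 ?le_pr//; try by apply: m01I => //; exact: m01_gt.
      by move=> t _ [].
have e2 : (intA A (quantile T \o Phi) <= int01 w)%E.
  apply: le_int01 => //.
  - exact: mfun01_restr.
  - by move=> t _; case: ifPn => // _; exact: quantile_ge0.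
  - apply: ae01_all => t _; case: ifPn => // /set_mem tA.
    have [h|h] := ltP (Phi t) p; last first.
      rewrite /w [\1_N t]indicE (mem_set (_ : N t))// mulr1.
      by apply: le_trans (qB _) _; rewrite lerDr sumr_ge0// => l _; rewrite mulr_ge0.
    have [l cl] := cell_exists tA h.
    apply: (@le_trans _ _ (r l)).
      rewrite /r; case: ifPn => [_|l0] /=; first exact: qB.
      apply: le_quantile => //; last by case: cl => [[]].
      by move: l0; rewrite -val_eqE /=; case: (val l) => // m _; exact: u_gt0.
    rewrite /w (bigD1 l)//= {1}indicE mem_set// mulr1 -addrA lerDl.
    by rewrite addr_ge0 ?mulr_ge0// sumr_ge0// => k _; rewrite mulr_ge0.
have e3 : int01 w = ((\sum_(l < n) r l) * (p / n%:R))%:E.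
  rewrite /w int01D//; last 4 first.
  - by apply: mfun01_sum => l _; exact: mi'.
  - exact: mi'.
  - by move=> t _; rewrite sumr_ge0// => l _; rewrite mulr_ge0.
  - by move=> t _; rewrite mulr_ge0.
  rewrite int01Z//; [|exact: mi]; rewrite int01_indic// pr_N mule0 adde0.
  rewrite int01_sum//; [|by move=> l; exact: mi'|by move=> l t _; rewrite mulr_ge0].
  rewrite mulr_suml -sumEFin; apply: eq_bigr => l _.
  by rewrite int01Z//; [|exact: mi]; rewrite int01_indic// pr_cell.
move: e2; rewrite -e1 -aA e3 lee_fin => h.
have h' : a <= (\sum_(l < n) r l) / n%:R.
  by rewrite -(ler_pM2r A_gt0) mulrAC -mulrA.
apply: le_trans h' _; rewrite ler_pM2r ?invr_gt0// /Q /n big_ord_recl big_ord_recr /=.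
rewrite {1}/r eqxx lerD2l -[leLHS]addr0 lerD//.
Qed.

(* Up to the error [B / n], which comes from replacing the quantile function by
   its lower step function, [z] is the mean of the functions [xs j] obtained by
   permuting cyclically [n] pieces of equal measure of [x] on [A]. *)
Lemma average_cells : let z t := if t \in A then a else x t in
  ss_mem X z /\ norm z <= norm x + B / n%:R.
Proof.
move=> z; have mz : mfun01 z by apply: mfun01_if => //; exact: mfun01_cst.
have [Xs ns] := @ss_sum _ X _ (index_enum 'I_n) xs (fun j => proj1 (xs_ss j)).
have Xs' := ss_scale n%:R^-1 Xs.
have := ss_norm_scale n%:R^-1 Xs.
rewrite ger0_norm ?invr_ge0 ?(ltW n0)// => ns'.
have X1 := ss_scale (B / n%:R) (ss_one X).
have := ss_norm_scale (B / n%:R) (ss_one X).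
rewrite ss_norm_one mulr1 ger0_norm ?divr_ge0 ?(ltW n0)// => n1.
have [Xz nz] : ss_mem X z /\ norm z <= norm ((fun t => n%:R^-1 * \sum_(j < n) xs j t) \+
   (fun t => B / n%:R * \1_U01 t)).
  apply: ss_ideal => //; first exact: ss_add.
  apply: ae01S (null_ae01 mN pr_N) => t tU Nt.
  have xs0 : 0 <= \sum_(j < n) xs j t.
    apply: sumr_ge0 => j _; rewrite /xs; case: ifPn => _.
      by rewrite sumr_ge0// => l _; rewrite mulr_ge0.
    by have /andP[] := xB tU.
  rewrite /= [\1_U01 t]indicE mem_set// mulr1 [leRHS]ger0_norm; last first.
    by rewrite addr_ge0 ?divr_ge0 ?mulr_ge0 ?invr_ge0 ?(ltW n0).
  rewrite /z; case: ifPn => [/set_mem tA|tA]; last first.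
    rewrite (eq_bigr (fun=> x t)); last by move=> j _; rewrite /xs (negbTE tA).
    have /andP[x0 _] := xB tU.
    rewrite sumr_const card_ord ger0_norm// -[x t *+ n]mulr_natl mulKf ?gt_eqF//.
    by rewrite lerDl divr_ge0 ?(ltW n0).
  have [l cl] : exists l, cell l t.
    apply: cell_exists => //; rewrite ltNge; apply/negP => h; exact: Nt.
  rewrite (eq_bigr (fun j => q (l + j))); last by move=> j _; exact: xs_cell.
  have -> : \sum_(j < n) q (l + j) = Q by rewrite /Q [RHS](reindex_inj (addrI l)).
  rewrite ger0_norm//.
  by apply: le_trans avg_le _; rewrite mulrDl addrC mulrC.
split => //; apply: le_trans nz _.
apply: le_trans (ss_norm_triangle Xs' X1) _; rewrite n1 lerD2r ns'.
rewrite ler_pdivrMl//; apply: le_trans ns _.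
apply: (@le_trans _ _ (\sum_(j < n) norm x)).
  by apply: ler_sum => j _; exact: (proj2 (xs_ss j)).
by rewrite sumr_const card_ord mulr_natl.
Qed.

End Cells.

(** The error [B / n] of [average_cells] vanishes as the number of cells grows. On a null set there
    are no cells, and nothing changes almost everywhere. *)
Lemma average_set A x (B a : R) : m01 A -> ss_mem X x ->
  (forall t, U01 t -> 0 <= x t <= B) -> 0 <= a ->
  (a * pr A)%:E = intA A x ->
  let z t := if t \in A then a else x t in ss_mem X z /\ norm z <= norm x.
Proof.
move=> mA Xx xB a0 aA z.
have [A0|A0] := eqVneq (pr A) 0.
  apply: ss_ideal => //.
    by apply: mfun01_if => //; [exact: mfun01_cst|exact: ss_measurable Xx].
  by apply: ae01S (null_ae01 mA A0) => t _ tA; rewrite /z memNset.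
have {}A0 : 0 < pr A by rewrite lt_neqAle eq_sym A0 pr_ge0.
have H K := @average_cells A x B a K mA A0 Xx xB a0 aA.
split; first exact: (proj1 (H 0%N)).
have B0 : 0 <= B.
  have U0 : U01 0 by rewrite /unit_itv /= in_itv/= lexx ler01.
  by have /andP[h1 h2] := xB 0 U0; exact: le_trans h1 h2.
rewrite leNgt; apply/negP => xz; pose d := norm z - norm x.
have d0 : 0 < d by rewrite subr_gt0.
have := archi_boundP (divr_ge0 B0 (ltW d0)); set K := Num.bound _ => h.
have := proj2 (H K); rewrite -lerBlDl -/z -/d ler_pdivlMr ?ltr0n//.
move: h; rewrite ltr_pdivrMr// mulrC => h.
have : d * K%:R <= d * K.+1%:R by rewrite ler_wpM2l ?(ltW d0)// ler_nat.
by move=> h1 /(le_trans h1) /(lt_le_trans h); rewrite ltxx.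
Qed.

(* Conditional expectation with respect to the partition by the values of [k]. *)
Lemma average_partition (k : R -> nat) m x (B : R) (a : nat -> R) :
  (forall i, m01 [set t | k t = i]) -> ss_mem X x ->
  (forall t, U01 t -> 0 <= x t <= B) -> (forall i, 0 <= a i <= B) ->
  (forall i, (a i * pr [set t | k t = i])%:E = intA [set t | k t = i] x) ->
  let z t := if (k t < m)%N then a (k t) else x t in
  ss_mem X z /\ norm z <= norm x.
Proof.
move=> mk Xx xB aB aA; elim: m => [|m [Xz nz]] z.
  by split => //; rewrite (_ : z = x)//; apply/funext.
pose y t := if (k t < m)%N then a (k t) else x t.
have zE : z = fun t => if t \in [set t | k t = m] then a m else y t.
  apply/funext => t; rewrite /z /y ltnS leq_eqVlt.
  have [<-|km] := eqVneq (k t) m; first by rewrite mem_set.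
  by rewrite memNset//; apply/eqP.
have [|||Xz' nz'] := @average_set [set t | k t = m] y B (a m) (mk m) Xz.
- by move=> t tU; rewrite /y; case: ifPn => // _; exact: xB.
- by have /andP[] := aB m.
- rewrite aA; apply: eq_int01 => t _; case: ifPn => // /set_mem /= km.
  by rewrite /y km ltnn.
by rewrite zE; split => //; exact: le_trans nz.
Qed.

End Averaging.

(** * Norming functions *)

Section HahnBanach.
Context {R : realType} (V : lmodType R) (p : V -> R).
Hypothesis pD : forall u v, p (u + v) <= p u + p v.
Hypothesis pZ : forall a v, p (a *: v) = `|a| * p v.

(* The functional being built takes the value [p c] at [c] and [w i] at [e i]. *)
Lemma hahn_banach_seq (c : V) (e : nat -> V) m : exists w : nat -> R,
  forall (a : R) (b : nat -> R),
    a * p c + \sum_(i < m) b i * w i <= p (a *: c + \sum_(i < m) b i *: e i).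
Proof.
have p0 v : 0 <= p v.
  have := pD v ((-1) *: v); rewrite pZ normrN normr1 mul1r scaleN1r subrr.
  have := pZ 0 0; rewrite scale0r normr0 mul0r => ->; lra.
elim: m => [|m [w Hw]].
  by exists (fun=> 0) => a b; rewrite !big_ord0 !addr0 pZ ler_wpM2r// ler_norm.
(* [S] collects the lower bounds imposed on the value at [e m], and [hS] bounds them by all the
   upper ones; the supremum satisfies both. *)
pose S := [set s | exists (a : R) (b : nat -> R),
  s = a * p c + \sum_(i < m) b i * w i -
      p (a *: c + \sum_(i < m) b i *: e i - e m)].
have hS (a : R) (b : nat -> R) s : S s ->
    s <= p (a *: c + \sum_(i < m) b i *: e i + e m) -
         (a * p c + \sum_(i < m) b i * w i).
  move=> [a' [b' ->]]; have := Hw (a + a') (fun i => b i + b' i).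
  rewrite (eq_bigr (fun i : 'I_m => b i * w i + b' i * w i)); last first.
    by move=> i _; rewrite mulrDl.
  rewrite (eq_bigr (fun i : 'I_m => b i *: e i + b' i *: e i)); last first.
    by move=> i _; rewrite scalerDl.
  rewrite !big_split /= mulrDl scalerDl.
  set x := \sum_(i < m) b i *: e i; set x' := \sum_(i < m) b' i *: e i.
  set y := \sum_(i < m) _; set y' := \sum_(i < m) _ => h.
  have := pD (a *: c + x + e m) (a' *: c + x' - e m).
  rewrite (_ : _ + _ + e m + _ = a *: c + a' *: c + (x + x')); last first.
    rewrite addrACA; rewrite (_ : a *: c + x + (a' *: c + x') = a *: c + a' *: c + (x + x')) ?subrr ?addr0//.
    by rewrite addrACA.
  by lra.
have S0 : S !=set0 by eexists; exists 0, (fun=> 0); reflexivity.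
have Sub : has_ubound S.
  eexists => s Ss; exact: (hS 0 (fun=> 0) s Ss).
pose r := sup S.
have r1 (a : R) (b : nat -> R) : a * p c + \sum_(i < m) b i * w i -
      p (a *: c + \sum_(i < m) b i *: e i - e m) <= r.
  by apply: ub_le_sup => //; exists a, b.
have r2 (a : R) (b : nat -> R) : r <= p (a *: c + \sum_(i < m) b i *: e i + e m) -
         (a * p c + \sum_(i < m) b i * w i).
  by apply: ge_sup => // s; exact: hS.
exists (fun i => if i == m then r else w i) => a b.
rewrite !big_ord_recr /= eqxx.
have -> : \sum_(i < m) b i * (if i == m :> nat then r else w i) =
          \sum_(i < m) b i * w i.
  by apply: eq_bigr => i _; rewrite ltn_eqF.
set x := \sum_(i < m) b i *: e i; set y := \sum_(i < m) _.
have lin_scale (l : R) : 0 < l ->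
    l * (l^-1 * a * p c + \sum_(i < m) l^-1 * b i * w i) = a * p c + y.
  move=> l0; rewrite mulrDr -mulrA mulVKf ?gt_eqF//; congr (_ + _).
  by rewrite mulr_sumr; apply: eq_bigr => i _; rewrite -mulrA mulVKf ?gt_eqF.
have p_scale (l : R) z : 0 < l ->
    l * p ((l^-1 * a) *: c + \sum_(i < m) (l^-1 * b i) *: e i + z) =
    p (a *: c + x + l *: z).
  move=> l0; rewrite -{1}(gtr0_norm l0) -pZ !scalerDr scalerA.
  rewrite mulVKf ?gt_eqF// scaler_sumr; congr (p (_ + _ + _)).
  by apply: eq_bigr => i _; rewrite scalerA mulVKf ?gt_eqF.
(* Dividing by [|b m|] reduces to the coefficient 1 or -1 of [e m], that is, to [r2] or [r1]. *)
have [b0|b0|->] := ltgtP (b m) 0; last first.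
- by rewrite mul0r scale0r !addr0; exact: Hw.
- have := r2 ((b m)^-1 * a) (fun i => (b m)^-1 * b i).
  by rewrite -(ler_pM2l b0) mulrBr lin_scale// p_scale// !addrA; lra.
- have b1 : 0 < - b m by rewrite oppr_gt0.
  have := r1 ((- b m)^-1 * a) (fun i => (- b m)^-1 * b i).
  rewrite -(ler_pM2l b1) mulrBr lin_scale// p_scale// scalerN scaleNr opprK.
  by rewrite !addrA; lra.
Qed.

End HahnBanach.

Section DualTheory.
Context {R : realType}.
Local Notation mu := (@lebesgue_measure R).
Local Notation U01 := (unit_itv R).
Variable X : symmetric_space R.
Local Notation norm := (ss_norm X).
Implicit Types (x y z g : R -> R) (A : set R).

Lemma mfun01M x y : mfun01 x -> mfun01 y -> mfun01 (fun t => x t * y t).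
Proof. exact: measurable_funM. Qed.

Lemma mfun01_absM x y : mfun01 x -> mfun01 y -> mfun01 (fun t => `|x t| * `|y t|).
Proof. by move=> mx my; apply: mfun01M; exact: mfun01_abs. Qed.

Lemma dual_le_ge0 C y : dual_le X C y -> 0 <= C.
Proof.
move=> [_ yC]; have := yC _ (ss_one X); rewrite ss_norm_one mulr1 -lee_fin.
by apply: le_trans; apply: integral_ge0 => t _; rewrite lee_fin mulr_ge0.
Qed.

Lemma dual_leW C D y : C <= D -> dual_le X C y -> dual_le X D y.
Proof.
move=> CD [my yC]; split => // x Xx; apply: le_trans (yC _ Xx) _.
by rewrite lee_fin ler_wpM2r// ss_norm_ge0.
Qed.

Lemma dual_leD C D y1 y2 y : dual_le X C y1 -> dual_le X D y2 -> mfun01 y ->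
  ae01 (fun t => `|y t| <= `|y1 t| + `|y2 t|) -> dual_le X (C + D) y.
Proof.
move=> [m1 h1] [m2 h2] my yy; split => // x Xx; have mx := ss_measurable Xx.
apply: (@le_trans _ _ (int01 (fun t => `|x t| * `|y1 t| + `|x t| * `|y2 t|))).
  apply: le_int01 => //.
  - exact: mfun01_absM.
  - by apply: measurable_funD; exact: mfun01_absM.
  - by apply: ae01S yy => t _ h; rewrite -mulrDr ler_wpM2l.
rewrite int01D//; try exact: mfun01_absM.
by rewrite mulrDl EFinD; apply: leeD; [exact: h1|exact: h2].
Qed.

Lemma dual_leS C y1 y : dual_le X C y1 -> mfun01 y ->
  ae01 (fun t => `|y t| <= `|y1 t|) -> dual_le X C y.
Proof.
move=> [m1 h1] my yy; split => // x Xx; have mx := ss_measurable Xx.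
apply: le_trans (h1 _ Xx); apply: le_int01 => //; try exact: mfun01_absM.
by apply: ae01S yy => t _ h; rewrite ler_wpM2l.
Qed.

Lemma dual_leZ C a y : dual_le X C y -> dual_le X (`|a| * C) (fun t => a * y t).
Proof.
move=> [my h]; split.
  by apply: mfun01M => //; exact: mfun01_cst.
move=> x Xx; have mx := ss_measurable Xx.
rewrite (_ : integral _ _ _ = int01 (fun t => `|a| * (`|x t| * `|y t|))).
  rewrite int01Z//; last exact: mfun01_absM.
  by rewrite -mulrA EFinM; apply: lee_wpmul2l; [rewrite lee_fin|exact: h].
by apply: eq_int01 => t _; rewrite normrM mulrCA.
Qed.

Lemma dual_le_sum (I : Type) (s : seq I) (C : I -> R) (y : I -> R -> R) :
  (forall i, dual_le X (C i) (y i)) ->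
  dual_le X (\sum_(i <- s) C i) (fun t => \sum_(i <- s) y i t).
Proof.
move=> Hy; elim: s => [|i s IH].
  rewrite big_nil; split.
    by apply: mfun01_sum => i _; exact: (proj1 (Hy i)).
  move=> x Xx; rewrite mul0r integral0_eq// => t _.
  by rewrite big_nil normr0 mulr0.
rewrite big_cons; apply: dual_leD (Hy i) IH _ _.
  by apply: mfun01_sum => j _; exact: (proj1 (Hy j)).
by apply: ae01_all => t _; rewrite big_cons ler_normD.
Qed.

Lemma dual_le_bounded C g : 0 <= C -> mfun01 g ->
  (forall x (B : R), ss_mem X x -> (forall t, U01 t -> 0 <= x t <= B) ->
    (int01 (fun t => x t * `|g t|)%R <= (C * norm x)%:E)%E) ->
  dual_le X C g.
Proof.
move=> C0 mg H; split => // x Xx; have mx := ss_measurable Xx.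
pose xn (n : nat) t := Num.min `|x t| n%:R.
have xn0 n t : 0 <= xn n t by rewrite /xn le_min normr_ge0/=.
have mxn n : mfun01 (xn n).
  by apply: measurable_minr; [exact: mfun01_abs|exact: mfun01_cst].
have Xn n : ss_mem X (xn n) /\ norm (xn n) <= norm x.
  apply: ss_ideal => //; apply: ae01_all => t _.
  by rewrite ger0_norm// ge_min lexx.
pose f n t : \bar R := (xn n t * `|g t|)%:E.
have fx t : limn (f ^~ t) = (`|x t| * `|g t|)%:E.
  apply: lim_near_cst => //; exists (Num.bound `|x t|) => // n /= bn.
  rewrite /f /xn (min_idPl _)//; apply: ltW.
  apply: (@lt_le_trans _ _ (Num.bound `|x t|)%:R); last by rewrite ler_nat.
  exact: archi_boundP.
have U0 := @measurable_U01 R.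
have mf n : measurable_fun U01 (f n).
  by apply/measurable_EFinP; apply: mfun01M => //; exact: mfun01_abs.
have f0 n t : U01 t -> (0 <= f n t)%E by move=> _; rewrite lee_fin mulr_ge0.
have nd t : U01 t -> {homo f ^~ t : n m / (n <= m)%N >-> (n <= m)%E}.
  move=> _ n m nm; rewrite lee_fin ler_wpM2r// le_min ge_min lexx /=.
  by rewrite ge_min ler_nat nm orbT.
rewrite (_ : integral _ _ _ = limn (fun n => \int[mu]_(t in U01) f n t)%E).
  apply: lime_le.
    apply: ereal_nondecreasing_is_cvgn => n m nm; apply: ge0_le_integral => //.
    - by move=> t; exact: f0.
    - exact: mf.
    - exact: mf.
    - by move=> t tU; exact: nd.
  near=> n; apply: le_trans (H _ n%:R (proj1 (Xn n)) _) _.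
    by move=> t _; rewrite xn0 /xn ge_min lexx orbT.
  by rewrite lee_fin ler_wpM2l//; exact: (proj2 (Xn n)).
rewrite -monotone_convergence//; apply: eq_integral => t _; exact/esym/fx.
Unshelve. all: by end_near. Qed.

Lemma intA_fin_num A x (B : R) : m01 A -> ss_mem X x ->
  (forall t, U01 t -> 0 <= x t <= B) ->
  exists2 a, 0 <= a <= B & (a * pr A)%:E = intA A x.
Proof.
move=> mA Xx xB; have mx := ss_measurable Xx.
have B0 : 0 <= B.
  have U0 : U01 0 by rewrite /unit_itv /= in_itv/= lexx ler01.
  by have /andP[h1 h2] := xB 0 U0; exact: le_trans h1 h2.
have mi : mfun01 (\1_A : R -> R) by exact: mfun01_indic.
have I0 : (0 <= intA A x)%E.
  by apply: int01_ge0 => t tU; case: ifPn => // _; have /andP[] := xB _ tU.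
have IB : (intA A x <= (B * pr A)%:E)%E.
  rewrite EFinM -int01_indic// -int01Z//.
  apply: le_int01.
  - exact: mfun01_restr.
  - by apply: mfun01M => //; exact: mfun01_cst.
  - by move=> t tU; case: ifPn => // _; have /andP[] := xB _ tU.
  - by move=> t tU; rewrite mulr_ge0.
  - apply: ae01_all => t tU; rewrite indicE; case: ifPn => _; last by rewrite mulr0.
    by rewrite mulr1; have /andP[] := xB _ tU.
have If : intA A x = (fine (intA A x))%:E.
  by rewrite fineK// ge0_fin_numE//; exact: le_lt_trans IB (ltry _).
have p0 := pr_ge0 mA.
(* On a null set this quotient is 0 by convention, which still lies in [[0, B]]. *)
exists (fine (intA A x) / pr A).
  rewrite divr_ge0 ?fine_ge0//=.
  have [->|A0] := eqVneq (pr A) 0; first by rewrite invr0 mulr0.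
  rewrite ler_pdivrMr; last by rewrite lt_neqAle eq_sym A0.
  by rewrite -lee_fin -If.
have [A0|A0] := eqVneq (pr A) 0; last by rewrite divfK.
rewrite A0 !mulr0; apply/eqP; rewrite eq_le I0/=.
by move: IB; rewrite A0 mulr0.
Qed.

(** Averaging over the whole of [[0,1]] replaces a nonnegative [x] by the constant equal to its
    integral, which is also the norm of that constant. *)
Lemma dual_le1 : dual_le X 1 (cst 1).
Proof.
apply: dual_le_bounded => // [|x B Xx xB]; first exact: mfun01_cst.
have [a /andP[a0 aB] ax] := @intA_fin_num setT x B m01T Xx xB.
have [_] := @average_set _ X setT x B a m01T Xx xB a0 ax.
rewrite (_ : int01 _ = intA setT x); last first.
  by apply: eq_int01 => t _; rewrite in_setT normr1 mulr1.
rewrite -ax prT mulr1 mul1r lee_fin; apply: le_trans.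
have [Xa _] := ss_cst X a.
have X1 := ss_scale a (ss_one X).
have := ss_norm_scale a (ss_one X); rewrite ss_norm_one mulr1 ger0_norm// => {1}<-.
apply: (proj2 (ss_ideal _ (ss_measurable X1) _)).
  by rewrite (_ : (fun _ => _) = cst a)//; apply/funext => t; rewrite in_setT.
apply: ae01_all => t tU; rewrite in_setT indicE mem_set// mulr1//.
Qed.

End DualTheory.

Section Norming.
Context {R : realType}.
Local Notation mu := (@lebesgue_measure R).
Local Notation U01 := (unit_itv R).
Variable X : symmetric_space R.
Local Notation norm := (ss_norm X).
Implicit Types (x y z g f : R -> R) (A : set R).

Definition pairing x y : R := fine (int01 (fun t => x t * y t)).

Lemma dual_integrable C x g : ss_mem X x -> dual_le X C g ->
  mu.-integrable U01 (fun t => (x t * g t)%:E).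
Proof.
move=> Xx [mg h]; have mx := ss_measurable Xx.
apply/integrableP; split; first by apply/measurable_EFinP; exact: mfun01M.
rewrite (_ : integral _ _ _ = int01 (fun t => `|x t| * `|g t|)%R).
  by apply: le_lt_trans (h _ Xx) (ltry _).
by apply: eq_integral => t _; rewrite abse_EFin normrM.
Qed.

Lemma integrable_fin01 f : mu.-integrable U01 (EFin \o f) ->
  int01 f = (fine (int01 f))%:E.
Proof.
by move=> H; rewrite fineK//; apply: integrable_fin_num H; exact: measurable_U01.
Qed.

Lemma int01_lin f g (a b : R) : mu.-integrable U01 (EFin \o f) ->
  mu.-integrable U01 (EFin \o g) ->
  int01 (fun t => a * f t + b * g t) = (a%:E * int01 f + b%:E * int01 g)%E.
Proof.
move=> i1 i2; have U0 := @measurable_U01 R.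
by rewrite /int01 -!integralZl// -integralD//; exact: integrableZl.
Qed.

Lemma pairingE C x g : ss_mem X x -> dual_le X C g ->
  int01 (fun t => x t * g t) = (pairing x g)%:E.
Proof.
by move=> Xx Hg; rewrite -integrable_fin01//; exact: dual_integrable Xx Hg.
Qed.

Lemma pairing_le C x g : ss_mem X x -> dual_le X C g ->
  `|pairing x g| <= C * norm x.
Proof.
move=> Xx Hg; have mx := ss_measurable Xx; have mg := proj1 Hg.
rewrite -lee_fin -abse_EFin -(pairingE Xx Hg).
apply: le_trans (proj2 Hg _ Xx).
apply: le_trans (le_abse_integral _ _ _) _.
- exact: measurable_U01.
- by apply/measurable_EFinP; exact: mfun01M.
- by rewrite le_eqVlt; apply/orP; left; apply/eqP; apply: eq_integral => t _;
    rewrite abse_EFin normrM.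
Qed.

Lemma pairing_lin C x y g a b : ss_mem X x -> ss_mem X y -> dual_le X C g ->
  pairing (fun t => a * x t + b * y t) g = a * pairing x g + b * pairing y g.
Proof.
move=> Xx Xy Hg; apply: EFin_inj.
have Xa := ss_scale a Xx; have Xb := ss_scale b Xy.
rewrite EFinD !EFinM -!(pairingE _ Hg)//; last exact: ss_add.
have i1 := dual_integrable Xx Hg; have i2 := dual_integrable Xy Hg.
by rewrite -(int01_lin _ _ i1 i2); apply: eq_int01 => t _; ring.
Qed.

Lemma pairing_linr C D x g h a b : ss_mem X x -> dual_le X C g ->
  dual_le X D h ->
  pairing x (fun t => a * g t + b * h t) = a * pairing x g + b * pairing x h.
Proof.
move=> Xx Hg Hh; apply: EFin_inj.
have Hab : dual_le X (`|a| * C + `|b| * D) (fun t => a * g t + b * h t).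
  have Ha := dual_leZ a Hg; have Hb := dual_leZ b Hh.
  apply: dual_leD Ha Hb _ _.
    by apply: measurable_funD; [exact: (proj1 (dual_leZ a Hg))|
      exact: (proj1 (dual_leZ b Hh))].
  by apply: ae01_all => t _; rewrite ler_normD.
rewrite EFinD !EFinM -(pairingE Xx Hg) -(pairingE Xx Hh) -(pairingE Xx Hab).
have i1 := dual_integrable Xx Hg; have i2 := dual_integrable Xx Hh.
by rewrite -(int01_lin _ _ i1 i2); apply: eq_int01 => t _; ring.
Qed.

Section FinitePartition.
Variables (k : R -> nat) (m : nat).
Hypotheses (mk : forall i, m01 [set t | k t = i]) (km : forall t, (k t < m.+1)%N).

Let A i := [set t | k t = i].

Lemma mfun01_nat (c : nat -> R) : mfun01 (c \o k).
Proof.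
move=> _ B mB; pose s := [seq i <- iota 0 m.+1 | c i \in B].
have ms i : (i \in s) = (c i \in B) && (i < m.+1)%N.
  by rewrite mem_filter mem_iota.
rewrite (_ : U01 `&` _ = U01 `&` [set t | exists2 i, i \in s & A i t]).
  exact: m01_bigU.
apply/seteqP; split => t [tU].
  move=> Bt; split => //; exists (k t) => //.
  by rewrite ms km andbT; exact/mem_set.
move=> [i]; rewrite ms => /andP[/set_mem Bi _] ki; split => //=.
by rewrite /A /= in ki; rewrite ki.
Qed.

Lemma ss_mem_nat (c : nat -> R) : ss_mem X (c \o k).
Proof.
have [] // := @ss_bounded _ X (c \o k) (\sum_(i < m.+1) `|c i|) (mfun01_nat c) _.
move=> t _ /=; rewrite (bigD1 (Ordinal (km t)))//= lerDl; exact: sumr_ge0.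
Qed.

Lemma sum_nat (f : nat -> R -> R) t :
  \sum_(i < m.+1) (if t \in A i then f i t else 0) = f (k t) t.
Proof.
rewrite (bigD1 (Ordinal (km t)))//= mem_set// big1 ?addr0// => i.
rewrite -val_eqE /= => ik; rewrite memNset// => e.
by rewrite /A /= in e; rewrite e eqxx in ik.
Qed.

Lemma pairing_nat (c w : nat -> R) :
  pairing (c \o k) (w \o k) = \sum_(i < m.+1) c i * w i * pr (A i).
Proof.
have U0 := @measurable_U01 R.
have iA i : mu.-integrable U01 (EFin \o (\1_(A i) : R -> R)).
  apply/integrableP; split; first by apply/measurable_EFinP; exact: (mfun01_indic (mk i)).
  rewrite (_ : integral _ _ _ = int01 (\1_(A i))).
    by rewrite (int01_indic (mk i)) ltry.
  by apply: eq_integral => t _; rewrite /= ger0_norm.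
rewrite /pairing (_ : int01 _ = (\sum_(i < m.+1) c i * w i * pr (A i))%:E)//.
transitivity (\int[mu]_(t in U01)
    \sum_(i < m.+1) ((c i * w i)%:E * (\1_(A i) t : R)%:E))%E.
  apply: eq_integral => t _; rewrite /= -(sum_nat (fun i _ => c i * w i)) -sumEFin.
  apply: eq_bigr => i _; rewrite -EFinM indicE; case: (_ \in _); first by rewrite mulr1.
  by rewrite mulr0.
rewrite integral_sum//; last by move=> i; apply: integrableZl => //; exact: iA.
rewrite -sumEFin; apply: eq_bigr => i _.
rewrite integralZl//; last exact: iA.
by rewrite [RHS]EFinM -(int01_indic (mk i)).
Qed.

(** Functions constant on the cells form a space of dimension at most [m.+1]. Hahn-Banach yields a
    functional [v] there, and [v i / pr (A i)] is its density. The bound passes to all of [X]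
    because averaging over the cells does not increase the norm. *)
Lemma norming_nat (c : nat -> R) : exists w : nat -> R,
  dual_le X 1 (w \o k) /\ norm (c \o k) <= pairing (c \o k) (w \o k).
Proof.
pose st (v : 'rV[R]_m.+1) := (fun i => v 0 (inord i)) \o k.
pose p v := norm (st v).
have Xst v : ss_mem X (st v) by exact: ss_mem_nat.
have pD u v : p (u + v) <= p u + p v.
  rewrite /p (_ : st (u + v) = st u \+ st v); first exact: ss_norm_triangle.
  by apply/funext => t; rewrite /st /= mxE.
have pZ a v : p (a *: v) = `|a| * p v.
  rewrite /p -(ss_norm_scale a (Xst v)); congr norm.
  by apply/funext => t; rewrite /st /= mxE.
pose e i : 'rV[R]_m.+1 := delta_mx 0 (inord i).
have [v Hv] := hahn_banach_seq pD pZ (\row_j c j) e m.+1.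
have rowE (b : nat -> R) : \sum_(i < m.+1) b i *: e i = \row_j b j.
  rewrite [RHS]row_sum_delta; apply: eq_bigr => i _.
  by rewrite mxE /e inord_val.
have stE (b : nat -> R) : st (\row_j b j) = b \o k.
  by apply/funext => t; rewrite /st /= mxE inordK.
have F1 (b : nat -> R) : \sum_(i < m.+1) b i * v i <= norm (b \o k).
  by have := Hv 0 b; rewrite mul0r add0r scale0r add0r rowE /p stE.
(* For [a = 1] and [b = - c] the vector on the right of [Hv] is zero. *)
have F2 : norm (c \o k) <= \sum_(i < m.+1) c i * v i.
  have := Hv 1 (fun i => - c i); rewrite mul1r scale1r (rowE (fun i => - c i)).
  rewrite (eq_bigr (fun i : 'I_m.+1 => - (c i * v i))); last by move=> i _; rewrite mulNr.
  rewrite sumrN (_ : _ + _ = \row_j cst 0 j); last first.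
    by apply/rowP => j; rewrite !mxE subrr.
  rewrite /p stE (stE (cst 0)) (_ : norm (cst 0 \o k) = 0); [lra|exact: ss_norm0].
pose w i := v i / pr (A i).
(* On a null cell the quotient is 0, and so is [v i]: both signs of the indicator of that cell have
   norm 0. *)
have wv (i : 'I_m.+1) : w i * pr (A i) = v i.
  have [A0|A0] := eqVneq (pr (A i)) 0; last by rewrite divfK.
  rewrite A0 mulr0; pose d (s : R) (j : nat) := if j == i then s else 0.
  have vd s : s * v i <= 0.
    have := F1 (d s); rewrite (bigD1 i)//= /d eqxx big1 ?addr0; last first.
      by move=> j ji; rewrite -val_eqE in ji; rewrite (negbTE ji) mul0r.
    move=> /le_trans; apply; rewrite -[leRHS](ss_norm0 X).
    apply: (proj2 (ss_ideal (ss_mem0 X) _ _)); first exact: mfun01_nat.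
    apply: ae01S (null_ae01 (mk i) A0) => t _ /= /eqP ki.
    by rewrite (negbTE ki).
  apply/eqP; rewrite eq_le; have := vd 1; have := vd (-1).
  by rewrite mulN1r mul1r oppr_le0 => -> ->.
exists w; split; last first.
  apply: le_trans F2 _; rewrite pairing_nat; apply: ler_sum => i _.
  by rewrite -mulrA wv.
apply: dual_le_bounded => // [|x B Xx xB]; first exact: mfun01_nat.
have mx := ss_measurable Xx.
have /choice[a Ha] : forall i, exists a, 0 <= a <= B /\ (a * pr (A i))%:E = intA (A i) x.
  by move=> i; have [a h1 h2] := intA_fin_num (mk i) Xx xB; exists a.
rewrite (_ : int01 _ = (\sum_(i < m.+1) `|w i|%:E * intA (A i) x)%E); last first.
  rewrite (eq_bigr (fun i : 'I_m.+1 => int01 (fun t => `|w i| * (if t \in A i then x t else 0)))); last first.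
    move=> i _; rewrite int01Z//; first exact: (mfun01_restr (mk i) mx).
    by move=> t tU; case: ifPn => // _; have /andP[] := xB _ tU.
  rewrite -int01_sum.
  - apply: eq_int01 => t _; rewrite -(sum_nat (fun i t => x t * `|w i|)).
    by apply: eq_bigr => i _; case: ifPn => _; rewrite ?mulr0// mulrC.
  - by move=> i; apply: mfun01M; [exact: mfun01_cst|exact: (mfun01_restr (mk i) mx)].
  - move=> i t tU; rewrite mulr_ge0//; case: ifPn => // _.
    by have /andP[] := xB _ tU.
rewrite (eq_bigr (fun i : 'I_m.+1 => (Num.sg (w i) * a i * v i)%:E)); last first.
  move=> i _; have [_ <-] := Ha i; rewrite -EFinM; congr EFin.
  by rewrite normrEsg -wv; ring.
rewrite sumEFin lee_fin mul1r.
(* The signs recover the absolute values of [w], and the signed cell averages are bounded pointwise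
   by the conditional expectation of [x]. *)
apply: le_trans (F1 (fun i => Num.sg (w i) * a i)) _.
have [Xz] := @average_partition _ X k m.+1 x B a mk Xx xB (fun i => proj1 (Ha i)) (fun i => proj2 (Ha i)).
apply: le_trans; apply: (proj2 (ss_ideal Xz _ _)); first exact: mfun01_nat.
apply: ae01_all => t _ /=; rewrite km normrM normr_sg ler_piMl//.
by case: (_ == _).
Qed.

End FinitePartition.

End Norming.

Section NormingFunction.
Context {R : realType}.
Variable X : symmetric_space R.
Local Notation norm := (ss_norm X).
Implicit Types (x y z g f : R -> R) (A : set R).

(* Index of the cell of [r] in the subdivision of [0, n] into cells of length
   [1 / l]; all the reals outside [0, n] have index 0. *)
Definition grid (n l : nat) (r : R) : nat :=
  if r <= n%:R then Num.truncn (r * l%:R) else 0.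

Lemma grid_gt n l r i :
  (i < grid n l r)%N = (r <= n%:R) && (i.+1%:R <= r * l%:R).
Proof. by rewrite /grid; case: ifPn => //= h; rewrite truncn_gt_nat. Qed.

Lemma grid_lt n l r : (grid n l r < (n * l).+1)%N.
Proof.
rewrite ltnS leqNgt grid_gt; apply/negP => /andP[h1 h2].
have : r * l%:R <= (n * l)%:R by rewrite natrM ler_wpM2r.
by move=> /(le_trans h2); rewrite ler_nat ltnn.
Qed.

Lemma measurable_grid n l i : (0 < l)%N ->
  measurable [set r | grid n l r = i].
Proof.
move=> l0; have mg j : measurable [set r | (j < grid n l r)%N].
  rewrite (_ : [set r | _] = `[j.+1%:R / l%:R, n%:R]%classic).
    exact: measurable_itv.
  apply/seteqP; split => r /=; rewrite in_itv/= grid_gt andbC;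
    by rewrite ler_pdivrMr ?ltr0n.
case: i => [|i].
  rewrite (_ : [set r | _] = ~` [set r | (0 < grid n l r)%N]).
    exact: measurableC.
  by apply/seteqP; split => r /=; rewrite lt0n; [move=> ->|
    move=> /negP; rewrite negbK => /eqP].
rewrite (_ : [set r | _] =
    [set r | (i < grid n l r)%N] `\` [set r | (i.+1 < grid n l r)%N]).
  exact: measurableD.
apply/seteqP; split => r /= => [->|[h1 /negP]]; first by rewrite ltnn leqnn.
by rewrite -leqNgt => h2; apply/eqP; rewrite eqn_leq h2.
Qed.

Lemma measurable_fun_grid (w : nat -> R) n l : (0 < l)%N ->
  measurable_fun setT (w \o grid n l).
Proof.
move=> l0 _ B mB; rewrite setTI (_ : _ @^-1` _ =
    \bigcup_i (if w i \in B then [set r | grid n l r = i] else set0)).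
  apply: bigcupT_measurable => i; case: ifPn => // _; exact: measurable_grid.
apply/seteqP; split => r /= => [Br|[i _]].
  by exists (grid n l r) => //; rewrite mem_set.
by case: ifPn => // /set_mem Bi /= ->.
Qed.

Let pos f t := Num.max (f t) 0.

Lemma mfun01_pos f : mfun01 f -> mfun01 (pos f).
Proof. by move=> mf; apply: measurable_maxr => //; exact: mfun01_cst. Qed.

(** Of [v / 2], truncation loses [v / 8] and rounding to the grid [v / 8], so the step function has
    norm at least [v / 4]; replacing it by [f] in the pairing costs another [v / 8]. *)
Lemma norming_pos (lower2 : lower_2_estimate X) f (v : R) : ss_mem X f ->
  0 < v -> v / 2 <= norm (pos f) ->
  exists (h : R -> R) (V : seq R), [/\ measurable_fun setT h,
    forall r, h r \in V, dual_le X 1 (h \o f) & v / 8 <= pairing f (h \o f)].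
Proof.
move=> Xf v0 vf; have mf := ss_measurable Xf; have mp := mfun01_pos mf.
have p0 t : 0 <= pos f t by rewrite /pos le_max lexx orbT.
have Xp : ss_mem X (pos f).
  apply: (proj1 (ss_ideal Xf mp _)); apply: ae01_all => t _.
  by rewrite ger0_norm// /pos ge_max ler_norm normr_ge0.
have v8 : 0 < v / 8 by lra.
have [n] := ss_truncation lower2 Xp v8.
set u := fun t => _; move=> [Xu nu].
pose l := (Num.bound (8 / v)).+1.
have l0 : 0 < l%:R :> R by rewrite ltr0n.
have lv : l%:R^-1 <= v / 8.
  rewrite -[leRHS]invrK lef_pV2 ?posrE ?invr_gt0// invf_div ltW//.
  apply: (@lt_le_trans _ _ (Num.bound (8 / v))%:R); last by rewrite ler_nat.
  by apply: archi_boundP; rewrite divr_ge0// ltW.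
pose k := grid n l \o f; pose c (i : nat) : R := i%:R / l%:R.
have mk i : m01 [set t | k t = i].
  exact: (@m01_preimage _ f [set r | grid n l r = i] mf (@measurable_grid n l i isT)).
have km t : (k t < (n * l).+1)%N by exact: grid_lt.
have [w [Hw cw]] := norming_nat X mk km c.
(* Index 0 also collects the points where [f] is negative or exceeds [n]. There [c 0 = 0], so
   dropping [w 0] loses nothing for the step function and removes these points from the pairing with
   [f]. *)
pose w' i := if i == 0 then 0 else w i.
have Hw' : dual_le X 1 (w' \o k).
  apply: dual_leS Hw (mfun01_nat mk km _) _; apply: ae01_all => t _ /=.
  by rewrite /w'; case: ifPn => // _; rewrite normr0.
have Xc : ss_mem X (c \o k) by exact: ss_mem_nat.
have gridE t : pos f t <= n%:R -> k t = Num.truncn (pos f t * l%:R).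
  rewrite /k /grid /pos /=; have [h|h] := leP (f t) 0 => hn.
    rewrite (le_trans h) ?ler0n// mul0r truncn0.
    by apply/truncn0Pn; rewrite -ltNge (le_lt_trans _ ltr01)// mulr_le0_ge0.
  by rewrite hn.
have approx t : pos f t <= n%:R -> `|pos f t - c (k t)| <= l%:R^-1.
  move=> hn; rewrite gridE// /c.
  have /truncn_itv/andP[h1 h2] : 0 <= pos f t * l%:R by rewrite mulr_ge0// ltW.
  rewrite ger0_norm; last by rewrite subr_ge0 ler_pdivrMr.
  rewrite lerBlDl -[X in _ <= _ + X]div1r -mulrDl ler_pdivlMr// natr1; exact: ltW.
have k_out t : n%:R < pos f t -> k t = 0.
  rewrite /pos lt_max (ltNge n%:R 0) ler0n orbF /k /grid /= => h.
  by rewrite leNgt h.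
have X1 := ss_cst X.
have nc : v / 4 <= norm (c \o k).
  have [Xl nl] := X1 l%:R^-1; rewrite ger0_norm ?invr_ge0 ?(ltW l0)// in nl.
  have Xs := ss_add (ss_add Xc Xl) Xu.
  have le1 : norm (pos f) <= norm (((c \o k) \+ cst l%:R^-1) \+ u).
    apply: (proj2 (ss_ideal Xs mp _)); apply: ae01_all => t _ /=.
    have c0 : 0 <= c (k t) by rewrite divr_ge0 ?ler0n ?(ltW l0).
    rewrite /u (ger0_norm (p0 t)); case: ltP => h; rewrite ger0_norm ?addr_ge0 ?addr0//.
      by rewrite lerDr addr_ge0.
    by have := approx t h; rewrite ler_norml => /andP[_]; rewrite lerBlDl.
  have := ss_norm_triangle (ss_add Xc Xl) Xu.
  have := ss_norm_triangle Xc Xl; lra.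
pose r t := (if (0 < k t)%N then f t else 0) - c (k t).
have [Xr nr] : ss_mem X r /\ norm r <= norm (cst l%:R^-1).
  have [Xl _] := X1 l%:R^-1; apply: ss_ideal => //.
    apply: measurable_funB; last exact: mfun01_nat.
    apply: mfun01_ifb => //; last exact: mfun01_cst.
    rewrite (_ : [set t | _] = ~` [set t | k t = 0]); first exact: m01C.
    by apply/seteqP; split => t /=; rewrite lt0n => /eqP.
  apply: ae01_all => t _; rewrite [leRHS]ger0_norm ?invr_ge0 ?(ltW l0)//.
  rewrite /r; case: ifPn => [|]; rewrite -?leqNgt ?leqn0; last first.
    by move=> /eqP ->; rewrite /c mul0r subr0 normr0 invr_ge0 (ltW l0).
  move=> k0; have hn : pos f t <= n%:R.
    by rewrite leNgt; apply/negP => /k_out k0'; rewrite k0' in k0.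
  suff <- : pos f t = f t by exact: approx.
  rewrite /pos; apply/max_idPl; rewrite leNgt; apply/negP => f0.
  move: k0; rewrite gridE// /pos (max_idPr _) ?(ltW f0)//.
  by rewrite mul0r truncn0.
have nr8 : norm r <= v / 8.
  apply: le_trans nr _; have [_] := X1 l%:R^-1.
  rewrite ger0_norm ?invr_ge0 ?(ltW l0)// => h; exact: le_trans lv.
exists (w' \o grid n l), [seq w' i | i <- iota 0 (n * l).+1]; split => //.
- exact: measurable_fun_grid.
- by move=> s; apply: (map_f w'); rewrite mem_iota add0n grid_lt.
- have -> : pairing f ((w' \o grid n l) \o f) =
      pairing (fun t => 1 * (c \o k) t + 1 * r t) (w' \o k).
    congr fine; apply: eq_int01 => t _; rewrite /= /r /k /= /w'.
    have [->|k0] := eqVneq (grid n l (f t)) 0; first by rewrite !mulr0.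
    by rewrite lt0n k0 !mul1r addrC subrK.
  rewrite (pairing_lin _ _ Xc Xr Hw') !mul1r.
  have -> : pairing (c \o k) (w' \o k) = pairing (c \o k) (w \o k).
    congr fine; apply: eq_int01 => t _; rewrite /= /w'.
    by case: ifPn => // /eqP ->; rewrite /c !mul0r.
  have := pairing_le Xr Hw'; rewrite mul1r ler_norml => /andP[h _].
  lra.
Qed.

(** Either [f] or [- f] has a positive part of at least half the norm. Subtracting the mean costs 1
    in the dual radius and does not affect the pairing, as [f] has mean zero. The form [h \o f]
    preserves independence, and the finite list [V] makes the law discrete. *)
Lemma norming_function (lower2 : lower_2_estimate X) f : ss_mem X f ->
  0 < norm f -> int01 f = 0%E ->
  exists (h : R -> R) (V : seq R), [/\ measurable_fun setT h,
    forall r, h r \in V, dual_le X 2 (h \o f), int01 (h \o f) = 0%E &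
    norm f / 8 <= pairing f (h \o f)].
Proof.
move=> Xf f0 If.
have [Xn nn] := ss_memN Xf; have mf := ss_measurable Xf.
have [h [V [mh hV Hh ph]]] : exists (h : R -> R) (V : seq R),
   [/\ measurable_fun setT h, forall r, h r \in V, dual_le X 1 (h \o f) &
    norm f / 8 <= pairing f (h \o f)].
  have [hp|hp] := leP (norm f / 2) (norm (pos f)); first exact: norming_pos.
  have hm : norm f / 2 <= norm (pos (fun t => - f t)).
    have pabs g t : `|pos g t| <= `|g t|.
      rewrite ger0_norm; last by rewrite /pos le_max lexx orbT.
      by rewrite /pos ge_max ler_norm normr_ge0.
    have Xp : ss_mem X (pos f).
      apply: (proj1 (ss_ideal Xf (mfun01_pos mf) _)).
      by apply: ae01_all => t _; exact: pabs.
    have Xm : ss_mem X (pos (fun t => - f t)).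
      apply: (proj1 (ss_ideal Xn (mfun01_pos (ss_measurable Xn)) _)).
      by apply: ae01_all => t _; exact: pabs.
    have := ss_norm_triangle Xp (proj1 (ss_memN Xm)).
    rewrite (proj2 (ss_memN Xm)) (_ : _ \+ _ = f); first by lra.
    apply/funext => t /=; rewrite /pos.
    by case: (leP (f t) 0) => h; case: (leP (- f t) 0) => h'; lra.
  have [h [V [mh hV Hh ph]]] := norming_pos lower2 Xn f0 hm.
  exists (fun r => - h (- r)), [seq - s | s <- V]; split.
  - by apply: measurable_funN; apply: measurableT_comp => //; exact: oppr_measurable.
  - by move=> r; apply: map_f.
  - have mh2 := proj1 Hh; apply: dual_leS Hh _ _; first exact: measurable_funN.
    by apply: ae01_all => t _; rewrite /= normrN.
  - suff -> : pairing f ((fun r => - h (- r)) \o f) =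
       pairing (fun t => - f t) (h \o (fun t => - f t)) by [].
    by congr fine; apply: eq_int01 => t _ /=; rewrite mulrN mulNr.
have [X1 n1] := ss_cst X 1; rewrite normr1 in n1.
have H1 := dual_le1 X.
pose e := pairing (cst 1) (h \o f).
have e1 : `|e| <= 1.
  by apply: le_trans (pairing_le X1 Hh) _; rewrite mul1r.
have p11 : pairing (cst 1) (cst 1) = 1 :> R.
  rewrite /pairing (_ : int01 _ = int01 (\1_[set: R])).
    by rewrite int01_indic ?prT//; exact: m01T.
  by apply: eq_int01 => t _; rewrite /= mul1r indicE in_setT.
have pf1 : pairing f (cst 1) = 0.
  rewrite /pairing; have -> : int01 (fun t => f t * cst 1 t) = int01 f.
    by apply: eq_int01 => t _; rewrite mulr1.
  by rewrite If.
have mhf := proj1 Hh.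
have H2 : dual_le X 2 ((fun r => h r - e) \o f).
  rewrite (_ : 2 = 1 + 1) //; apply: dual_leD Hh H1 _ _.
    by apply: measurable_funB => //; exact: mfun01_cst.
  apply: ae01_all => t _ /=; apply: le_trans (ler_normB _ _) _.
  by rewrite lerD2l normr1.
have E2 x : pairing x ((fun r => h r - e) \o f) =
    pairing x (fun t => 1 * (h \o f) t + - e * cst 1 t).
  by congr fine; apply: eq_int01 => t _; rewrite /= mul1r mulr1.
exists (fun r => h r - e), [seq s - e | s <- V]; split => //.
- by apply: measurable_funB.
- by move=> r; apply: (map_f (fun s => s - e)).
- rewrite -(_ : int01 (fun t => cst 1 t * ((fun r => h r - e) \o f) t) = int01 _).
    rewrite (pairingE X1 H2) E2 (pairing_linr _ _ X1 Hh H1) p11 -/e.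
    by rewrite mul1r mulr1 subrr.
  by apply: eq_int01 => t _; rewrite mul1r.
- by rewrite E2 (pairing_linr _ _ Xf Hh H1) pf1 mulr0 addr0 mul1r.
Qed.

End NormingFunction.

(** * Sums of independent discrete variables *)

Section DiscreteLaws.
Context {R : realType}.
Implicit Types (w : seq (R * R)) (phi psi : R -> R).

(* The convolution operator [phi |-> (s |-> \sum p * phi (s + v))] of a discrete
   measure, given as a list of pairs (mass [p], atom [v]). *)
Definition conv w phi (s : R) : R := \sum_(pv <- w) pv.1 * phi (s + pv.2).

Definition nonneg_weights w := forall pv, pv \in w -> 0 <= pv.1.

Lemma conv_le w phi psi s : nonneg_weights w -> (forall r, phi r <= psi r) ->
  conv w phi s <= conv w psi s.
Proof.
move=> w0 h; rewrite /conv big_seq [leRHS]big_seq; apply: ler_sum => pv pw.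
by rewrite ler_wpM2l// w0.
Qed.

Lemma conv_ge0 w phi s : nonneg_weights w -> (forall r, 0 <= phi r) ->
  0 <= conv w phi s.
Proof.
move=> w0 h; rewrite /conv big_seq; apply: sumr_ge0 => pv pw.
by rewrite mulr_ge0// w0.
Qed.

Lemma convD w phi psi s :
  conv w (fun r => phi r + psi r) s = conv w phi s + conv w psi s.
Proof. by rewrite /conv -big_split; apply: eq_bigr => pv _; rewrite mulrDr. Qed.

Lemma convZ w a phi s : conv w (fun r => a * phi r) s = a * conv w phi s.
Proof. by rewrite /conv mulr_sumr; apply: eq_bigr => pv _; rewrite mulrCA. Qed.

Lemma conv_sum w n (F : nat -> R -> R) s :
  conv w (fun r => \sum_(j < n) F j r) s = \sum_(j < n) conv w (F j) s.
Proof.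
rewrite /conv exchange_big; apply: eq_bigr => pv _; exact: mulr_sumr.
Qed.

Lemma conv_cat w1 w2 phi s :
  conv (w1 ++ w2) phi s = conv w1 phi s + conv w2 phi s.
Proof. exact: big_cat. Qed.

Lemma convC w1 w2 phi s : conv w1 (conv w2 phi) s = conv w2 (conv w1 phi) s.
Proof.
rewrite /conv; under eq_bigr do rewrite mulr_sumr.
rewrite exchange_big; apply: eq_bigr => pv _; rewrite mulr_sumr.
by apply: eq_bigr => qu _; rewrite mulrCA -!addrA [qu.2 + _]addrC.
Qed.

Lemma iter_conv_ge0 w phi j s : nonneg_weights w -> (forall r, 0 <= phi r) ->
  0 <= iter j (conv w) phi s.
Proof.
by move=> w0 h; elim: j s => // j IH s; apply: conv_ge0 => // r; exact: IH.
Qed.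

Lemma nonneg_weights_cat w1 w2 : nonneg_weights w1 -> nonneg_weights w2 ->
  nonneg_weights (w1 ++ w2).
Proof. by move=> h1 h2 pv; rewrite mem_cat => /orP[/h1|/h2]. Qed.

(** The first two terms of the binomial expansion of the power of a sum of commuting positive
    operators. *)
Lemma iter_conv_cat_ge w1 w2 phi j s : nonneg_weights w1 ->
  nonneg_weights w2 -> (forall r, 0 <= phi r) ->
  iter j.+1 (conv w2) phi s + j.+1%:R * conv w1 (iter j (conv w2) phi) s <=
  iter j.+1 (conv (w1 ++ w2)) phi s.
Proof.
move=> h1 h2 p0; have h12 := nonneg_weights_cat h1 h2.
elim: j s => [|j IH] s; first by rewrite /= mul1r conv_cat addrC.
rewrite -[leRHS]/(conv (w1 ++ w2) (iter j.+1 (conv (w1 ++ w2)) phi) s).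
apply: le_trans (conv_le s h12 IH).
rewrite conv_cat !convD !convZ -[iter j.+2 _ _ s]/(conv w2 (iter j.+1 (conv w2) phi) s).
rewrite [conv w2 (conv w1 _) s]convC.
rewrite -[conv w2 (iter j (conv w2) phi)]/(iter j.+1 (conv w2) phi).
have : 0 <= j.+1%:R * conv w1 (conv w1 (iter j (conv w2) phi)) s.
  by rewrite mulr_ge0//; do 2 (apply: conv_ge0 => // ?); exact: iter_conv_ge0.
rewrite -[j.+2%:R]natr1 mulrDl mul1r; lra.
Qed.

(* [exp (w_1 + ... + w_n) >= (1 + w_1) ... (1 + w_n)] for commuting positive
   operators, with the exponential series truncated at order [n]. *)
Lemma exp_conv_ge (ws : seq (seq (R * R))) phi s :
  (forall w, w \in ws -> nonneg_weights w) -> (forall r, 0 <= phi r) ->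
  foldr (fun w psi r => psi r + conv w psi r) phi ws s <=
  \sum_(j < (size ws).+1) iter j (conv (flatten ws)) phi s / j`!%:R.
Proof.
move=> hws p0; elim: ws hws s => [|w ws IH] hws s.
  by rewrite /= big_ord_recl big_ord0 fact0 divr1 addr0.
have hw : nonneg_weights w by apply: hws; rewrite mem_head.
have {}IH := IH (fun w' h => hws w' (@mem_behead _ (w :: ws) w' h)).
have hf : nonneg_weights (flatten ws).
  move=> pv /flattenP[w' w'ws]; apply: hws.
  by rewrite inE w'ws orbT.
set A := flatten ws in IH *; set n := size ws in IH *.
rewrite /= -/A -/n.
apply: (@le_trans _ _ (\sum_(j < n.+1) iter j (conv A) phi s / j`!%:R +
   \sum_(j < n.+1) conv w (iter j (conv A) phi) s / j`!%:R)).
  apply: lerD; first exact: IH.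
  apply: le_trans (conv_le s hw IH) _; rewrite (conv_sum w n.+1 (fun j r => iter j (conv A) phi r / j`!%:R)).
  apply: ler_sum => j _.
  rewrite (_ : conv w _ s = j`!%:R^-1 * conv w (iter j (conv A) phi) s).
    by rewrite mulrC.
  by rewrite -convZ; apply: eq_bigr => pv _; rewrite [_ / _]mulrC.
rewrite [leRHS]big_ord_recl [X in X + _ <= _]big_ord_recl /= -addrA lerD2l.
(* As [1 / j! = (j + 1) / (j + 1)!], the [j]-th term containing [w] belongs to the power [j.+1], as
   in [iter_conv_cat_ge]. *)
apply: (@le_trans _ _ (\sum_(j < n.+1) (iter j.+1 (conv A) phi s +
    j.+1%:R * conv w (iter j (conv A) phi) s) / j.+1`!%:R)); last first.
  apply: ler_sum => j _; rewrite ler_wpM2r ?invr_ge0//.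
  exact: iter_conv_cat_ge.
under [leRHS]eq_bigr do rewrite mulrDl.
rewrite big_split /=; apply: lerD.
  rewrite [leRHS]big_ord_recr /= lerDl divr_ge0//.
  by apply: (@iter_conv_ge0 _ _ n.+1).
apply: ler_sum => j _; rewrite factS natrM invfM mulrACA divff ?mul1r//.
Qed.

End DiscreteLaws.

Section Independence.
Context {R : realType}.
Context {I : choiceType} (c : I -> R -> R).
Hypotheses (ic : independent c) (mc : forall i, mfun01 (c i)).

Definition law (f : R -> R) (V : seq R) : seq (R * R) :=
  [seq (pr [set t | f t = v], v) | v <- V].

Lemma nonneg_law f V : mfun01 f -> nonneg_weights (law f V).
Proof. by move=> mf pv /mapP[v _ ->] /=; apply: pr_ge0; exact: m01_eq. Qed.

Lemma m01_forall (K : seq I) (B : I -> set R) : (forall i, measurable (B i)) ->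
  m01 [set t | forall i, i \in K -> B i (c i t)].
Proof.
move=> mB; elim: K => [|i K IH].
  rewrite (_ : [set t | _] = setT); first exact: m01T.
  by apply/seteqP; split.
rewrite (_ : [set t | _] = c i @^-1` B i `&`
   [set t | forall i, i \in K -> B i (c i t)]).
  by apply: m01I => //; exact: m01_preimage.
apply/seteqP; split => t /= => [H|[h H] j].
  by split => [|j jK]; apply: H; rewrite inE ?eqxx ?jK ?orbT.
by rewrite inE => /predU1P[->|/H].
Qed.

Lemma pr_forall (K : seq I) (B : I -> set R) : uniq K ->
  (forall i, measurable (B i)) ->
  pr [set t | forall i, i \in K -> B i (c i t)] =
  \prod_(i <- K) pr (c i @^-1` B i).
Proof.
move=> uK mB; apply: EFin_inj; rewrite -prE; last exact: m01_forall.
have := ic (seq_fset tt K) mB.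
rewrite (_ : \bigcap_(i in _) _ = [set t | forall i, i \in K -> B i (c i t)]).
  move=> ->; rewrite (perm_big K) /=; last first.
    by apply: uniq_perm; [exact: sort_keys_uniq|exact: uK|exact: sort_keysE].
  rewrite -prodEFin; apply: eq_bigr => i _; rewrite prE//.
  exact: m01_preimage.
apply/seteqP; split => t /= H i iK; apply: H; move: iK => /=;
  by rewrite ?seq_fsetE ?sort_keysE.
Qed.

(** By induction on [J]: one summand is split over its finitely many values [v], and its index moves
    to [K] with the event [{v}]. Carrying the conditioned indices [K] makes the induction close. *)
Lemma int01_indep (J K : seq I) (V : I -> seq R) (B : I -> set R)
    (phi : R -> R) s :
  uniq (K ++ J) -> (forall i, measurable (B i)) ->
  (forall i, i \in J -> uniq (V i) /\ forall t, c i t \in V i) ->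
  measurable_fun setT phi -> (forall r, 0 <= phi r) ->
  int01 (fun t => \1_[set t | forall i, i \in K -> B i (c i t)] t *
                  phi (s + \sum_(i <- J) c i t)) =
  (\prod_(i <- K) pr (c i @^-1` B i) *
    foldr (fun i => conv (law (c i) (V i))) phi J s)%:E.
Proof.
move=> uKJ mB HV mphi phi0; elim: J K B s uKJ mB HV => [|i J IH] K B s uKJ mB HV.
  rewrite (eq_int01 (g := fun t => phi s *
      \1_[set t | forall i, i \in K -> B i (c i t)] t)); last first.
    by move=> t _; rewrite big_nil addr0 mulrC.
  have mK := @m01_forall K B mB.
  rewrite int01Z//; last exact: mfun01_indic.
  by rewrite int01_indic// pr_forall ?cats0// -?EFinM 1?mulrC//; rewrite cats0 in uKJ.
have [uV cV] := HV i (mem_head _ _).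
have iK : i \notin K.
  by move: uKJ; rewrite cat_uniq /= negb_or => /and3P[_ /andP[]].
pose B' (v : R) j : set R := if j == i then [set v] else B j.
have mB' v j : measurable (B' v j) by rewrite /B'; case: ifPn.
pose G v t := \1_[set t | forall j, j \in i :: K -> B' v j (c j t)] t *
              phi (s + v + \sum_(j <- J) c j t).
have mG v : mfun01 (G v).
  apply: mfun01M; first by apply: mfun01_indic; exact: m01_forall.
  apply: measurableT_comp => //; apply: measurable_funD; first exact: mfun01_cst.
  by apply: mfun01_sum => j _; exact: mc.
rewrite (eq_int01 (g := fun t => \sum_(v <- V i) G v t)); last first.
  move=> t _.
  have G0 v : v != c i t -> G v t = 0.
    move=> vc; rewrite /G indicE memNset ?mul0r//= => /(_ i (mem_head _ _)).
    by rewrite /B' eqxx /= => e; rewrite e eqxx in vc.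
  have S0 : \sum_(v <- V i | v != c i t) G v t = 0 by apply: big1 => v; exact: G0.
  rewrite (bigD1_seq (c i t))//= S0 addr0 /G.
  rewrite big_cons -addrA; congr (_ * _); rewrite !indicE; congr (_%:R).
  congr nat_of_bool; apply/idP/idP => /set_mem /= H; apply/mem_set => /= j.
    rewrite inE /B'; case: eqVneq => [-> _ //|ji /=]; exact: H.
  move=> jK; have := H j; rewrite inE jK orbT /B' => /(_ isT).
  by case: eqVneq => // e; move: iK; rewrite -e jK.
rewrite int01_sum//; last by move=> v t _; rewrite /G mulr_ge0.
rewrite /= /conv /law big_map mulr_sumr -sumEFin; apply: eq_bigr => v _ /=.
rewrite /G IH//; last 2 first.
- rewrite -(perm_uniq (_ : perm_eq (K ++ i :: J) _))//.
  by rewrite perm_catC /= perm_cons perm_catC.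
- by move=> j jJ; apply: HV; rewrite inE jJ orbT.
rewrite big_cons {1}/B' eqxx mulrCA; congr EFin; rewrite mulrA; congr (_ * _).
congr (_ * _); rewrite big_seq [RHS]big_seq.
by apply: eq_bigr => j jK; rewrite /B'; case: eqVneq => // e; rewrite -e jK in iK.
Qed.

Lemma pr_indep (J K : seq I) (V : I -> seq R) (B : I -> set R) (D : set R) :
  uniq (K ++ J) -> (forall i, measurable (B i)) -> measurable D ->
  (forall i, i \in J -> uniq (V i) /\ forall t, c i t \in V i) ->
  pr ([set t | forall i, i \in K -> B i (c i t)] `&`
      [set t | D (\sum_(i <- J) c i t)]) =
  \prod_(i <- K) pr (c i @^-1` B i) *
    foldr (fun i => conv (law (c i) (V i))) (\1_D) J 0.
Proof.
move=> uKJ mB mD HV; apply: EFin_inj.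
have mS : mfun01 (fun t => \sum_(i <- J) c i t).
  by apply: mfun01_sum => j _; exact: mc.
rewrite -int01_indic; last first.
  by apply: m01I; [exact: m01_forall|exact: (m01_preimage mS mD)].
have mI : measurable_fun setT (\1_D : R -> R) by apply: measurable_indic.
rewrite -(@int01_indep J K V B (\1_D) 0 uKJ mB HV mI)//.
apply: eq_int01 => t _; rewrite add0r !indicE -natrM mulnb; congr (nat_of_bool _)%:R.
by apply/idP/andP => [/set_mem[/= h1 h2]|[/set_mem h1 /set_mem h2]];
  [split; apply/mem_set|apply/mem_set].
Qed.

End Independence.

(** Lagrange's identity: the defect is half the double sum of the squares
    [(a i * b j - a j * b i) ^+ 2]. *)
Lemma sum_cauchy_schwarz {R : realType} (I : Type) (s : seq I) (a b : I -> R) :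
  \sum_(i <- s) a i * b i <=
  Num.sqrt (\sum_(i <- s) a i ^+ 2) * Num.sqrt (\sum_(i <- s) b i ^+ 2).
Proof.
set A := \sum_(i <- s) a i ^+ 2; set B := \sum_(i <- s) b i ^+ 2.
set S := \sum_(i <- s) _.
have A0 : 0 <= A by apply: sumr_ge0 => i _; exact: sqr_ge0.
have B0 : 0 <= B by apply: sumr_ge0 => i _; exact: sqr_ge0.
have : 0 <= \sum_(i <- s) \sum_(j <- s) (a i * b j - a j * b i) ^+ 2.
  by apply: sumr_ge0 => i _; apply: sumr_ge0 => j _; exact: sqr_ge0.
have -> : \sum_(i <- s) \sum_(j <- s) (a i * b j - a j * b i) ^+ 2 =
    A * B + A * B - S * S *+ 2.
  have e1 : A * B = \sum_(i <- s) \sum_(j <- s) a i ^+ 2 * b j ^+ 2.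
    by rewrite mulr_suml; apply: eq_bigr => i _; rewrite mulr_sumr.
  have e2 : A * B = \sum_(i <- s) \sum_(j <- s) a j ^+ 2 * b i ^+ 2.
    by rewrite e1 exchange_big.
  have e3 : S * S = \sum_(i <- s) \sum_(j <- s) (a i * b i) * (a j * b j).
    by rewrite mulr_suml; apply: eq_bigr => i _; rewrite mulr_sumr.
  rewrite {1}e1 e2 e3 -mulr_natr mulr_suml -big_split -sumrB /=.
  apply: eq_bigr => i _; rewrite mulr_suml -big_split -sumrB /=.
  by apply: eq_bigr => j _; ring.
rewrite mulr2n => h; have SS : S ^+ 2 <= A * B by rewrite expr2; lra.
apply: le_trans (ler_norm S) _; rewrite -sqrtrM// -sqrtr_sqr.
by rewrite ler_sqrt// mulr_ge0.
Qed.

Section Place.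
Context {R : realType}.
Implicit Types (w : seq (R * R)) (a u : R).

Definition mass w : R := \sum_(pv <- w) pv.1.

(* The step function on [[a, a + mass w[] taking the value [v] on an interval of
   length [p] for each [(p, v)] in [w]. *)
Fixpoint place a w u : R :=
  if w is pv :: w' then if a <= u < a + pv.1 then pv.2 else place (a + pv.1) w' u
  else 0.

Lemma mass_ge0 w : nonneg_weights w -> 0 <= mass w.
Proof.
by move=> w0; rewrite /mass big_seq; apply: sumr_ge0 => pv; exact: w0.
Qed.

Lemma place_mem a w u : place a w u \in 0 :: unzip2 w.
Proof.
elim: w a => [|pv w IH] a /=; first by rewrite mem_head.
case: ifPn => _; first by rewrite !inE eqxx orbT.
by have := IH (a + pv.1); rewrite !inE => /orP[->//|->]; rewrite !orbT.
Qed.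

Lemma place_ge0 a w u : (forall pv, pv \in w -> 0 <= pv.2) -> 0 <= place a w u.
Proof.
move=> h; have := place_mem a w u; rewrite inE => /predU1P[->//|].
by move=> /mapP[pv /h + ->].
Qed.

Lemma m01_itvco a b : m01 [set u : R | a <= u < b].
Proof.
apply: measurable_m01; rewrite (_ : [set u | _] = `[a, b[%classic).
  exact: measurable_itv.
by apply/seteqP; split => u /=; rewrite in_itv.
Qed.

Lemma pr_itvco a b : 0 <= a -> a <= b -> b <= 1 -> pr [set u : R | a <= u < b] = b - a.
Proof.
move=> a0 ab b1; apply: EFin_inj; rewrite -prE; last exact: m01_itvco.
rewrite /prob01 (_ : _ `&` _ = `[a, b[%classic).
  rewrite lebesgue_measure_itv/= lte_fin; case: ltP => // ba.
  by congr EFin; lra.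
apply/seteqP; split => u /=; rewrite /unit_itv /= !in_itv/=; first by case.
move=> /andP[h1 h2]; split; last by rewrite h1.
by rewrite (le_trans a0 h1) (le_trans (ltW h2) b1).
Qed.

Lemma measurable_place a w : measurable_fun setT (place a w).
Proof.
elim: w a => [|pv w IH] a /=; first exact: measurable_cst.
apply: measurable_fun_ifT => //.
have h1 : measurable_fun setT (fun u : R => a <= u) by exact: measurable_fun_ler.
have h2 : measurable_fun setT (fun u : R => u < a + pv.1) by exact: measurable_fun_ltr.
exact: measurable_and.
Qed.

Lemma mfun01_place a w : mfun01 (place a w).
Proof. by apply: measurable_funS (measurable_place a w). Qed.

Lemma int01_place w a (psi : R -> R) : nonneg_weights w -> 0 <= a ->
  a + mass w <= 1 -> (forall v, 0 <= psi v) ->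
  let F u := if a <= u < a + mass w then psi (place a w u) else 0 in
  mfun01 F /\ int01 F = (\sum_(pv <- w) pv.1 * psi pv.2)%:E.
Proof.
move=> + + + psi0; elim: w a => [|pv w IH] a w0 a0 aw F.
  rewrite big_nil (_ : F = cst 0).
    split; first exact: mfun01_cst.
    by rewrite /int01 integral0_eq.
  apply/funext => u; rewrite /F /mass big_nil addr0; case: ifPn => // /andP[h1].
  by rewrite ltNge h1.
have p0 : 0 <= pv.1 by apply: w0; rewrite mem_head.
have w0' : nonneg_weights w by move=> qu qw; apply: w0; rewrite inE qw orbT.
have m0 := mass_ge0 w0'.
have mE : mass (pv :: w) = pv.1 + mass w by rewrite /mass big_cons.
rewrite mE addrA in aw.
have [||mG IG] := IH (a + pv.1) w0'; [exact: addr_ge0|by []|].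
set G := fun u => _ in mG IG.
have m1 : mfun01 (fun u => psi pv.2 * \1_[set u | a <= u < a + pv.1] u).
  by apply: mfun01M; [exact: mfun01_cst|apply: mfun01_indic; exact: m01_itvco].
have FE : F = fun u => psi pv.2 * \1_[set u | a <= u < a + pv.1] u + G u.
  apply/funext => u; rewrite /F /G mE addrA /= indicE.
  have [h1|h1] := boolP (a <= u < a + pv.1).
    rewrite mem_set//= mulr1; move: (h1) => /andP[h2 h3].
    by rewrite h2 (lt_le_trans h3) ?lerDl//= (leNgt (a + pv.1)) h3 /= addr0.
  rewrite memNset/=; last exact/negP.
  rewrite mulr0 add0r; congr (if _ then _ else _).
  apply/andP/andP => -[h2 h3]; split => //.
    by rewrite leNgt; apply: contra h1 => h4; rewrite h2.
  by apply: le_trans h2; rewrite lerDl.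
rewrite FE; split; first exact: measurable_funD.
rewrite int01D//; last 2 first.
- by move=> u _; rewrite mulr_ge0.
- by move=> u _; rewrite /G; case: ifPn.
rewrite IG int01Z//; last by apply: mfun01_indic; exact: m01_itvco.
rewrite int01_indic; last exact: m01_itvco.
rewrite pr_itvco ?lerDl//; last by apply: le_trans aw; rewrite lerDl.
by rewrite big_cons (addrC a) addrK -EFinM -EFinD mulrC.
Qed.

End Place.

(** * Disjoint copies and the Kruglov property *)

Section UpperEstimate.
Context {R : realType}.
Local Notation U01 := (unit_itv R).
Variable X : symmetric_space R.
Local Notation norm := (ss_norm X).

(** The upper 2-estimate of the dual: [x] is cut along the sets [D k], each piece is paired with its
    [b k], and Cauchy-Schwarz leaves the square sum of the norms of the pieces, which the lower
    2-estimate bounds by the norm of [x]. *)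
Lemma dual_le_disjoint : lower_2_estimate X -> exists2 C : R, 0 < C &
  forall (N : nat) (D : 'I_N -> set R) (b : 'I_N -> R -> R) (beta : 'I_N -> R),
    (forall k, m01 (D k)) -> (forall j k t, D j t -> D k t -> j = k) ->
    (forall k t, U01 t -> ~ D k t -> b k t = 0) ->
    (forall k, dual_le X (beta k) (b k)) ->
    dual_le X (C * Num.sqrt (\sum_(k < N) beta k ^+ 2))
      (fun t => \sum_(k < N) b k t).
Proof.
move=> [C C0 HC]; exists C => // N D b beta mD dD bD Hb.
have mb k : mfun01 (b k) by exact: (proj1 (Hb k)).
split; first by apply: mfun01_sum => k _; exact: mb.
move=> x Xx; have mx := ss_measurable Xx.
pose xk k t := if t \in D k then x t else 0.
have mxk k : mfun01 (xk k) by exact: mfun01_restr.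
have Xk k : ss_mem X (xk k).
  apply: (proj1 (ss_ideal Xx (mxk k) _)); apply: ae01_all => t _; rewrite /xk.
  by case: ifPn => // _; rewrite normr0.
set bb := Num.sqrt _.
apply: (@le_trans _ _ (int01 (fun t => \sum_(k < N) `|xk k t| * `|b k t|))).
  apply: le_int01.
  - by apply: mfun01_absM => //; apply: mfun01_sum => k _; exact: mb.
  - by apply: mfun01_sum => k _; exact: mfun01_absM.
  - by move=> t _; rewrite mulr_ge0.
  - by move=> t _; apply: sumr_ge0 => k _; rewrite mulr_ge0.
  apply: ae01_all => t tU.
  apply: (@le_trans _ _ (`|x t| * \sum_(k < N) `|b k t|)).
    by rewrite ler_wpM2l// ler_norm_sum.
  rewrite mulr_sumr; apply: ler_sum => k _; rewrite /xk.
  case: ifPn => [//|/negP tD]; rewrite bD ?normr0 ?mulr0//.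
  by move=> h; apply: tD; exact/mem_set.
rewrite int01_sum; last 2 first.
- by move=> k; exact: mfun01_absM.
- by move=> k t _; rewrite mulr_ge0.
apply: (@le_trans _ _ (\sum_(k < N) (beta k * norm (xk k))%:E)%E).
  by apply: lee_sum => k _; exact: (proj2 (Hb k)).
rewrite sumEFin lee_fin; apply: le_trans (sum_cauchy_schwarz _ _ _) _.
rewrite -/bb -mulrA mulrCA ler_wpM2l ?sqrtr_ge0//.
have disj (j k : 'I_N) : j != k -> ae01 (fun t => xk j t * xk k t = 0).
  move=> jk; apply: ae01_all => t _; rewrite /xk.
  case: ifPn => [/set_mem h1|]; last by rewrite mul0r.
  case: ifPn => [/set_mem h2|]; last by rewrite mulr0.
  by move: jk; rewrite (dD _ _ _ h1 h2) eqxx.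
rewrite -ler_pdivrMl//; apply: le_trans (HC N xk Xk disj) _.
apply: (proj2 (ss_ideal Xx _ _)); first by apply: mfun01_sum => k _; exact: mxk.
apply: ae01_all => t _.
have [[k Dk]|nD] := pselect (exists k, D k t); last first.
  rewrite big1 ?normr0// => k _; rewrite /xk memNset// => Dk.
  by apply: nD; exists k.
rewrite (bigD1 k)//= big1 ?addr0; first by rewrite /xk mem_set.
move=> j jk; rewrite /xk memNset// => Dj.
by move: jk; rewrite (dD _ _ _ Dj Dk) eqxx.
Qed.

Section DisjointCopy.
Variables (N : nat) (w : 'I_N -> seq (R * R)).
Hypotheses (w0 : forall k, nonneg_weights (w k))
  (wv0 : forall k pv, pv \in w k -> 0 <= pv.2) (w1 : \sum_(k < N) mass (w k) <= 1).

Let a (k : 'I_N) := \sum_(i < N | (i < k)%N) mass (w i).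
Let D (k : 'I_N) := [set u : R | a k <= u < a k + mass (w k)].
Let b (k : 'I_N) (u : R) := if a k <= u < a k + mass (w k) then place (a k) (w k) u else 0.

Let m0 k : 0 <= mass (w k). Proof. exact: mass_ge0. Qed.

Let a0 k : 0 <= a k. Proof. exact: sumr_ge0. Qed.

Let aS (j k : 'I_N) : (j < k)%N -> a j + mass (w j) <= a k.
Proof.
move=> jk; rewrite /a [leRHS](bigD1 j)//= [leLHS]addrC lerD2l.
rewrite big_mkcond [leRHS]big_mkcond /=; apply: ler_sum => i _.
case: ifPn => ij; last by case: ifPn.
by rewrite (ltn_trans ij jk)/= -val_eqE ltn_eqF.
Qed.

Let a1 k : a k + mass (w k) <= 1.
Proof.
apply: le_trans w1; rewrite [leRHS](bigD1 k)//= [leLHS]addrC lerD2l.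
rewrite /a big_mkcond [leRHS]big_mkcond /=; apply: ler_sum => i _.
case: ifPn => ik; last by case: ifPn.
by rewrite -val_eqE ltn_eqF.
Qed.

Let dD j k t : D j t -> D k t -> j = k.
Proof.
move=> /andP[h1 h2] /andP[h3 h4]; apply/val_inj.
case: (ltngtP j k) => // /aS h; exfalso.
  by have := lt_le_trans h2 h; rewrite ltNge h3.
by have := lt_le_trans h4 h; rewrite ltNge h1.
Qed.

(** The laws occupy consecutive intervals, which fit into [[0,1]] because the total mass is at most
    1. The last clause is an inequality since the part of [[0,1]] left free is dropped. *)
Lemma disjoint_copy : exists (D : 'I_N -> set R) (b : 'I_N -> R -> R),
  [/\ forall k, [/\ m01 (D k), mfun01 (b k), forall t, 0 <= b k t &
        forall t, ~ D k t -> b k t = 0],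
      forall j k t, D j t -> D k t -> j = k,
      forall (k : 'I_N) (s : R), 0 <= s ->
        pr [set t | s < b k t] = \sum_(pv <- w k) pv.1 * (s < pv.2)%R%:R,
      forall t, \sum_(k < N) b k t \in 0 :: unzip2 (flatten (codom w)) &
      forall (phi : R -> R) (s : R), measurable_fun setT phi -> (forall r, 0 <= phi r) ->
        ((conv (flatten (codom w)) phi s)%:E <=
         int01 (fun t => phi (s + \sum_(k < N) b k t)%R))%E].
Proof.
have mb k : mfun01 (b k).
  apply: mfun01_ifb; [exact: m01_itvco|exact: mfun01_place|exact: mfun01_cst].
have bk k t : D k t -> \sum_(j < N) b j t = place (a k) (w k) t.
  move=> Dk; rewrite (bigD1 k)//= big1 ?addr0; first by rewrite /b (_ : _ <= _ < _).
  move=> j jk; rewrite /b ifF//; apply/negP => Dj.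
  by move: jk; rewrite (dD Dj Dk) eqxx.
exists D, b; split => //.
- move=> k; split => //; first exact: m01_itvco.
    by move=> t; rewrite /b; case: ifPn => // _; apply: place_ge0; exact: (@wv0 k).
  by move=> t /negP; rewrite /b => /negbTE ->.
- move=> k s s0.
  have [_] := @int01_place R (w k) (a k) (fun v => (s < v)%R%:R) (@w0 k) (a0 k) (a1 k) (fun v => ler0n R _).
  rewrite (_ : int01 _ = (pr [set t | s < b k t])%:E); first by move=> [].
  rewrite -int01_indic; last exact: m01_gt.
  apply: eq_int01 => t _; rewrite indicE /b.
  case: ifPn => h; last by rewrite memNset//= (negbTE h) ltNge s0.
  congr (nat_of_bool _)%:R; apply/idP/idP => [H|/set_mem/=]; last by rewrite h.
  by apply/mem_set => /=; rewrite h.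
- move=> t; have [[k Dk]|nD] := pselect (exists k, D k t); last first.
    rewrite big1 ?mem_head// => k _; rewrite /b ifF//; apply/negP => h.
    by apply: nD; exists k.
  rewrite (bk k)//; have := place_mem (a k) (w k) t.
  rewrite !inE => /orP[->//|/mapP[pv pw ->]]; apply/orP; right; apply: map_f.
  by apply/flattenP; exists (w k) => //; apply: codom_f.
- move=> phi s mphi phi0.
  pose F k t := if a k <= t < a k + mass (w k) then phi (s + place (a k) (w k) t) else 0.
  have HF k : mfun01 (F k) /\ int01 (F k) = (\sum_(pv <- w k) pv.1 * phi (s + pv.2))%:E.
    exact: (@int01_place R (w k) (a k) (fun v => phi (s + v)) (@w0 k) (a0 k) (a1 k) (fun v => phi0 _)).
  have -> : (conv (flatten (codom w)) phi s)%:E = (\sum_(k < N) int01 (F k))%E.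
    rewrite (eq_bigr _ (fun k _ => proj2 (HF k))) sumEFin; congr EFin.
    by rewrite /conv big_flatten /= big_map enumT.
  rewrite -int01_sum; last 2 first.
  - by move=> k; exact: (proj1 (HF k)).
  - by move=> k t _; rewrite /F; case: ifPn.
  apply: le_int01.
  - by apply: mfun01_sum => k _; exact: (proj1 (HF k)).
  - apply: measurableT_comp => //; apply: measurable_funD; first exact: mfun01_cst.
    by apply: mfun01_sum => k _; exact: mb.
  - by move=> t _; apply: sumr_ge0 => k _; rewrite /F; case: ifPn.
  - by move=> t _.
  - apply: ae01_all => t _.
    have [[k Dk]|nD] := pselect (exists k, D k t); last first.
      rewrite big1// => k _; rewrite /F ifF//; apply/negP => h.
      by apply: nD; exists k.
    rewrite (bk k)// (bigD1 k)//= big1 ?addr0; first by rewrite /F; case: ifPn.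
    move=> j jk; rewrite /F ifF//; apply/negP => Dj.
    by move: jk; rewrite (dD Dj Dk) eqxx.
Qed.

End DisjointCopy.
End UpperEstimate.

(** * Tails of compound Poisson sums *)

Section PoissonDomination.
Context {R : realType}.
Implicit Types (w : seq (R * R)) (phi : R -> R).

Lemma independent_comp (I : choiceType) (c psi : I -> R -> R) :
  independent c -> (forall i, measurable_fun setT (psi i)) ->
  independent (fun i t => psi i (c i t)).
Proof.
move=> ic mpsi J B mB; apply: (ic J (fun i => psi i @^-1` B i)) => i.
by rewrite -[X in measurable X]setTI; apply: mpsi.
Qed.

Lemma int01_law (c : R -> R) (V : seq R) phi s : mfun01 c -> uniq V ->
  (forall t, c t \in V) -> (forall r, 0 <= phi r) ->
  int01 (fun t => phi (s + c t)) = (conv (law c V) phi s)%:E.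
Proof.
move=> mc uV cV phi0.
pose F v t := phi (s + v) * \1_[set t | c t = v] t.
have mF v : mfun01 (F v).
  by apply: mfun01M; [exact: mfun01_cst|apply: mfun01_indic; exact: m01_eq].
rewrite (eq_int01 (g := fun t => \sum_(v <- V) F v t)); last first.
  move=> t _; rewrite (bigD1_seq (c t))//= big1 ?addr0.
    by rewrite /F indicE mem_set// mulr1.
  move=> v vc; rewrite /F indicE memNset ?mulr0//= => e.
  by rewrite e eqxx in vc.
rewrite int01_sum//; last by move=> v t _; rewrite /F mulr_ge0.
rewrite /conv /law big_map -sumEFin; apply: eq_bigr => v _ /=.
have m1 : mfun01 (\1_[set t | c t = v] : R -> R).
  by apply: mfun01_indic; exact: m01_eq.
rewrite /F (int01Z (phi0 _) m1)// int01_indic; last exact: m01_eq.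
by rewrite mulrC.
Qed.

(** For nonnegative [x], rounding down to the finite set [0 :: V]; a negative [x] is sent to 0. *)
Definition step (V : seq R) (x : R) : R :=
  foldr (fun v y => Num.max (if v <= x then v else 0) y) 0 V.

Lemma measurable_step V : measurable_fun setT (step V).
Proof.
elim: V => [|v V IH]; first exact: measurable_cst.
apply: measurable_maxr => //; apply: measurable_fun_ifT => //.
exact: measurable_fun_ler.
Qed.

Lemma step_ge0 V x : 0 <= step V x.
Proof. by elim: V => //= v V IH; rewrite le_max IH orbT. Qed.

Lemma step_le V x : 0 <= x -> step V x <= x.
Proof. by move=> x0; elim: V => //= v V IH; rewrite ge_max IH andbT; case: ifP. Qed.

Lemma le_step V x v : v \in 0 :: V -> v <= x -> v <= step V x.
Proof.
rewrite inE => /predU1P[-> _|+ vx]; first exact: step_ge0.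
elim: V => //= u V IH; rewrite inE le_max => /predU1P[<-|/IH ->].
  by rewrite vx lexx.
by rewrite orbT.
Qed.

Lemma step_mem V x : step V x \in undup (0 :: V).
Proof.
rewrite mem_undup; elim: V => [|v V IH] /=; first by rewrite mem_head.
rewrite maxEle; case: ifPn => _.
  by move: IH; rewrite !inE => /orP[->//|->]; rewrite !orbT.
by case: ifP; rewrite !inE eqxx ?orbT.
Qed.

Definition tailfun (tau : R) : R -> R := \1_[set r | tau < r].

Lemma tailfun_ge0 tau r : 0 <= tailfun tau r. Proof. by []. Qed.

Lemma le_tailfun tau : {homo tailfun tau : x y / x <= y}.
Proof.
move=> x y xy; rewrite /tailfun !indicE.
have [/set_mem/= h|] := boolP (x \in _); last by [].
by rewrite mem_set//= (lt_le_trans h xy).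
Qed.

Lemma measurable_tailset tau : measurable [set r : R | tau < r].
Proof.
rewrite (_ : [set r : R | _] = `]tau, +oo[%classic); first exact: measurable_itv.
by apply/seteqP; split => u /=; rewrite in_itv/= andbT.
Qed.

Lemma measurable_tailfun tau : measurable_fun setT (tailfun tau).
Proof. by apply: measurable_indic; exact: measurable_tailset. Qed.

Lemma le_conv w phi : nonneg_weights w -> {homo phi : x y / x <= y} ->
  {homo conv w phi : x y / x <= y}.
Proof.
move=> w0 h x y xy; rewrite /conv big_seq [leRHS]big_seq.
by apply: ler_sum => pv /w0 p0; rewrite ler_wpM2l// h// lerD2r.
Qed.

Lemma measurable_conv w phi : measurable_fun setT phi ->
  measurable_fun setT (conv w phi).
Proof.
move=> mphi; apply: measurable_sum => pv; apply: measurable_funM => //.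
by apply: measurableT_comp => //; exact: measurable_funD.
Qed.

(** Stochastic domination compares nondecreasing test functions only; convolution with nonnegative
    weights preserves monotonicity, so the comparison can be iterated. *)
Lemma iter_conv_mono w1 w2 phi j : nonneg_weights w1 -> nonneg_weights w2 ->
  (forall (psi : R -> R) (s : R), measurable_fun setT psi ->
     (forall r, 0 <= psi r) ->
     {homo psi : x y / x <= y} -> conv w1 psi s <= conv w2 psi s) ->
  measurable_fun setT phi -> (forall r, 0 <= phi r) ->
  {homo phi : x y / x <= y} -> forall s,
  iter j (conv w1) phi s <= iter j (conv w2) phi s.
Proof.
move=> h1 h2 h12 mphi phi0 hphi.
have [mi hi] : measurable_fun setT (iter j (conv w1) phi) /\
    {homo iter j (conv w1) phi : x y / x <= y}.
  by elim: j => // j [mi hi]; split; [exact: measurable_conv|exact: le_conv].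
move=> s; elim: j mi hi s => // j IH _ _ s.
have [mi hi] : measurable_fun setT (iter j (conv w1) phi) /\
    {homo iter j (conv w1) phi : x y / x <= y}.
  elim: j {IH} => // j [mi hi]; split; [exact: measurable_conv|exact: le_conv].
apply: le_trans (h12 _ s mi _ hi) _; first by move=> r; exact: iter_conv_ge0.
by apply: conv_le => // r; exact: IH.
Qed.

(* The copies [F_k] of [f] are rounded down to the values of [b], which makes their
   law discrete; the event [{P = j}] contributes the [j]-th term. *)
Lemma pi_tail_ge (f g b : R -> R) w (V : seq R) (tau : R) n :
  mfun01 f -> mfun01 g -> mfun01 b -> (forall t, 0 <= b t) ->
  (forall t, b t \in 0 :: V) -> ae01 (fun t => b t <= f t) ->
  nonneg_weights w ->
  (forall phi s, measurable_fun setT phi -> (forall r, 0 <= phi r) ->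
    ((conv w phi s)%:E <= int01 (fun t => phi (s + b t)%R))%E) ->
  is_pi f g ->
  expR (- 1) * (\sum_(j < n) iter j (conv w) (tailfun tau) 0 / j`!%:R) <=
  pr [set t | tau < g t].
Proof.
move=> mf mg mb b0 bV bf w0 wb [F [P [HF mP HP iF gE]]].
have mF k : mfun01 (F k) by exact: (proj1 (HF k)).
pose c0 (i : option nat) := if i is Some k then F k else fun t => (P t)%:R.
pose psi (i : option nat) : R -> R := if i is Some k then step V else id.
pose c i t := psi i (c0 i t).
have mPR : mfun01 (fun t => (P t)%:R : R).
  apply: (@measurableT_comp _ _ _ _ _ _ (fun k : nat => k%:R : R)) => //.
have mc0 i : mfun01 (c0 i) by case: i.
have mpsi i : measurable_fun setT (psi i).
  by case: i => //= _; exact: measurable_step.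
have mc i : mfun01 (c i) by exact: (measurableT_comp (mpsi i) (mc0 i)).
have ic : independent c by exact: independent_comp.
pose V' := undup (0 :: V).
have uV' : uniq V' by exact: undup_uniq.
pose h t := step V (f t).
have mh : mfun01 h by exact: (measurableT_comp (measurable_step V) mf).
pose L := law h V'.
have L0 : nonneg_weights L by exact: nonneg_law.
(* Since [b] takes values in [0 :: V] and [b <= f] almost everywhere, it stays below the rounded
   [f]: monotone test functions see [w] below [L]. *)
have wL phi s : measurable_fun setT phi -> (forall r, 0 <= phi r) ->
    {homo phi : x y / x <= y} -> conv w phi s <= conv L phi s.
  move=> mphi phi0 hphi; rewrite -lee_fin; apply: le_trans (wb _ _ mphi phi0) _.
  rewrite -int01_law//; last by move=> t; exact: step_mem.
  apply: le_int01 => //.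
  - by apply: measurableT_comp => //; apply: measurable_funD => //; exact: mfun01_cst.
  - by apply: measurableT_comp => //; apply: measurable_funD => //; exact: mfun01_cst.
  - apply: ae01S bf => t _ bft; apply: hphi; rewrite lerD2l.
    exact: le_step.
pose B j (i : option nat) : set R := if i is None then [set j%:R] else setT.
have mB (j : nat) (i : option nat) : measurable (B j i).
  by rewrite /B; case: i => [_|]; [exact: measurableT|exact: measurable_set1].
(* The index [None] carries the Poisson variable; [E j] says that it equals [j] and that the first
   [j] rounded copies sum to more than [tau]. *)
pose E j := [set t | forall i, i \in [:: None] -> B j i (c i t)] `&`
      [set t | [set r : R | tau < r] (\sum_(i <- [seq Some i | i <- iota 0 j]) c i t)].
have mE j : m01 (E j).
  apply: m01I; first exact: m01_forall.
  apply: m01_gt.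
  by apply: mfun01_sum => i _; exact: mc.
have EP j t : E j t -> P t = j.
  move=> [/(_ None (mem_head _ _)) /= + _]; rewrite /c /= => /eqP.
  by rewrite eqr_nat => /eqP.
have prEj j : pr (E j) = poisson_pmf 1 j * iter j (conv L) (tailfun tau) 0.
  rewrite (@pr_indep R _ c ic mc [seq Some i | i <- iota 0 j] [:: None] (fun=> V')
     (B j)).
  - rewrite big_seq1; congr (_ * _).
      apply: EFin_inj; rewrite -HP -prE; last exact: m01_preimage.
      congr prob01; apply/seteqP; split => t /=; rewrite /c /=; last by move=> ->.
      by move/eqP; rewrite eqr_nat => /eqP.
    rewrite foldr_map -/(tailfun tau) -[in iter j](size_iota 0 j).
    elim: (iota 0 j) 0 => // k s IH r /=.
    rewrite (_ : law (c (Some k)) V' = L).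
      by apply: eq_bigr => pv _; rewrite IH.
    rewrite /L /law; apply: eq_map => v; congr pair.
    have mv : measurable (step V @^-1` [set v]).
      by rewrite -[X in measurable X]setTI; exact: measurable_step.
    rewrite /pr; congr fine.
    exact: (proj2 (HF k) _ mv).
  - rewrite /= map_inj_uniq; last by move=> ? ? [].
    by rewrite iota_uniq andbT; apply/mapP => -[].
  - exact: mB.
  - exact: measurable_tailset.
  - by move=> i /mapP[k _ ->]; split => // t; exact: step_mem.
apply: (@le_trans _ _ (\sum_(j <- iota 0 n) pr (E j))).
  rewrite mulr_sumr -(big_mkord xpredT (fun j => expR (- 1) * (iter j (conv w) (tailfun tau) 0 / j`!%:R))).
  rewrite /index_iota subn0; apply: ler_sum => j _; rewrite prEj /poisson_pmf ltr01.
  rewrite expr1n mul1r -[leRHS]mulrA [leRHS]mulrCA ler_wpM2l ?expR_ge0//.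
  rewrite mulrC ler_wpM2l ?invr_ge0//.
  apply: iter_conv_mono => //; [exact: measurable_tailfun|exact: le_tailfun].
rewrite -pr_bigU ?iota_uniq//; last first.
  by move=> i j t ij /EP e1 /EP e2; rewrite -e1 -e2 eqxx in ij.
apply: pr_ae_le.
- exact: m01_bigU.
- exact: m01_gt.
(* Rounding moves downwards only on nonnegative values, which the copies inherit from
   [f >= b >= 0]. *)
have F0 : ae01 (fun t => forall k, 0 <= F k t).
  apply: ae01_forall => k.
  have mn : measurable [set r : R | r < 0].
    rewrite (_ : [set r : R | _] = `]-oo, 0[%classic); first exact: measurable_itv.
    by apply/seteqP; split => u /=; rewrite in_itv.
  have := null_ae01 (m01_preimage (mF k) mn); rewrite /pr (proj2 (HF k) _ mn).
  have -> : fine (prob01 (f @^-1` [set r | r < 0])) = 0.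
    apply/eqP; rewrite eq_le -/(pr _) pr_ge0 ?andbT; last exact: m01_preimage.
    rewrite -[leRHS]pr0; apply: pr_ae_le; [exact: m01_preimage|exact: m01_0|].
    by apply: ae01S bf => t _ bft /=; rewrite ltNge (le_trans (b0 t) bft).
  move=> /(_ erefl); apply: ae01S => t _ /= /negP; by rewrite -leNgt.
apply: ae01S F0 => t tU F0 [j _ Ej]; have Pj := EP _ _ Ej.
move: Ej => [_ /=] => /lt_le_trans; apply; rewrite gE// Pj.
rewrite big_map -(big_mkord xpredT (fun k => F k t)) /index_iota subn0.
by apply: ler_sum => k _; exact: (step_le V (F0 k)).
Qed.

End PoissonDomination.

Section AssociatedSpace.
Context {R : realType}.
Local Notation mu := (@lebesgue_measure R).
Local Notation U01 := (unit_itv R).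
Variable X : symmetric_space R.
Local Notation norm := (ss_norm X).

(** [F] is the sum of the series, except that [fine] gives 0 where it diverges. This happens on a
    null set only; hence an almost everywhere majorant and an inequality of integrals. *)
Lemma series_majorant (u : nat -> R -> R) : (forall n, mfun01 (u n)) ->
  (forall n t, 0 <= u n t) -> (\sum_(n <oo) int01 (u n) < +oo)%E ->
  exists F : R -> R, [/\ mfun01 F, forall t, 0 <= F t,
    ae01 (fun t => forall n, u n t <= F t) &
    forall h : R -> R, mfun01 h -> (forall t, 0 <= h t) ->
      (int01 (fun t => h t * F t)%R <=
       \sum_(n <oo) int01 (fun t => h t * u n t)%R)%E].
Proof.
move=> mu_ u0 sfin.
pose S t := (\sum_(n <oo) (u n t)%:E)%E.
have S0 t : (0 <= S t)%E by apply: nneseries_ge0 => n _ _; rewrite lee_fin.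
have mS : measurable_fun U01 S.
  apply: ge0_emeasurable_sum => [n t _ _|n _]; first by rewrite lee_fin.
  by apply/measurable_EFinP; exact: mu_.
have IS : (\int[mu]_(t in U01) S t = \sum_(n <oo) int01 (u n))%E.
  apply: integral_nneseries; first exact: measurable_U01.
    by move=> n; apply/measurable_EFinP; exact: mu_.
  by move=> n t _; rewrite lee_fin.
have iS : mu.-integrable U01 S.
  apply/integrableP; split => //.
  suff -> : (\int[mu]_(t in U01) `|S t| = \int[mu]_(t in U01) S t)%E by rewrite IS.
  by apply: eq_integral => t _; rewrite gee0_abs.
have aS : ae01 (fun t => S t \is a fin_num).
  by apply: integrable_ae => //; exact: measurable_U01.
exists (fine \o S); split.
- exact: (measurableT_comp (fine_measurable measurableT)).
- by move=> t; exact: fine_ge0.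
- apply: ae01S aS => t _ St n; rewrite -lee_fin /= fineK//.
  apply: le_trans (@nneseries_lim_ge _ (fun n => (u n t)%:E) xpredT 0 n.+1 _); last first.
    by move=> k _ _; rewrite lee_fin.
  rewrite big_mkord sumEFin lee_fin big_ord_recr /= lerDr; exact: sumr_ge0.
- move=> h mh h0.
  rewrite -integral_nneseries; last 3 first.
  - exact: measurable_U01.
  - by move=> n; apply/measurable_EFinP; exact: mfun01M.
  - by move=> n t _; rewrite lee_fin mulr_ge0.
  apply: ge0_le_integral; first exact: measurable_U01.
  - by move=> t _; rewrite lee_fin mulr_ge0// fine_ge0.
  - apply/measurable_EFinP; apply: mfun01M => //.
    exact: (measurableT_comp (fine_measurable measurableT)).
  - apply: ge0_emeasurable_sum => [n t _ _|n _]; first by rewrite lee_fin mulr_ge0.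
    by apply/measurable_EFinP; exact: mfun01M.
  - move=> t _; under eq_eseriesr do rewrite EFinM.
    rewrite nneseriesZl; last by move=> n _; rewrite lee_fin.
    rewrite EFinM lee_wpmul2l ?lee_fin// -/(S t) /=.
    by case: (S t) (S0 t) => //= _; rewrite leey.
Qed.

Lemma dual_le_associated C y : dual_le X C y -> associated X y.
Proof.
move=> Hy; split; first exact: (proj1 Hy).
apply: le_lt_trans (ltry C); apply: ge_ereal_sup => _ [x [Xx nx] <-].
rewrite (pairingE Xx Hy) lee_fin; apply: le_trans (ler_norm _) _.
apply: le_trans (pairing_le Xx Hy) _.
by rewrite ler_piMr// (dual_le_ge0 Hy).
Qed.

(** The supremum involves no absolute values, but testing it on [|x|] times the sign of [y], scaled
    into the unit ball, recovers them. *)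
Lemma associated_dual_le y : associated X y -> exists C, dual_le X C y.
Proof.
move=> [my]; set s := ereal_sup _ => slt.
have s0 : (0 <= s)%E.
  apply: ereal_sup_ubound; exists (cst 0).
    by split; [exact: ss_mem0|rewrite ss_norm0].
  by rewrite -[RHS](@integral0 _ _ _ mu U01); apply: eq_int01 => t _; rewrite mul0r.
have sE : s = (fine s)%:E by rewrite fineK// ge0_fin_numE.
exists (fine s); split=> // x Xx; have mx := ss_measurable Xx.
have [nx|nx] := eqVneq (norm x) 0.
  rewrite nx mulr0; apply: (@le_trans _ _ (int01 (cst 0 : R -> R))); last by rewrite /int01 integral0.
  apply: le_int01 => //; [exact: mfun01_absM|exact: mfun01_cst|].
  apply: ae01S (ss_norm_eq0 Xx nx) => t _ ->; by rewrite normr0 mul0r.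
have nx0 : 0 < norm x by rewrite lt_neqAle eq_sym nx ss_norm_ge0.
pose z t := (norm x)^-1 * (if y t < 0 then - `|x t| else `|x t|).
have ma := mfun01_abs mx.
have mz : mfun01 (fun t => if y t < 0 then - `|x t| else `|x t|).
  apply: mfun01_ifb => //; last exact: measurableT_comp.
  exact: m01_lt.
have [Xz nz] : ss_mem X (fun t => if y t < 0 then - `|x t| else `|x t|) /\ norm (fun t => if y t < 0 then - `|x t| else `|x t|) <= norm x.
  apply: ss_ideal Xx mz _; apply: ae01_all => t _; by case: ifP; rewrite ?normrN normr_id.
have zB : unit_ball X z.
  split; first exact: ss_scale.
  have n0 := ltW nx0; rewrite ss_norm_scale// ger0_norm ?invr_ge0//.
  by rewrite mulrC ler_pdivrMr// mul1r.
have : (int01 (fun t => z t * y t)%R <= (fine s)%:E)%E.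
  by rewrite -sE; apply: ereal_sup_ubound; exists z.
rewrite (_ : int01 _ = ((norm x)^-1%:E * int01 (fun t => `|x t| * `|y t|)%R)%E); last first.
  rewrite -int01Z//; last 2 first.
  - by rewrite invr_ge0 ltW.
  - exact: mfun01_absM.
  apply: eq_int01 => t _; rewrite /z -mulrA; congr (_ * _).
  by case: ltP => h; [rewrite (ltr0_norm h) mulNr mulrN|rewrite (ger0_norm h)].
by rewrite muleC lee_pdivrMr// => h; apply: le_trans h _; rewrite -EFinM.
Qed.

End AssociatedSpace.

Section IndependentSums.
Context {R : realType}.
(** An atom at 0 adds nothing to a sum, and without it the mass is the probability that [f] does not
    vanish; this is what has to fit into [[0,1]]. *)
Definition nzlaw (f : R -> R) (s : seq R) := law f [seq v <- s | v != 0].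

Lemma sum_law_eq (f : R -> R) (s : seq R) (P : pred R) : mfun01 f -> uniq s ->
  (forall t, f t \in s) ->
  \sum_(v <- s | P v) pr [set t | f t = v] = pr [set t | P (f t)].
Proof.
move=> mf us fs; rewrite -big_filter.
rewrite -(@pr_bigU R R [seq v <- s | P v] (fun v => [set t | f t = v])).
- apply: eq_pr => t _ /=; split=> [[v + e]|Pf].
    by rewrite mem_filter e => /andP[].
  by exists (f t) => //; rewrite mem_filter Pf fs.
- exact: filter_uniq.
- by move=> v; exact: m01_eq.
- by move=> i j t /eqP ij /= h1 h2; apply: ij; rewrite -h1.
Qed.

Lemma conv_law_le (f : R -> R) (s : seq R) phi r : mfun01 f -> uniq s ->
  (forall t, f t \in s) -> (forall r, 0 <= phi r) ->
  conv (law f s) phi r <= phi r + conv (nzlaw f s) phi r.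
Proof.
move=> mf us fs phi0; rewrite /conv /nzlaw /law !big_map big_filter /=.
rewrite (bigID (pred1 0)) /= lerD2r.
rewrite (eq_bigr (fun v => pr [set t | f t = v] * phi r)); last first.
  by move=> v /eqP ->; rewrite addr0.
rewrite -mulr_suml ler_piMl// sum_law_eq//.
rewrite (_ : [set t | _] = [set t | f t = 0]); first by apply: pr_le1; exact: m01_eq.
by apply/seteqP; split => t /= /eqP.
Qed.

Variables (N : nat) (c : 'I_N -> R -> R) (V : 'I_N -> seq R).
Hypotheses (ic : independent c) (mc : forall k, mfun01 (c k))
  (uV : forall k, uniq (V k)) (cV : forall k t, c k t \in V k).

(** Concatenating lists adds the measures: this is the Levy measure of the compound Poisson law
    accompanying the sum of the [c k]. *)
Definition pieces : seq (R * R) := flatten (codom (fun k => nzlaw (c k) (V k))).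

(** Each factor [law (c k)] acts as at most [1 + nzlaw (c k)], since the atom at 0 has mass at most
    1; [exp_conv_ge] then bounds the product. *)
Lemma indep_tail_le tau :
  pr [set t | tau < \sum_(k < N) c k t] <=
  \sum_(j < N.+1) iter j (conv pieces) (tailfun tau) 0 / j`!%:R.
Proof.
have -> : pr [set t | tau < \sum_(k < N) c k t] =
    foldr (fun i => conv (law (c i) (V i))) (tailfun tau) (enum 'I_N) 0.
  have := @pr_indep R _ c ic mc (enum 'I_N) [::] V (fun=> setT) [set r | tau < r].
  rewrite big_nil mul1r => <-//; last 3 first.
  - by apply: eq_pr => t _ /=; rewrite big_enum /=; split => [|[]].
  - exact: enum_uniq.
  - exact: measurable_tailset.
have -> : N.+1 = (size [seq nzlaw (c k) (V k) | k <- enum 'I_N]).+1.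
  by rewrite size_map size_enum_ord.
have Hw k : nonneg_weights (nzlaw (c k) (V k)) by exact: nonneg_law.
apply: le_trans (exp_conv_ge _ _ _); last 2 first.
- by move=> w /mapP[k _ ->].
- by move=> r; exact: tailfun_ge0.
elim: (enum 'I_N) 0 => //= k s IH r.
have L0 : nonneg_weights (law (c k) (V k)) by exact: nonneg_law.
apply: le_trans (conv_le r L0 IH) _; apply: conv_law_le => // {}r.
have : forall w, w \in [seq nzlaw (c k) (V k) | k <- s] -> nonneg_weights w.
  by move=> w /mapP[j _ ->].
elim: {IH} [seq _ | _ <- _] r => // w ws' IH r hw /=.
have h : forall r, 0 <= foldr (fun w psi r => psi r + conv w psi r) (tailfun tau) ws' r.
  by move=> {}r; apply: IH => w' h; apply: hw; rewrite inE h orbT.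
by apply: addr_ge0 => //; apply: conv_ge0 => //; apply: hw; rewrite mem_head.
Qed.

End IndependentSums.

Section GlidingHump.
Context {R : realType}.
Local Notation U01 := (unit_itv R).
Variable X : symmetric_space R.
Local Notation norm := (ss_norm X).
Hypotheses (hlower : lower_2_estimate X)
  (hKruglov : kruglov_property (associated X)).

Lemma disjoint_sum : exists2 C : R, 0 < C &
  forall (N : nat) (c : 'I_N -> R -> R) (V : 'I_N -> seq R) (beta : 'I_N -> R),
  (forall k, mfun01 (c k)) -> (forall k, uniq (V k)) ->
  (forall k t, c k t \in V k) -> (forall k t, 0 <= c k t) ->
  (forall k v, v \in V k -> 0 <= v) ->
  \sum_(k < N) pr [set t | c k t != 0] <= 1 ->
  (forall k, dual_le X (beta k) (c k)) ->
  exists b : R -> R,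
  [/\ dual_le X (C * Num.sqrt (\sum_(k < N) beta k ^+ 2)) b,
    forall t, 0 <= b t,
    forall t, b t \in 0 :: unzip2 (pieces c V) &
    forall (phi : R -> R) (s : R), measurable_fun setT phi -> (forall r, 0 <= phi r) ->
        ((conv (pieces c V) phi s)%:E <= int01 (fun t => phi (s + b t)%R))%E].
Proof.
have [C C0 HC] := dual_le_disjoint hlower.
exists C => // N c V beta mc uV cV c0 V0 c1 Hc.
pose w k := nzlaw (c k) (V k).
have w0 k : nonneg_weights (w k) by exact: nonneg_law.
have wv0 k pv : pv \in w k -> 0 <= pv.2.
  by move=> /mapP[v + ->]; rewrite mem_filter => /andP[_ /V0].
have mw k : mass (w k) = pr [set t | c k t != 0].
  by rewrite /mass /w /nzlaw /law big_map big_filter /= sum_law_eq.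
have w1 : \sum_(k < N) mass (w k) <= 1.
  by rewrite (eq_bigr _ (fun k _ => mw k)).
have [D [b [Hb dD bt bV bphi]]] := disjoint_copy w0 wv0 w1.
exists (fun t => \sum_(k < N) b k t); split => //.
- apply: (HC N D) => //; first by move=> k; have [] := Hb k.
  + by move=> k t _; have [_ _ _] := Hb k; apply.
  + move=> k; have [_ mb b0 _] := Hb k; rewrite -[beta k]mul1r.
    apply: dual_tail_le (Hc k) mb (lexx _) _ => s s0; rewrite mul1r.
    rewrite (_ : [set t | s < `|b k t|] = [set t | s < b k t]); last first.
      by apply/seteqP; split => t /=; rewrite ger0_norm.
    rewrite (_ : [set t | s < `|c k t|] = [set t | s < c k t]); last first.
      by apply/seteqP; split => t /=; rewrite ger0_norm.
    rewrite bt// -(@sum_law_eq R (c k) (V k) (fun v => s < v))//.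
    rewrite /w /nzlaw /law big_map big_filter /= [leRHS]big_mkcond /=.
    rewrite [leLHS]big_mkcond /=; apply: ler_sum => v _.
    have [->|v0] := eqVneq v 0; first by rewrite ltNge s0.
    by case: ifP => _; rewrite ?mulr1 ?mulr0.
- by move=> t; apply: sumr_ge0 => k _; have [_ _ ] := Hb k.
Qed.

(* Otherwise there would be families whose disjoint copies sum up to [b_n], with
   the norm of [b_n] at most [C 2^-n], and whose own sums have norm at least [n];
   all these sums are dominated in tail by a single [pi(\sum_n b_n)]. *)
Lemma indep_sum_dual_le : exists2 delta : R, 0 < delta & exists K : R,
  forall (N : nat) (c : 'I_N -> R -> R) (V : 'I_N -> seq R) (beta : 'I_N -> R),
  independent c -> (forall k, mfun01 (c k)) -> (forall k, uniq (V k)) ->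
  (forall k t, c k t \in V k) -> (forall k t, 0 <= c k t) ->
  (forall k v, v \in V k -> 0 <= v) ->
  \sum_(k < N) pr [set t | c k t != 0] <= 1 ->
  (forall k, dual_le X (beta k) (c k)) ->
  \sum_(k < N) beta k ^+ 2 <= delta ^+ 2 ->
  dual_le X K (fun t => \sum_(k < N) c k t).
Proof.
have [C C0 HC] := disjoint_sum.
apply: contrapT => H.
(* The data of a counterexample at stage [n]: the independent sum [S] is remembered only through its
   tail bound in terms of [w], and [b] is the disjoint version of the family. *)
pose P n (N : nat) (b : R -> R) (w : seq (R * R)) (V : seq R) (S : R -> R) :=
  [/\ dual_le X (C / (2 ^ n.+1)%:R) b, (forall t, 0 <= b t) /\ (forall t, b t \in 0 :: V),
   nonneg_weights w /\ (forall (phi : R -> R) (s : R), measurable_fun setT phi -> (forall r, 0 <= phi r) ->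
        ((conv w phi s)%:E <= int01 (fun t => phi (s + b t)%R))%E),
   [/\ mfun01 S, forall t, 0 <= S t & forall tau, pr [set t | tau < S t] <=
  \sum_(j < N.+1) iter j (conv w) (tailfun tau) 0 / j`!%:R] &
   ~ dual_le X n%:R S].
have HP n : exists p : nat * (R -> R) * seq (R * R) * seq R * (R -> R),
    P n p.1.1.1.1 p.1.1.1.2 p.1.1.2 p.1.2 p.2.
  apply: contrapT => HN; apply: H.
  (* Without a counterexample at stage [n], the constants [2^-(n+1)] and [n] would do. The radii
     [C / 2^(n+1)] are summable with sum [C]. *)
  exists ((2 ^ n.+1)%:R^-1) => //.
  exists n%:R => N c V beta ic mc uV cV c0 V0 c1 Hc bd.
  apply: contrapT => HS; apply: HN.
  have [b [Hb b0 bV bphi]] := HC N c V beta mc uV cV c0 V0 c1 Hc.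
  exists (N, b, pieces c V, unzip2 (pieces c V), fun t => \sum_(k < N) c k t).
  split => //=.
  - apply: dual_leW Hb; apply: ler_wpM2l; first exact: ltW.
    have := ler_wsqrtr bd; rewrite sqrtr_sqr ger0_norm//; exact: ltW.
  - by split => // pv /flattenP[w /mapP[k _ ->]]; exact: nonneg_law.
  - split; first by apply: mfun01_sum => k _.
      by move=> t; exact: sumr_ge0.
    by move=> tau; exact: indep_tail_le.
have [p Hp] := choice HP.
pose b n := (p n).1.1.1.2.
have Hb n : dual_le X (C / (2 ^ n.+1)%:R) (b n) by have [] := Hp n.
have b0 n t : 0 <= b n t by have [_ [h _] _ _ _] := Hp n; exact: h.
have mb n : mfun01 (b n) := proj1 (Hb n).
have sumC (x : R -> R) : ss_mem X x -> (forall t, 0 <= x t) ->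
    (\sum_(n <oo) int01 (fun t => x t * b n t)%R <= (C * norm x)%:E)%E.
  move=> Xx x0.
  apply: le_trans (@epsilon_trick0 R (C * norm x) xpredT _); last first.
    by apply: mulr_ge0; [exact: ltW|exact: ss_norm_ge0].
  apply: lee_nneseries => [n _ _|n _].
    by apply: int01_ge0 => t _; rewrite mulr_ge0.
  rewrite mulrAC -/(norm x) (eq_int01 (g := fun t => `|x t| * `|b n t|)).
    exact: (proj2 (Hb n)).
  by move=> t _; rewrite !ger0_norm.
have fin : (\sum_(n <oo) int01 (b n) < +oo)%E.
  apply: le_lt_trans (ltry (C * norm (\1_U01 : R -> R))).
  apply: le_trans (sumC _ (ss_one X) _); last by move=> t; rewrite indicE.
  apply: lee_nneseries => [n _ _|n _]; first by apply: int01_ge0.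
  rewrite (@eq_int01 _ (b n) (fun t => \1_U01 t * b n t)) => // t tU.
  by rewrite indicE mem_set// mul1r.
have [f [mf f0 bf Hf]] := series_majorant mb b0 fin.
have Df : dual_le X C f.
  split=> // x Xx; have [Xa na] := ss_abs Xx; rewrite -na.
  apply: le_trans (sumC _ Xa _); last by [].
  apply: le_trans (Hf _ (mfun01_abs (ss_measurable Xx)) _); last by [].
  rewrite [leLHS](_ : _ = int01 (fun t => `|x t| * f t)%R)//.
  by apply: eq_int01 => t _; rewrite (ger0_norm (f0 t)).
have [g pg Ag] := hKruglov (dual_le_associated Df).
have [L HL] := associated_dual_le Ag.
have mg := proj1 HL.
(* A single [pi f] dominates the tails of all stages up to the factor [e], so every [S] has radius
   [e * L]; a stage beyond it is contradictory. *)
have [n nL] : exists n : nat, expR 1 * L <= n%:R.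
  by exists (Num.truncn (expR 1 * L)).+1; rewrite ltW// truncnS_gt.
have [_ [_ bV] [w0 bphi] [mS S0 tS] []] := Hp n.
apply: dual_leW nL _; apply: dual_tail_le HL mS _ _.
  by rewrite -expR0 ler_expR.
move=> s s0.
rewrite (_ : [set t | s < `|(p n).2 t|] = [set t | s < (p n).2 t]); last first.
  by apply/seteqP; split => t /=; rewrite ger0_norm.
apply: (@le_trans _ _ (expR 1 * pr [set t | s < g t])); last first.
  rewrite ler_wpM2l ?expR_ge0//; apply: le_pr.
  - exact: m01_gt.
  - by apply: m01_gt; exact: mfun01_abs.
  - by move=> t _ /= h; exact: lt_le_trans h (ler_norm _).
have bfn : ae01 (fun t => b n t <= f t) by apply: ae01S bf => t _; apply.
have := @pi_tail_ge R f g (b n) (p n).1.1.2 (p n).1.2 s (p n).1.1.1.1.+1 mf mg (mb n) (b0 n) bV bfn w0 bphi pg.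
rewrite -(ler_pM2l (expR_gt0 1)) mulrA -expRD subrr expR0 mul1r => h.
exact: le_trans (tS s) h.
Qed.

End GlidingHump.

(** * Sums of bounded independent variables *)

Section Mean.
Context {R : realType}.
Local Notation mu := (@lebesgue_measure R).
Local Notation U01 := (unit_itv R).
Implicit Types f g : R -> R.

Definition mean f : R := fine (int01 f).

Definition bounded01 f := mfun01 f /\ exists B : R, forall t, `|f t| <= B.

Lemma integral01_cst (a : \bar R) : (\int[mu]_(t in U01) a = a)%E.
Proof.
rewrite (@integral_cst _ _ _ mu U01 measurable_U01 a) -[RHS]mule1.
by congr (_ * _)%E; exact: measure_U01.
Qed.

Lemma bounded01_integrable f : bounded01 f -> mu.-integrable U01 (EFin \o f).
Proof.
move=> [mf [B fB]]; apply: (@le_integrable _ _ _ _ _ _ _ (EFin \o cst B)).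
- exact: measurable_U01.
- exact/measurable_EFinP.
- move=> t _ /=; rewrite lee_fin; apply: le_trans (fB t) (ler_norm _).
- apply/integrableP; split; first by apply/measurable_EFinP; exact: mfun01_cst.
  by rewrite /= integral01_cst ltry.
Qed.

Lemma meanE f : bounded01 f -> int01 f = (mean f)%:E.
Proof. by move=> /bounded01_integrable; exact: integrable_fin01. Qed.

Lemma bounded01_cst a : bounded01 (cst a : R -> R).
Proof. by split; [exact: mfun01_cst|exists `|a|]. Qed.

Lemma bounded01D f g : bounded01 f -> bounded01 g ->
  bounded01 (fun t => f t + g t).
Proof.
move=> [mf [B fB]] [mg [C gC]]; split; first exact: measurable_funD.
by exists (B + C) => t; apply: le_trans (ler_normD _ _) _; exact: lerD.
Qed.

Lemma bounded01M f g : bounded01 f -> bounded01 g ->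
  bounded01 (fun t => f t * g t).
Proof.
move=> [mf [B fB]] [mg [C gC]]; split; first exact: mfun01M.
by exists (B * C) => t; rewrite normrM ler_pM.
Qed.

Lemma bounded01Z a f : bounded01 f -> bounded01 (fun t => a * f t).
Proof. exact: (bounded01M (bounded01_cst a)). Qed.

Lemma bounded01_comp (phi : R -> R) f (V : seq R) : measurable_fun setT phi ->
  mfun01 f -> (forall t, f t \in V) -> bounded01 (fun t => phi (f t)).
Proof.
move=> mphi mf fV; split; first exact: (measurableT_comp mphi mf).
exists (\sum_(v <- V) `|phi v|) => t; rewrite (big_rem (f t))//= lerDl.
exact: sumr_ge0.
Qed.

Lemma meanD f g : bounded01 f -> bounded01 g ->
  mean (fun t => f t + g t) = mean f + mean g.
Proof.
move=> bf bg; apply: EFin_inj; rewrite EFinD -!meanE//; last exact: bounded01D.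
rewrite /int01; under eq_integral do rewrite EFinD.
by apply: integralD; [exact: measurable_U01|exact: bounded01_integrable|exact: bounded01_integrable].
Qed.

Lemma meanZ a f : bounded01 f -> mean (fun t => a * f t) = a * mean f.
Proof.
move=> bf; apply: EFin_inj; rewrite EFinM -!meanE//; last exact: bounded01Z.
rewrite /int01; under eq_integral do rewrite EFinM.
by apply: integralZl; [exact: measurable_U01|exact: bounded01_integrable].
Qed.

Lemma mean_cst (a : R) : mean (cst a) = a.
Proof.
apply: EFin_inj; rewrite -meanE; last exact: bounded01_cst.
exact: (integral01_cst a%:E).
Qed.

Lemma le_mean f g : bounded01 f -> bounded01 g -> (forall t, f t <= g t) ->
  mean f <= mean g.
Proof.
move=> bf bg h; rewrite -lee_fin -!meanE//; apply: le_integral.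
- exact: measurable_U01.
- exact: bounded01_integrable.
- exact: bounded01_integrable.
- by move=> t _; rewrite lee_fin.
Qed.

Lemma mean_ge0 f : (forall t, 0 <= f t) -> 0 <= mean f.
Proof. by move=> h; apply: fine_ge0; apply: int01_ge0. Qed.

End Mean.

Section ExponentialMoments.
Context {R : realType}.

(** It follows from [expR x - 1 <= x * expR x], which is [1 - x <= expR (- x)] multiplied by
    [expR x]. *)
Lemma expR_le2 (z : R) : expR z <= 1 + z + z ^+ 2 * expR `|z|.
Proof.
have h1 x : expR x - 1 <= x * expR x :> R.
  have := expR_ge1Dx (- x); rewrite -(ler_pM2r (expR_gt0 x)) -expRD addNr expR0.
  by rewrite mulrDl mul1r mulNr; lra.
have h2 := h1 z; have h3 := expR_ge1Dx z.
case: (leP 0 z) => z0.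
  rewrite ger0_norm// expr2 -mulrA; have := ler_wpM2l z0 h2; lra.
rewrite ltr0_norm//; have h4 : 1 <= expR (- z) by rewrite -[leLHS]expR0 ler_expR; lra.
have : z ^+ 2 * 1 <= z ^+ 2 * expR (- z) by rewrite ler_wpM2l// sqr_ge0.
have : (- z) * (1 - expR z) <= (- z) * (- z) by rewrite ler_wpM2l//; lra.
by rewrite expr2; lra.
Qed.

Variables (N : nat) (c : 'I_N -> R -> R) (V : 'I_N -> seq R).
Hypotheses (ic : independent c) (mc : forall k, mfun01 (c k))
  (uV : forall k, uniq (V k)) (cV : forall k t, c k t \in V k).

Lemma measurable_expRM (lam : R) : measurable_fun setT (fun r : R => expR (lam * r)).
Proof. by apply: measurableT_comp => //; exact: measurable_funM. Qed.

Lemma mean_expR_sum lam :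
  int01 (fun t => expR (lam * \sum_(k < N) c k t)) =
  (\prod_(k < N) mean (fun t => expR (lam * c k t)))%:E.
Proof.
pose phi r := expR (lam * r).
have phi0 r : 0 <= phi r by exact: expR_ge0.
have := @int01_indep R _ c ic mc (enum 'I_N) [::] V (fun=> setT) phi 0.
rewrite big_nil mul1r (eq_int01 (g := fun t => expR (lam * \sum_(k < N) c k t))); last first.
  move=> t _; rewrite add0r big_enum /= indicE mem_set ?mul1r//.
move=> -> //; last 2 first.
- exact: enum_uniq.
- exact: measurable_expRM.
congr EFin; rewrite -[X in \prod_(k <- X) _]enumT.
suff H r : foldr (fun i => conv (law (c i) (V i))) phi (enum 'I_N) r =
    phi r * \prod_(k <- enum 'I_N) mean (fun t => expR (lam * c k t)).
  by rewrite H /phi mulr0 expR0 mul1r.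
elim: (enum 'I_N) r => [|k s IH] r; first by rewrite big_nil mulr1.
rewrite /= big_cons.
have -> : mean (fun t => expR (lam * c k t)) = conv (law (c k) (V k)) phi 0.
  apply: EFin_inj; rewrite -int01_law// -meanE; last first.
    exact: (bounded01_comp (measurable_expRM lam) (mc k) (cV k)).
  by apply: eq_int01 => t _; rewrite add0r.
rewrite [RHS]mulrCA [in RHS]/conv mulr_suml {1}/conv; apply: eq_bigr => pv _; rewrite IH add0r.
by rewrite /phi mulrDr expRD; ring.
Qed.

Hypotheses (c1 : forall k t, `|c k t| <= 1) (cmean : forall k, mean (c k) = 0)
  (cvar : \sum_(k < N) mean (fun t => c k t ^+ 2) <= 4^-1).

(** Mean zero cancels the linear term of [expR_le2], so each exponential moment is at most
    [exp (lam^2 e^lam E c_k^2)]. The total variance [1/4] and [(lam / 2)^2 <= e^lam] turn the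
    exponent into [e^(2 lam)]. *)
Lemma chernoff lam tau : 0 <= lam ->
  pr [set t | tau < \sum_(k < N) c k t] <= expR (expR (2 * lam) - lam * tau).
Proof.
move=> l0; have mS : mfun01 (fun t => \sum_(k < N) c k t) by exact: mfun01_sum.
have bc k : bounded01 (c k) by split => //; exists 1.
have bc2 k : bounded01 (fun t => c k t ^+ 2) by exact: bounded01M.
have bE k : bounded01 (fun t => expR (lam * c k t)).
  exact: (bounded01_comp (measurable_expRM lam) (mc k) (cV k)).
have mE k : mean (fun t => expR (lam * c k t)) <=
    expR (lam ^+ 2 * expR lam * mean (fun t => c k t ^+ 2)).
  apply: le_trans (expR_ge1Dx _).
  have -> : 1 + lam ^+ 2 * expR lam * mean (fun t => c k t ^+ 2) =
      mean (fun t => (1 + lam * c k t) + (lam ^+ 2 * expR lam) * c k t ^+ 2).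
    rewrite meanD; last 2 first.
    - by apply: bounded01D; [exact: bounded01_cst|exact: bounded01Z].
    - exact: bounded01Z.
    rewrite meanD; last 2 first.
    - exact: bounded01_cst.
    - exact: bounded01Z.
    by rewrite !meanZ// (mean_cst 1) cmean mulr0 addr0.
  apply: le_mean => //.
    by do 2 (apply: bounded01D; last exact: bounded01Z); exact: bounded01_cst.
  move=> t; apply: le_trans (expR_le2 _) _; rewrite lerD2l exprMn.
  rewrite [leRHS]mulrAC; apply: ler_wpM2l; first by rewrite mulr_ge0 ?sqr_ge0.
  rewrite ler_expR normrM (ger0_norm l0).
  by rewrite ler_piMr.
rewrite -lee_fin -int01_indic; last exact: m01_gt.
apply: (@le_trans _ _ (int01 (fun t => expR (- (lam * tau)) * expR (lam * \sum_(k < N) c k t)))).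
  apply: le_int01.
  - by apply: mfun01_indic; exact: m01_gt.
  - apply: mfun01M; first exact: mfun01_cst.
    exact: (measurableT_comp (measurable_expRM lam) mS).
  - by [].
  - by move=> t _; rewrite mulr_ge0 ?expR_ge0.
  - apply: ae01_all => t _; rewrite indicE -expRD.
    case: (boolP (t \in _)) => [/set_mem/= h|_]; last exact: expR_ge0.
    by rewrite -[leLHS]expR0 ler_expR -mulrN -mulrDr mulr_ge0//; lra.
rewrite int01Z//; last exact: (measurableT_comp (measurable_expRM lam) mS).
rewrite mean_expR_sum -EFinM lee_fin addrC expRD ler_wpM2l ?expR_ge0//.
apply: (@le_trans _ _ (\prod_(k < N) expR (lam ^+ 2 * expR lam * mean (fun t => c k t ^+ 2)))).
  apply: ler_prod => k _; rewrite mE andbT.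
  by apply: mean_ge0 => t; exact: expR_ge0.
rewrite -expR_sum ler_expR -mulr_sumr.
apply: (@le_trans _ _ (lam ^+ 2 * expR lam * 4^-1)).
  by rewrite ler_wpM2l// mulr_ge0 ?sqr_ge0 ?expR_ge0.
have e1 : lam / 2 <= expR (lam / 2) by have := expR_ge1Dx (lam / 2); lra.
have e2 : lam ^+ 2 / 4 <= expR lam.
  have -> : lam ^+ 2 / 4 = (lam / 2) * (lam / 2) by field.
  have -> : expR lam = expR (lam / 2) * expR (lam / 2) by rewrite -expRD; congr expR; field.
  by rewrite ler_pM// divr_ge0.
rewrite mulrAC (_ : 2 * lam = lam + lam) ?expRD; last by ring.
by rewrite ler_wpM2r ?expR_ge0.
Qed.

End ExponentialMoments.

Section BoundedSums.
Context {R : realType}.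
Variable X : symmetric_space R.

Lemma iter_conv_unit phi (j : nat) (s : R) :
  iter j (conv [:: (1, 1)]) phi s = phi (s + j%:R).
Proof.
elim: j s => [|j IH] s; first by rewrite addr0.
by rewrite iterS {1}/conv big_seq1 mul1r IH -addrA nat1r.
Qed.

(** [pi 1] is Poisson; only the probability of its value [n] is kept. *)
Lemma poisson_tail (g : R -> R) tau n : mfun01 g -> is_pi (cst 1) g ->
  tau < n%:R -> expR (- 1) / n`!%:R <= pr [set t | tau < g t].
Proof.
move=> mg pg tn.
have w0 : nonneg_weights [:: (1, 1) : R * R].
  by move=> pv; rewrite inE => /eqP ->.
have := @pi_tail_ge R (cst 1) g (cst 1) [:: (1, 1)] [:: 1] tau n.+1 (mfun01_cst 1) mg (mfun01_cst 1) (fun _ => ler01) _ _ w0 _ pg.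
move=> h; apply: le_trans (h _ _ _).
- rewrite ler_wpM2l ?expR_ge0// big_ord_recr /= iter_conv_unit add0r.
  rewrite {2}/tailfun indicE mem_set//= mul1r lerDr; apply: sumr_ge0 => j _.
  by rewrite divr_ge0// iter_conv_ge0.
- by move=> t; rewrite !inE eqxx orbT.
- by apply: ae01_all.
- move=> phi s mphi phi0; rewrite /conv big_seq1 mul1r.
  by rewrite (_ : int01 _ = (phi (s + 1))%:E)//; exact: (integral01_cst (phi (s + 1))%:E).
Qed.

Lemma fact_le_exp n : (n`! <= n ^ n)%N.
Proof.
elim: n => // n IH; rewrite factS expnS leq_mul2l /=.
apply: leq_trans IH _; have [->//|n0] := posnP n; by rewrite leq_exp2r.
Qed.

(** The exponent is [- n ln n + n (1 - 2 ln n)]. The first part is dominated by [1 / n!] because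
    [n! <= n^n], and the second is at most 0 as [ln n >= 1/2]. The outer factor 2 accounts for the
    two tails. *)
Lemma tail_vs_poisson (n : nat) : (2 <= n)%N ->
  2 * expR (n%:R - ln n%:R / 2 * (6 * n%:R)) <= 2 * expR 1 * (expR (- 1) / n`!%:R) :> R.
Proof.
move=> n2; have n0 : 0 < n%:R :> R by rewrite ltr0n (leq_trans _ n2).
rewrite -[leRHS]mulrA; apply: ler_wpM2l => //.
rewrite [leRHS]mulrA -expRD subrr expR0 mul1r.
have -> : ln n%:R / 2 * (6 * n%:R) = n%:R * ln n%:R + n%:R * (2 * ln n%:R) :> R by field.
rewrite opprD addrCA expRD expRN expRM_natl lnK ?posrE//.
have h1 : (n%:R ^+ n)^-1 <= n`!%:R^-1 :> R.
  have h : n`!%:R <= n%:R ^+ n :> R by rewrite -natrX ler_nat fact_le_exp.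
  by rewrite lef_pV2// posrE ?exprn_gt0// ltr0n fact_gt0.
have h2 : 2^-1 <= ln n%:R :> R.
  rewrite -ler_expR lnK ?posrE//; apply: (@le_trans _ _ 2); last by rewrite ler_nat.
  have := expR_ge1Dx (- 2^-1 : R); rewrite expRN => h.
  have h3 : 2^-1 <= (expR 2^-1)^-1 :> R by lra.
  by rewrite lef_pV2 ?posrE ?expR_gt0 in h3.
rewrite -[leRHS]mulr1; apply: ler_pM => //; rewrite ?expR_ge0 ?invr_ge0 ?exprn_ge0//.
rewrite -[leRHS]expR0 ler_expR -[X in X - _]mulr1 -mulrBr.
by rewrite mulr_ge0_le0//; lra.
Qed.

Hypothesis hKruglov : kruglov_property (associated X).

Lemma bounded_sum_dual_le : exists K : R,
  forall (N : nat) (c : 'I_N -> R -> R) (V : 'I_N -> seq R),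
  independent c -> (forall k, mfun01 (c k)) -> (forall k, uniq (V k)) ->
  (forall k t, c k t \in V k) -> (forall k t, `|c k t| <= 1) ->
  (forall k, mean (c k) = 0) ->
  \sum_(k < N) mean (fun t => c k t ^+ 2) <= 4^-1 ->
  dual_le X K (fun t => \sum_(k < N) c k t).
Proof.
have A1 : associated X (cst 1) := dual_le_associated (dual_le1 X).
have [g pg Ag] := hKruglov A1.
have [L HL] := associated_dual_le Ag; have mg := proj1 HL.
(* The 6 is the ratio between the threshold [6 n] of [tail_vs_poisson] and the Poisson value [n];
   the added 1 absorbs the truncation in [n], as [s / 6 - 1 < n]. *)
pose y t := 6 * (g t + 1).
have [Ly HLy] : exists L, dual_le X L y.
  have my : mfun01 (fun t => g t + 1) by exact: measurable_funD.
  have H1 : dual_le X (L + 1) (fun t => g t + 1).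
    apply: dual_leD HL (dual_le1 X) my _; apply: ae01_all => t _.
    exact: ler_normD.
  by exists (`|6| * (L + 1)); exact: dual_leZ H1.
have my : mfun01 y := proj1 HLy.
exists (2 * expR 1 * Ly) => N c V ic mc uV cV c1 cm cv.
have e2 : 2 <= expR 1 :> R by have := expR_ge1Dx (1 : R); lra.
have mS : mfun01 (fun t => \sum_(k < N) c k t) by exact: mfun01_sum.
apply: (dual_tail_le HLy mS); first by lra.
move=> s s0; pose n := Num.truncn (s / 6).
have s60 : 0 <= s / 6 by rewrite divr_ge0.
have nle : n%:R <= s / 6 by rewrite truncn_le.
have nlt : s / 6 < n.+1%:R by exact: truncnS_gt.
have mA : m01 [set t | s < `|\sum_(k < N) c k t|] by apply: m01_gt; exact: (mfun01_abs mS).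
have my' : m01 [set t | s < `|y t|] by apply: m01_gt; exact: (mfun01_abs my).
have Py : expR (- 1) / n`!%:R <= pr [set t | s < `|y t|].
  apply: (@le_trans _ _ (pr [set t | s / 6 - 1 < g t])).
    by apply: poisson_tail => //; rewrite -[n.+1]addn1 natrD in nlt; lra.
  apply: le_pr => //; first exact: m01_gt.
  move=> t _ /= h; apply: lt_le_trans (ler_norm _); rewrite /y; lra.
apply: (@le_trans _ _ (2 * expR 1 * (expR (- 1) / n`!%:R))); last first.
  by rewrite ler_wpM2l// mulr_ge0 ?expR_ge0.
(* For [n < 2] one has [n! = 1], and the right-hand side is 2, above any probability. *)
case: (ltnP n 2) => n2.
  apply: le_trans (pr_le1 mA) _.
  rewrite -mulrA [X in 2 * X]mulrA -expRD subrr expR0 mul1r.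
  have -> : n`! = 1%N by case: (n) n2 => [|[|]].
  by rewrite invr1 mulr1; lra.
apply: le_trans (tail_vs_poisson n2).
have l0 : 0 <= ln n%:R / 2 :> R by rewrite divr_ge0// ln_ge0// ler1n (leq_trans _ n2).
have el : expR (2 * (ln n%:R / 2)) = n%:R :> R.
  rewrite (_ : 2 * _ = ln n%:R); last by field.
  by rewrite lnK// posrE ltr0n (leq_trans _ n2).
have nS : 6 * n%:R <= s by lra.
have T1 := @chernoff R N c V ic mc uV cV c1 cm cv (ln n%:R / 2) (6 * n%:R) l0.
pose c' k t := - c k t.
have mc' k : mfun01 (c' k) by exact: (measurable_funN (mc k)).
have ic' : independent c'.
  by apply: (@independent_comp R _ c (fun=> -%R)) => // i.
have bc k : bounded01 (c k) by split => //; exists 1.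
have T2 : pr [set t | 6 * n%:R < \sum_(k < N) c' k t] <= expR (expR (2 * (ln n%:R / 2)) - (ln n%:R / 2) * (6 * n%:R)).
  apply: (@chernoff R N c' (fun k => [seq - v | v <- V k])) => //.
  - by move=> k; rewrite map_inj_uniq//; exact: oppr_inj.
  - by move=> k t; apply: map_f.
  - by move=> k t; rewrite normrN.
  - move=> k; have := meanZ (-1) (bc k); rewrite cm mulr0 => <-.
    by congr mean; apply/funext => t; rewrite mulN1r.
  - apply: le_trans cv; apply: ler_sum => k _; rewrite le_eqVlt; apply/orP; left; apply/eqP.
    by congr mean; apply/funext => t; rewrite /c' sqrrN.
rewrite el in T1 T2.
have c'E t : \sum_(k < N) c' k t = - \sum_(k < N) c k t by rewrite sumrN.
have m1 : m01 [set t | 6 * n%:R < \sum_(k < N) c k t] by exact: m01_gt.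
have m2 : m01 [set t | 6 * n%:R < \sum_(k < N) c' k t].
  by apply: m01_gt; apply: mfun01_sum => k _; exact: mc'.
apply: (@le_trans _ _ (pr ([set t | 6 * n%:R < \sum_(k < N) c k t] `|` [set t | 6 * n%:R < \sum_(k < N) c' k t]))).
  apply: le_pr => //; first exact: m01U.
  move=> t _ /=; rewrite c'E lter_normr => /orP[h|h]; [left|right]; exact: le_lt_trans nS h.
apply: le_trans (prU_le m1 m2) _; lra.
Qed.

End BoundedSums.

Section SquareIntegrability.
Context {R : realType}.
Variable X : symmetric_space R.
Local Notation norm := (ss_norm X).
Hypothesis hL2 : L2 R `<=` ss_mem X.

(** A closed graph argument by hand. Were the [y_n] of [L_2] norm [a_n > 4^(n+1)], the function
    [f = (\sum_n 2^-(n+1) x_n^2)^(1/2)] with [x_n = |y_n| / a_n] would lie in [L_2], hence in [X],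
    and pairing it with [|y_n|] would give [norm f >= 2^-(n+1) a_n >= 2^(n+1)] for all [n]. *)
Lemma dual_le_sq : exists2 D : R, 1 <= D & forall y, bounded01 y ->
  dual_le X 1 y -> mean (fun t => y t ^+ 2) <= D ^+ 2.
Proof.
apply: contrapT => H.
have HP n : exists y : R -> R, [/\ bounded01 y, dual_le X 1 y &
    (4 ^ n.+1)%:R ^+ 2 < mean (fun t => y t ^+ 2)].
  apply: contrapT => HN; apply: H; exists (4 ^ n.+1)%:R.
    by rewrite ler1n expn_gt0.
  move=> y By Hy; rewrite leNgt; apply/negP => h; apply: HN.
  by exists y.
have [y Hy] := choice HP.
pose a n := Num.sqrt (mean (fun t => y n t ^+ 2)).
have aE n : a n ^+ 2 = mean (fun t => y n t ^+ 2).
  by rewrite sqr_sqrtr//; apply: mean_ge0 => t; exact: sqr_ge0.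
have a4 n : (4 ^ n.+1)%:R < a n.
  have [_ _ h] := Hy n; rewrite -(ger0_norm (ler0n R (4 ^ n.+1))) -sqrtr_sqr.
  by rewrite ltr_sqrt//; apply: le_lt_trans h; exact: sqr_ge0.
have a0 n : 0 < a n by apply: le_lt_trans (a4 n).
pose x n t := `|y n t| / a n.
have By n : bounded01 (y n) by have [] := Hy n.
have Bx n : bounded01 (x n).
  have [my [B yB]] := By n; split.
    by apply: mfun01M; [exact: mfun01_abs|exact: mfun01_cst].
  exists (B / a n) => t; rewrite normrM normr_id [X in _ * X]ger0_norm.
    by rewrite ler_wpM2r// invr_ge0 ltW.
  by rewrite invr_ge0 ltW.
have x0 n t : 0 <= x n t by rewrite divr_ge0// ltW.
have xE n : mean (fun t => x n t ^+ 2) = 1.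
  transitivity (mean (fun t => (a n ^+ 2)^-1 * y n t ^+ 2)).
    by congr mean; apply/funext => t; rewrite /x expr_div_n real_normK ?num_real// mulrC.
  rewrite meanZ; last exact: bounded01M.
  by rewrite aE mulVf// -aE expf_neq0// gt_eqF.
pose p n : R := 1 / (2 ^ n.+1)%:R.
have p0 n : 0 < p n by rewrite divr_gt0// ltr0n expn_gt0.
have p1 n : p n <= 1 by rewrite ler_pdivrMr ?mul1r ?ler1n ?expn_gt0// ltr0n expn_gt0.
pose u n t := p n * x n t ^+ 2.
have Bu n : bounded01 (u n) by apply: bounded01Z; exact: bounded01M.
have uE n : int01 (u n) = (p n)%:E.
  by rewrite meanE// meanZ ?xE ?mulr1//; exact: bounded01M.
have u0 n t : 0 <= u n t by rewrite mulr_ge0 ?sqr_ge0 ?ltW.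
have su : (\sum_(n <oo) int01 (u n) <= 1%:E)%E.
  rewrite (eq_eseriesr (fun n _ => uE n)); exact: epsilon_trick0.
have [F [mF F0 uF HF]] := series_majorant (fun n => proj1 (Bu n)) u0 (le_lt_trans su (ltry 1)).
pose f t := Num.sqrt (F t).
have mf : mfun01 f.
  apply: measurableT_comp => //; apply: continuous_measurable_fun; exact: sqrt_continuous.
have Xf : ss_mem X f.
  apply: hL2; split => //; apply: le_lt_trans (ltry 1).
  rewrite (eq_int01 (g := fun t => cst 1 t * F t)); last first.
    by move=> t _; rewrite sqr_sqrtr// mul1r.
  apply: le_trans (HF (cst 1) (mfun01_cst 1) (fun=> ler01)) _.
  apply: le_trans su; apply: lee_nneseries => [n _ _|n _].
    by apply: int01_ge0 => t _; rewrite mul1r.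
  by rewrite (@eq_int01 _ (fun t => cst 1 t * u n t) (u n))// => t _; rewrite mul1r.
have key n : (2 ^ n.+1)%:R <= norm f.
  have [_ [my HYn] _] := Hy n.
  have : ((p n * a n)%:E <= (norm f)%:E)%E.
    rewrite -[norm f]mul1r; apply: le_trans (HYn _ Xf).
    have -> : (p n * a n)%:E = int01 (fun t => p n * (a n)^-1 * y n t ^+ 2).
      rewrite meanE; last by apply: bounded01Z; exact: bounded01M.
      rewrite meanZ; last exact: bounded01M.
      by rewrite -aE expr2; congr EFin; field; rewrite gt_eqF.
    apply: le_int01.
    - by apply: mfun01M; [exact: mfun01_cst|exact: mfun01M].
    - exact: mfun01_absM.
    - by move=> t _; rewrite mulr_ge0 ?sqr_ge0// divr_ge0 ?ltW.
    - by move=> t _; rewrite mulr_ge0.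
    apply: ae01S uF => t _ /(_ n) h.
    (* As [p n <= 1], the square of [p n * x n] is at most [p n * x n ^+ 2], a single term of the
       series. *)
    have h2 : p n * x n t <= f t.
      rewrite -[leLHS]ger0_norm; last by rewrite mulr_ge0// ltW.
      rewrite -sqrtr_sqr ler_wsqrtr//; apply: le_trans h; rewrite exprMn.
      by rewrite ler_wpM2r ?sqr_ge0// expr2 ler_piMr// ltW.
    rewrite (ger0_norm (sqrtr_ge0 _)) -(real_normK (num_real (y n t))).
    have -> : p n / a n * `|y n t| ^+ 2 = p n * x n t * `|y n t| by rewrite /x; ring.
    by rewrite ler_wpM2r.
  rewrite lee_fin; apply: le_trans.
  rewrite /p mul1r ler_pdivlMl ?ltr0n ?expn_gt0//.
  by apply: le_trans (ltW (a4 n)); rewrite -natrM -expnMn.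
have [n hn] : exists n : nat, norm f < n%:R.
  by exists (Num.truncn (norm f)).+1; exact: truncnS_gt.
have := lt_le_trans hn (_ : n%:R <= norm f).
rewrite ltxx => h; apply: Bool.diff_false_true; apply: h.
by apply: le_trans (key n); rewrite ler_nat (leq_trans (leqnSn _))// ltnW// ltn_expl.
Qed.

End SquareIntegrability.

(** * Independent functions in the dual space *)

Section IndependentDual.
Context {R : realType}.
Variable X : symmetric_space R.
Hypotheses (hlower : lower_2_estimate X) (hL2 : L2 R `<=` ss_mem X)
  (hKruglov : kruglov_property (associated X)).

(** The absolute value is built in because [indep_sum_dual_le] concerns nonnegative functions; the
    true large part [r - small_part r] only has to be dominated. *)
Definition big_part (r : R) : R := if 1 < `|r| then `|r| else 0.
Definition small_part (r : R) : R := if 1 < `|r| then 0 else r.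

Lemma measurable_gt1 : measurable_fun setT (fun r : R => 1 < `|r|).
Proof. by apply: measurable_fun_ltr => //; exact: measurableT_comp. Qed.

Lemma measurable_big_part : measurable_fun setT big_part.
Proof.
apply: measurable_fun_ifT; first exact: measurable_gt1.
  exact: normr_measurable.
exact: measurable_cst.
Qed.

Lemma measurable_small_part : measurable_fun setT small_part.
Proof.
by apply: measurable_fun_ifT; [exact: measurable_gt1| |exact: measurable_id].
Qed.

Lemma big_part_ge0 r : 0 <= big_part r.
Proof. by rewrite /big_part; case: ifP. Qed.

Lemma le_big_part_sq r : big_part r <= r ^+ 2.
Proof.
rewrite /big_part; case: ifPn => h; last exact: sqr_ge0.
by rewrite -real_normK ?num_real// expr2 ler_peMl// ltW.
Qed.

Lemma le_small_part r : `|small_part r| <= 1.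
Proof. by rewrite /small_part; case: ltP => //; rewrite normr0 ler01. Qed.

Lemma small_part_sq r : small_part r ^+ 2 <= r ^+ 2.
Proof. by rewrite /small_part; case: ifP => _ //; rewrite expr0n sqr_ge0. Qed.

Lemma norm_sub_small_part r : `|r - small_part r| = big_part r.
Proof.
by rewrite /big_part /small_part; case: ifP => _; rewrite ?subr0// subrr normr0.
Qed.

(** With [delta <= 1 / D] the total variance of the [y k = a k * g k] is at most 1. By Chebyshev the
    large parts then have supports of total measure at most 1, as disjoint copies require. The three
    summands of [K] come from the large parts, the centred small parts and the sum of the centring
    constants. *)
Lemma indep_dual_le_small : exists2 delta : R, 0 < delta & exists2 K : R, 0 <= K &
  forall (N : nat) (g : 'I_N -> R -> R) (V : 'I_N -> seq R) (a : 'I_N -> R),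
  independent g -> (forall k, mfun01 (g k)) -> (forall k t, g k t \in V k) ->
  (forall k, dual_le X 1 (g k)) -> (forall k, mean (g k) = 0) ->
  \sum_(k < N) a k ^+ 2 <= delta ^+ 2 ->
  dual_le X K (fun t => \sum_(k < N) a k * g k t).
Proof.
have [d0 d0_gt0 [K0 HK0]] := indep_sum_dual_le hlower hKruglov.
have [K1 HK1] := bounded_sum_dual_le hKruglov.
have [D D1 HD] := dual_le_sq hL2.
have D0 : 0 < D by apply: lt_le_trans D1.
exists (Num.min d0 D^-1); first by rewrite lt_min d0_gt0 invr_gt0.
set delta := Num.min _ _.
have dl0 : 0 <= delta by rewrite le_min !ltW// invr_gt0.
have dle0 : delta <= d0 by rewrite ge_min lexx.
have dle1 : delta <= D^-1 by rewrite ge_min lexx orbT.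
exists (`|K0 + `|2| * K1 + 1|) => // N g V a ig mg gV Hg gm sa.
have sa1 : \sum_(k < N) a k ^+ 2 <= d0 ^+ 2.
  by apply: le_trans sa _; rewrite ler_sqr// nnegrE ltW.
have sa2 : \sum_(k < N) a k ^+ 2 * D ^+ 2 <= 1.
  rewrite -mulr_suml; apply: (@le_trans _ _ (delta ^+ 2 * D ^+ 2)).
    by rewrite ler_wpM2r// sqr_ge0.
  rewrite -exprMn expr_le1//; last by rewrite mulr_ge0// ltW.
  by rewrite -ler_pdivlMr// div1r.
pose y k t := a k * g k t.
have mM k : measurable_fun setT (fun r : R => a k * r) by exact: measurable_funM.
have bg k : bounded01 (g k).
  by apply: (@bounded01_comp R id (g k) (V k) _ (mg k) (gV k)); exact: measurable_id.
have by_ k : bounded01 (y k) by exact: bounded01Z.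
have yvar k : mean (fun t => y k t ^+ 2) <= a k ^+ 2 * D ^+ 2.
  rewrite (_ : mean _ = a k ^+ 2 * mean (fun t => g k t ^+ 2)).
    by rewrite ler_wpM2l ?sqr_ge0// HD.
  rewrite -meanZ; last exact: bounded01M.
  by congr mean; apply/funext => t; rewrite exprMn.
pose c k t := big_part (y k t).
have mbig k : measurable_fun setT (fun r => big_part (a k * r)).
  exact: (measurableT_comp measurable_big_part (mM k)).
have bc k : bounded01 (c k) by exact: (bounded01_comp (mbig k) (mg k) (gV k)).
have mcy k : mean (c k) <= a k ^+ 2 * D ^+ 2.
  apply: le_trans (yvar k); apply: le_mean => //; first exact: bounded01M.
  by move=> t; exact: le_big_part_sq.
have mc k : mfun01 (c k) := proj1 (bc k).
have Dc : dual_le X K0 (fun t => \sum_(k < N) c k t).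
  apply: (HK0 N c (fun k => undup [seq big_part (a k * v) | v <- V k]) (fun k => `|a k|)) => //.
  - exact: (@independent_comp R _ g (fun k r => big_part (a k * r))).
  - by move=> k; exact: undup_uniq.
  - by move=> k t; rewrite mem_undup; apply/mapP; exists (g k t).
  - by move=> k t; exact: big_part_ge0.
  - by move=> k v; rewrite mem_undup => /mapP[u _ ->]; exact: big_part_ge0.
  - apply: le_trans sa2; apply: ler_sum => k _; apply: le_trans (yvar k).
    have m1 : m01 [set t | c k t != 0].
      rewrite (_ : [set t | _] = ~` [set t | c k t = 0]); first by apply: m01C; exact: m01_eq.
      by apply/seteqP; split => t /= /eqP.
    rewrite -lee_fin -meanE; last exact: bounded01M.
    rewrite -int01_indic//; apply: le_int01.
    + exact: mfun01_indic.
    + by apply: (proj1 (bounded01M (by_ k) (by_ k))).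
    + by [].
    + by move=> t _; exact: sqr_ge0.
    apply: ae01_all => t _; rewrite indicE.
    case: (boolP (t \in _)) => [/set_mem /=|_]; last exact: sqr_ge0.
    rewrite /c /big_part; case: ifPn => [h _|]; last by rewrite eqxx.
    by rewrite -real_normK ?num_real// expr_ge1// ltW.
  - move=> k; have Hy := dual_leZ (a k) (Hg k); rewrite mulr1 in Hy.
    apply: dual_leS Hy (mc k) _.
    apply: ae01_all => t _; rewrite (ger0_norm (big_part_ge0 _)) /c /big_part.
    by case: ifP => // _; exact: normr_ge0.
  - by apply: le_trans sa1; apply: ler_sum => k _; rewrite real_normK ?num_real.
have msmall k : measurable_fun setT (fun r => small_part (a k * r)).
  exact: (measurableT_comp measurable_small_part (mM k)).
pose u k t := small_part (y k t).
have bu k : bounded01 (u k) by exact: (bounded01_comp (msmall k) (mg k) (gV k)).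
pose m k := mean (u k).
have m1 k : `|m k| <= 1.
  have h1 t : - 1 <= u k t <= 1 by rewrite -ler_norml; exact: le_small_part.
  rewrite ler_norml -{1}(mean_cst (- 1)) -{2}(mean_cst 1); apply/andP; split.
    by apply: le_mean => // [|t]; [exact: bounded01_cst|have /andP[] := h1 t].
  by apply: le_mean => // [|t]; [exact: bounded01_cst|have /andP[] := h1 t].
(* [y k] has mean zero, so the mean of its small part is minus that of its large part; this makes
   the centring constants summable. *)
have mc_ge k : `|m k| <= mean (c k).
  have by0 : mean (y k) = 0 by rewrite meanZ// gm mulr0.
  have byu : bounded01 (fun t => y k t + -1 * u k t).
    by apply: bounded01D => //; exact: bounded01Z.
  have -> : `|m k| = `|mean (fun t => y k t + -1 * u k t)|.
    rewrite meanD//; last exact: bounded01Z.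
    by rewrite by0 (meanZ (-1) (bu k)) add0r mulN1r normrN.
  have h t : - c k t <= y k t + -1 * u k t <= c k t.
    by rewrite -ler_norml mulN1r norm_sub_small_part.
  rewrite ler_norml; apply/andP; split; last first.
    by apply: le_mean => // t; have /andP[] := h t.
  rewrite -[leLHS]mulN1r -(meanZ (-1) (bc k)); apply: le_mean => //; first exact: bounded01Z.
  by move=> t; have /andP[] := h t; rewrite -[- c k t]mulN1r.
have bcst : forall r : R, bounded01 (fun=> r) by exact: bounded01_cst.
(* Both [u k] and [m k] are bounded by 1, so halving restores the bound 1 and also brings the total
   variance below [1/4]. *)
pose s k t := 2^-1 * (u k t + - m k).
have bs k : bounded01 (s k) by apply: bounded01Z; exact: bounded01D.
have Ds : dual_le X K1 (fun t => \sum_(k < N) s k t).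
  apply: (HK1 N s (fun k => undup [seq 2^-1 * (small_part (a k * v) + - m k) | v <- V k])) => //.
  - apply: (@independent_comp R _ g (fun k r => 2^-1 * (small_part (a k * r) + - m k))) => // k.
    by apply: measurable_funM => //; exact: measurable_funD.
  - by move=> k; exact: (proj1 (bs k)).
  - by move=> k; exact: undup_uniq.
  - by move=> k t; rewrite mem_undup; apply/mapP; exists (g k t).
  - move=> k t; rewrite normrM ger0_norm ?invr_ge0// ler_pdivrMl// mulr1.
    apply: le_trans (ler_normB _ _) _.
    have := le_small_part (y k t); have := m1 k; rewrite -/(u k t); lra.
  - by move=> k; rewrite meanZ ?meanD ?(mean_cst (- m k)) ?subrr ?mulr0//; exact: bounded01D.
  - apply: (@le_trans _ _ (\sum_(k < N) 4^-1 * (a k ^+ 2 * D ^+ 2))); last first.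
      by rewrite -mulr_sumr; lra.
    apply: ler_sum => k _.
    have bu2 : bounded01 (fun t => u k t ^+ 2) by exact: bounded01M.
    have -> : (fun t => s k t ^+ 2) = (fun t => (4^-1 * u k t ^+ 2 + (- (m k / 2)) * u k t) + (m k ^+ 2 / 4)).
      by apply/funext => t; rewrite /s; field.
    rewrite meanD//; last by apply: bounded01D; exact: bounded01Z.
    rewrite meanD; [|exact: bounded01Z|exact: bounded01Z].
    rewrite (meanZ _ bu2) (meanZ _ (bu k)) (mean_cst (m k ^+ 2 / 4)) -/(m k).
    have h1 : mean (fun t => u k t ^+ 2) <= a k ^+ 2 * D ^+ 2.
      apply: le_trans (yvar k); apply: le_mean => //; first exact: bounded01M.
      by move=> t; exact: small_part_sq.
    have := sqr_ge0 (m k); rewrite expr2; lra.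
have msum : `|\sum_(k < N) m k| <= 1.
  apply: le_trans sa2; apply: le_trans (ler_norm_sum _ _ _) _.
  by apply: ler_sum => k _; exact: le_trans (mc_ge k) (mcy k).
have D2s := dual_leZ 2 Ds.
have mSc : mfun01 (fun t => \sum_(k < N) c k t) := proj1 Dc.
have mSs := proj1 D2s.
have Dcs : dual_le X (K0 + `|2| * K1)
    (fun t => `|\sum_(k < N) c k t| + `|2 * \sum_(k < N) s k t|).
  apply: dual_leD Dc D2s _ _.
    by apply: measurable_funD; exact: mfun01_abs.
  by apply: ae01_all => t _; rewrite ger0_norm// addr_ge0.
apply: dual_leW (ler_norm _) _.
apply: dual_leD Dcs (dual_le1 X) _ _; first by apply: mfun01_sum => k _; exact: (proj1 (by_ k)).
apply: ae01_all => t _.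
have -> : \sum_(k < N) a k * g k t =
    \sum_(k < N) (y k t - u k t) + 2 * \sum_(k < N) s k t + \sum_(k < N) m k.
  rewrite mulr_sumr -!big_split /=; apply: eq_bigr => k _.
  by rewrite -/(y k t) /s; field.
apply: le_trans (ler_normD _ _) _; apply: lerD; last by rewrite normr1.
apply: le_trans (ler_normD _ _) _; rewrite [leRHS]ger0_norm ?addr_ge0//.
apply: lerD => //; rewrite (le_trans (ler_norm_sum _ _ _))//.
apply: le_trans (ler_norm _); apply: ler_sum => k _.
by rewrite norm_sub_small_part.
Qed.

(** Homogeneity: nonzero coefficients are rescaled to Euclidean norm [delta]. *)
Lemma indep_dual_le : exists2 K : R, 0 <= K &
  forall (N : nat) (g : 'I_N -> R -> R) (V : 'I_N -> seq R) (a : 'I_N -> R),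
  independent g -> (forall k, mfun01 (g k)) -> (forall k t, g k t \in V k) ->
  (forall k, dual_le X 1 (g k)) -> (forall k, mean (g k) = 0) ->
  dual_le X (K * Num.sqrt (\sum_(k < N) a k ^+ 2)) (fun t => \sum_(k < N) a k * g k t).
Proof.
have [delta d0 [K K0 HK]] := indep_dual_le_small.
exists (K / delta); first by rewrite divr_ge0// ltW.
move=> N g V a ig mg gV Hg gm; set S := \sum_(k < N) a k ^+ 2.
have S0 : 0 <= S by apply: sumr_ge0 => k _; exact: sqr_ge0.
have [S1|S1] := eqVneq S 0.
  have a0 k : a k = 0.
    apply/eqP; rewrite -sqrf_eq0 eq_le sqr_ge0 andbT -S1 /S (bigD1 k)//= lerDl.
    by apply: sumr_ge0 => j _; exact: sqr_ge0.
  rewrite S1 sqrtr0 mulr0.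
  have := dual_leZ 0 (dual_le1 X); rewrite normr0 mul0r => H.
  apply: dual_leS H _ _.
    by apply: mfun01_sum => k _; apply: mfun01M => //; exact: mfun01_cst.
  apply: ae01_all => t _; rewrite big1 ?normr0// => k _.
  by rewrite a0 mul0r.
have sS : 0 < Num.sqrt S by rewrite sqrtr_gt0 lt_neqAle eq_sym S1.
pose b k := delta / Num.sqrt S * a k.
have sb : \sum_(k < N) b k ^+ 2 <= delta ^+ 2.
  rewrite (eq_bigr (fun k => (delta / Num.sqrt S) ^+ 2 * a k ^+ 2)); last first.
    by move=> k _; rewrite exprMn.
  by rewrite -mulr_sumr -/S expr_div_n sqr_sqrtr// divfK.
have := dual_leZ (Num.sqrt S / delta) (HK N g V b ig mg gV Hg gm sb).
rewrite ger0_norm; last by rewrite divr_ge0// ltW.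
rewrite (_ : (fun t => _) = (fun t => \sum_(k < N) a k * g k t)).
  by rewrite (_ : _ * K = K / delta * Num.sqrt S)//; ring.
apply/funext => t; rewrite mulr_sumr; apply: eq_bigr => k _; rewrite /b.
by field; rewrite !gt_eqF.
Qed.

End IndependentDual.

(** * Kolmogorov widths *)

Section TraceRank.
Context {R : realType}.

(* Cauchy-Schwarz applied to [tr A = tr (P A)], where [P] is the orthogonal
   projection onto the column space of [A]. *)
Lemma trace_le_sqrt_rank N (A : 'M[R]_N) :
  \tr A <= Num.sqrt (\rank A)%:R * Num.sqrt (\sum_j \sum_k A j k ^+ 2).
Proof.
pose B := col_base A; pose G := B^T *m B.
have sq0 r (u : 'rV[R]_r) : u *m u^T = 0 -> u = 0.
  move=> h; apply/rowP => i; rewrite mxE; apply/eqP; rewrite -sqrf_eq0.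
  have /matrixP/(_ 0 0) := h; rewrite !mxE => /eqP.
  rewrite psumr_eq0; last by move=> j _; rewrite mxE -expr2 sqr_ge0.
  by move=> /allP/(_ i (mem_index_enum _)) /=; rewrite mxE -expr2.
(* The Gram matrix of independent columns: if [v G = 0] then [v B^T] has Euclidean norm 0, so
   [v = 0]. *)
have uG : G \in unitmx.
  rewrite -row_free_unit; apply: inj_row_free => v vG.
  have Bf : row_free B^T by rewrite /row_free mxrank_tr -/(row_full B) col_base_full.
  have : v *m B^T = 0.
    by apply: sq0; rewrite (trmx_mul v B^T) (trmxK B) mulmxA -(mulmxA v) -/G vG mul0mx.
  by rewrite -(mul0mx _ B^T) => /(row_free_inj Bf).
pose P := B *m invmx G *m B^T.
have PB : P *m B = B by rewrite /P -mulmxA -/G mulmxKV.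
have PA : P *m A = A.
  have BA : B *m row_base A = A by exact: mulmx_base.
  transitivity (P *m (B *m row_base A)); first by rewrite BA.
  by rewrite mulmxA PB BA.
have PT : P^T = P.
  rewrite /P !trmx_mul trmxK trmx_inv -/G mulmxA.
  by rewrite (_ : G^T = G)// /G trmx_mul trmxK.
have PP : P *m P = P.
  have -> : P *m P = P *m (B *m invmx G *m B^T) by [].
  by rewrite (mulmxA P _ B^T) (mulmxA P B) PB.
have trP : \tr P = (\rank A)%:R.
  by rewrite /P mxtrace_mulC mulmxA -/G mulmxV// mxtrace1.
(* The squared Hilbert-Schmidt norm of [P] is [tr (P P^T) = tr P]. *)
have P2 : \sum_j \sum_k P j k ^+ 2 = (\rank A)%:R.
  rewrite -trP -{2}PP -{3}PT /mxtrace; apply: eq_bigr => j _.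
  by rewrite [RHS]mxE; apply: eq_bigr => k _; rewrite [X in _ * X]mxE expr2.
rewrite -{1}PA /mxtrace -P2.
rewrite (eq_bigr (fun j => \sum_k P j k * A k j)); last by move=> j _; rewrite mxE.
rewrite [X in _ <= _ * Num.sqrt X]exchange_big !pair_big /=.
exact: sum_cauchy_schwarz.
Qed.

End TraceRank.

Section Final.
Context {R : realType}.
Variable X : symmetric_space R.
Local Notation norm := (ss_norm X).

(** The strict inequality provides a subspace and, for each [f k], an approximant within [gamma],
    with no infimum attained. Spanning holds almost everywhere only, which the norm does not see. *)
Lemma kolmogorov_width_lt n (gamma : R) N (f : 'I_N -> R -> R) :
  (forall k, ss_mem X (f k)) ->
  (kolmogorov_width n (range f) X < gamma%:E)%E ->
  exists (e : 'I_n -> R -> R) (c : 'I_N -> 'I_n -> R),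
    (forall i, ss_mem X (e i)) /\
    forall k, norm (f k \- (fun t => \sum_(i < n) c k i * e i t)) < gamma.
Proof.
move=> Xf /ereal_inf_lt[_ [V [[VX V0 VD VZ] [e Ve Vspan]] <-] hV].
have HP k : exists c : 'I_n -> R,
    norm (f k \- (fun t => \sum_(i < n) c i * e i t)) < gamma.
  have : (ereal_inf [set (norm (f k \- v))%:E | v in V] < gamma%:E)%E.
    by apply: le_lt_trans hV; apply: ereal_sup_ubound; exists (f k) => //; exists k.
  move=> /ereal_inf_lt[_ [v Vv <-]]; rewrite lte_fin => hv.
  have [c cv] := Vspan v Vv; exists c; apply: le_lt_trans hv.
  have Xs : ss_mem X (fun t => \sum_(i < n) c i * e i t).
    by apply: (proj1 (ss_sum _ _)) => i; apply: ss_scale; apply: VX.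
  have Xfs := ss_sub (Xf k) Xs.
  apply: (proj2 (ss_ideal (ss_sub (Xf k) (VX _ Vv)) (ss_measurable Xfs) _)).
  by apply: ae01S cv => t _ /= ->.
have [c Hc] := choice HP.
by exists e, c; split => // i; exact: VX.
Qed.

Lemma pairing_suml (I : Type) (s : seq I) (c : I -> R) (e : I -> R -> R) C g :
  dual_le X C g -> (forall i, ss_mem X (e i)) ->
  pairing (fun t => \sum_(i <- s) c i * e i t) g = \sum_(i <- s) c i * pairing (e i) g.
Proof.
move=> Hg Xe; elim: s => [|i s IH].
  rewrite big_nil /pairing (eq_int01 (g := cst 0)); last first.
    by move=> t _; rewrite big_nil mul0r.
  by rewrite /int01 integral0.
have Xs : ss_mem X (fun t => \sum_(i <- s) c i * e i t).
  by apply: (proj1 (ss_sum _ _)) => j; apply: ss_scale.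
rewrite big_cons -IH; transitivity (pairing (fun t => c i * e i t + 1 * \sum_(i <- s) c i * e i t) g).
  by congr pairing; apply/funext => t; rewrite big_cons mul1r.
by rewrite (pairing_lin _ _ (Xe i) Xs Hg) mul1r.
Qed.

Lemma pairing_sumr (I : Type) (s : seq I) (b : I -> R) (g : I -> R -> R) x C :
  ss_mem X x -> (forall i, dual_le X C (g i)) ->
  pairing x (fun t => \sum_(i <- s) b i * g i t) = \sum_(i <- s) b i * pairing x (g i).
Proof.
move=> Xx Hg; elim: s => [|i s IH].
  rewrite big_nil /pairing (eq_int01 (g := cst 0)); last first.
    by move=> t _; rewrite big_nil mulr0.
  by rewrite /int01 integral0.
have Hs : dual_le X (\sum_(i <- s) `|b i| * C) (fun t => \sum_(i <- s) b i * g i t).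
  by apply: dual_le_sum => j; exact: dual_leZ.
rewrite big_cons -IH; transitivity (pairing x (fun t => b i * g i t + 1 * \sum_(i <- s) b i * g i t)).
  by congr pairing; apply/funext => t; rewrite big_cons mul1r.
by rewrite (pairing_linr _ _ Xx (Hg i) Hs) mul1r.
Qed.

End Final.

Theorem theorem1 (R : realType) (X : symmetric_space R)
    (hlower : lower_2_estimate X)
    (hL2 : L2 R `<=` ss_mem X)
    (hKruglov : kruglov_property (associated X)) :
  property_IR X.
Proof.
have [K K0 HK] := indep_dual_le hlower hL2 hKruglov.
(* The argument ends with [1/1024 <= 4 gamma K^2], that is [gamma K^2 >= 1/4096]; 8192 is twice
   4096. The added 1 covers small [K] and gives [gamma <= 1/8192]. *)
pose gamma : R := (8192 * (K ^+ 2 + 1))^-1.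
have K2 : 1 <= K ^+ 2 + 1 by rewrite lerDr sqr_ge0.
have g0 : 0 < gamma by rewrite invr_gt0; lra.
have gK : gamma * (K ^+ 2 + 1) = 8192^-1.
  by rewrite /gamma invfM -mulrA mulVf ?mulr1//; lra.
have g1 : gamma <= 8192^-1.
  by rewrite -gK ler_peMr// ltW.
exists gamma => // N f N0 Xf indf f0 f1; rewrite leNgt; apply/negP.
rewrite /kolmogorov_width_real; set n := Num.truncn _ => hw.
have n_le : n%:R <= gamma * N%:R by rewrite truncn_le// mulr_ge0// ltW.
have [e [c [Xe hv]]] := kolmogorov_width_lt Xf hw.
have nf0 k : 0 < ss_norm X (f k) by apply: lt_le_trans (f1 k).
pose v k t := \sum_(i < n) c k i * e i t.
have Xv k : ss_mem X (v k) by apply: (proj1 (ss_sum _ _)) => i; exact: ss_scale.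
have [p Hp] := choice (fun k => (let: ex_intro h (ex_intro V H) := norming_function hlower (Xf k) (nf0 k) (f0 k) in
  ex_intro _ (h, V) H) : exists p : (R -> R) * seq R,
  [/\ measurable_fun setT p.1, forall r, p.1 r \in p.2, dual_le X 2 (p.1 \o f k),
    int01 (p.1 \o f k) = 0%E & ss_norm X (f k) / 8 <= pairing (f k) (p.1 \o f k)]).
(* Halving brings the norming function from radius 2 to radius 1, so the constant [1/8] becomes
   [1/16]. *)
pose g k t := 2^-1 * (p k).1 (f k t).
have mf k := ss_measurable (Xf k).
have mg k : mfun01 (g k).
  have [mp _ _ _ _] := Hp k; apply: mfun01M; first exact: mfun01_cst.
  exact: (measurableT_comp mp (mf k)).
have Hg k : dual_le X 1 (g k).
  have [_ _ H _ _] := Hp k; have := dual_leZ 2^-1 H.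
  by rewrite ger0_norm ?invr_ge0// mulVf.
have ig : independent g.
  apply: (@independent_comp R _ f (fun k r => 2^-1 * (p k).1 r)) => // k.
  by have [mp _ _ _ _] := Hp k; exact: measurable_funM.
have gV k t : g k t \in [seq 2^-1 * r | r <- (p k).2].
  by apply: map_f; have [_ pV _ _ _] := Hp k; exact: pV.
have gm k : mean (g k) = 0.
  have [mp pV _ p0 _] := Hp k; have bp : bounded01 ((p k).1 \o f k).
    apply: (@bounded01_comp R id ((p k).1 \o f k) (p k).2); first exact: measurable_id.
      exact: (measurableT_comp mp (mf k)).
    by move=> t; exact: pV.
  rewrite (meanZ _ bp).
  by rewrite /mean [int01 _]p0 mulr0.
have fg k : ss_norm X (f k) / 16 <= pairing (f k) (g k).
  have [_ _ H _ h] := Hp k.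
  have -> : pairing (f k) (g k) = 2^-1 * pairing (f k) ((p k).1 \o f k).
    rewrite -[RHS]addr0 -[X in _ + X](mul0r (pairing (f k) ((p k).1 \o f k))).
    rewrite -(pairing_linr _ _ (Xf k) H H); congr pairing; apply/funext => t.
    by rewrite mul0r addr0.
  by clear -h; lra.
(* The norms of the [f k] are bounded below only, so each column is normalised by its own norm. *)
pose A : 'M[R]_N := \matrix_(j, k) (pairing (v k) (g j) / ss_norm X (f k)).
have rA : (\rank A <= n)%N.
  have -> : A = (\matrix_(j < N, i < n) pairing (e i) (g j)) *m (\matrix_(i < n, k < N) (c k i / ss_norm X (f k))).
    apply/matrixP => j k; rewrite !mxE (pairing_suml _ _ (Hg j) Xe) mulr_suml.
    by apply: eq_bigr => i _; rewrite !mxE; ring.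
  by apply: leq_trans (mulmx_max_rank _ _) _.
(* Replacing [f k] by [v k] changes the diagonal pairing by at most [gamma], hence by at most
   [gamma] times the norm of [f k]. *)
have trA : N%:R * (16^-1 - gamma) <= \tr A.
  have -> : N%:R * (16^-1 - gamma) = \sum_(k < N) (16^-1 - gamma).
    by rewrite sumr_const card_ord mulr_natl.
  apply: ler_sum => k _; rewrite mxE ler_pdivlMr//.
  have -> : pairing (v k) (g k) = pairing (f k) (g k) - pairing (f k \- v k) (g k).
    rewrite (_ : f k \- v k = fun t => 1 * f k t + (-1) * v k t); last first.
      by apply/funext => t /=; rewrite mul1r mulN1r.
    by rewrite (pairing_lin _ _ (Xf k) (Xv k) (Hg k)) mul1r mulN1r opprB addrCA subrr addr0.
  have h1 := pairing_le (ss_sub (Xf k) (Xv k)) (Hg k); rewrite mul1r in h1.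
  have h2 := hv k; have h3 := fg k; have h4 := ler_norm (pairing (f k \- v k) (g k)).
  have h5 : gamma <= gamma * ss_norm X (f k) by rewrite ler_peMr// ltW.
  rewrite mulrBl; rewrite -/(v k) in h2; clear -h1 h2 h3 h4 h5; lra.
(* The column serves as its own coefficients: pairing [v k] with [\sum_j A j k * g j] gives [S]
   times the norm of [f k], at most [K * sqrt S] times the norm of [v k], which is at most twice
   that of [f k]. *)
have colA k : \sum_j A j k ^+ 2 <= 4 * K ^+ 2.
  set S := \sum_j _.
  have S0 : 0 <= S by apply: sumr_ge0 => j _; exact: sqr_ge0.
  have HS := HK N g _ (fun j => A j k) ig mg gV Hg gm; rewrite -/S in HS.
  have h1 := pairing_le (Xv k) HS.
  have h2 : pairing (v k) (fun t => \sum_(j < N) A j k * g j t) = S * ss_norm X (f k).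
    rewrite (pairing_sumr _ _ (Xv k) Hg) /S mulr_suml; apply: eq_bigr => j _.
    have -> : pairing (v k) (g j) = A j k * ss_norm X (f k).
      by rewrite mxE divfK// gt_eqF.
    by rewrite mulrA expr2.
  have h3 : ss_norm X (v k) <= 2 * ss_norm X (f k).
    have h := ss_norm_triangle (ss_sub (Xv k) (Xf k)) (Xf k).
    rewrite (_ : (v k \- f k) \+ f k = v k) in h; last first.
      by apply/funext => t /=; rewrite subrK.
    rewrite (ss_norm_sub (Xv k) (Xf k)) in h.
    have h4 := hv k; have h5 := f1 k; rewrite -/(v k) in h4.
    by clear -h h4 h5 g1; lra.
  rewrite h2 ger0_norm in h1; last by rewrite mulr_ge0// ltW.
  have q0 : 0 <= Num.sqrt S by exact: sqrtr_ge0.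
  have h4 : S <= K * Num.sqrt S * 2.
    rewrite -(ler_pM2r (nf0 k)); apply: le_trans h1 _.
    by rewrite -[leRHS]mulrA ler_wpM2l// mulr_ge0.
  have SE := sqr_sqrtr S0; rewrite -{1}SE in h4; rewrite -SE.
  have [q1|q1] := eqVneq (Num.sqrt S) 0.
    by rewrite q1 expr0n mulr_ge0// sqr_ge0.
  have h5 : Num.sqrt S <= 2 * K.
    have q2 : 0 < Num.sqrt S by rewrite lt_neqAle eq_sym q1.
    by rewrite -(ler_pM2r q2) -expr2; clear -h4; lra.
  have -> : 4 * K ^+ 2 = (2 * K) ^+ 2 by ring.
  by rewrite ler_sqr ?nnegrE// mulr_ge0.
have HSA : \sum_j \sum_k A j k ^+ 2 <= 4 * K ^+ 2 * N%:R.
  rewrite exchange_big /= mulr_natr -[X in _ *+ X]card_ord -sumr_const.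
  by apply: ler_sum => k _; exact: colA.
have N0' : 0 < N%:R :> R by rewrite ltr0n.
have := le_trans trA (trace_le_sqrt_rank A).
rewrite -sqrtrM// => h.
have h0 : 0 <= N%:R * (16^-1 - gamma) by rewrite mulr_ge0//; clear -g1; lra.
have hh : (N%:R * (16^-1 - gamma)) ^+ 2 <= (\rank A)%:R * \sum_j \sum_k A j k ^+ 2.
  rewrite -[leRHS]sqr_sqrtr; last first.
    by rewrite mulr_ge0//; do 2 (apply: sumr_ge0 => ? _); exact: sqr_ge0.
  by rewrite ler_sqr ?nnegrE.
have h2 : (\rank A)%:R * (\sum_j \sum_k A j k ^+ 2) <= (gamma * N%:R) * (4 * K ^+ 2 * N%:R).
  apply: ler_pM => //.
    by do 2 (apply: sumr_ge0 => ? _); exact: sqr_ge0.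
  by apply: le_trans n_le; rewrite ler_nat.
(* [1/16 - gamma] is at least [1/32]. *)
have h3 : (N%:R * 32^-1) ^+ 2 <= (N%:R * (16^-1 - gamma)) ^+ 2.
  rewrite ler_sqr ?nnegrE//.
  by apply: ler_wpM2l => //; clear -g1; lra.
have h4 : (N%:R * 32^-1) ^+ 2 <= (gamma * (4 * K ^+ 2)) * N%:R ^+ 2.
  apply: le_trans h3 (le_trans hh (le_trans h2 _)).
  by rewrite le_eqVlt; apply/orP; left; apply/eqP; ring.
rewrite exprMn mulrC ler_pM2r ?exprn_gt0// in h4.
have h5 : gamma * K ^+ 2 <= 8192^-1 by rewrite -gK mulrDr mulr1 lerDl ltW.
move: h4; rewrite mulrCA expr2; clear -h5; lra.
Qed.
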